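(* Let $\mu_0$ be a Borel probability measure on $L^2$ which is invariant for $\{S(t)\}_{t\in\mathbb{R}}$ and satisfies $$\int_{L^2}\|\zeta\|_{H^1}^2\,\mathrm{d}\mu_0(\zeta)<\infty .$$ Then $\mu_0(H^1\cap E)=1$. In particular, $\mathrm{spt}(\mu_0)\subset E$.
   Context: Let $d\ge2$ and let $\mathbb{T}^d=[0,2\pi]^d$ be the periodic torus. $L^2$ is the space of real-valued, mean-zero, square-integrable functions on $\mathbb{T}^d$, and $H^1$ is the Sobolev space of mean-zero functions with norm $\|\varphi\|_{H^1}=\|(-\Delta)^{1/2}\varphi\|_{L^2}$ (set to $+\infty$ if $\varphi\notin H^1$). $\boldsymbol{u}:\mathbb{T}^d\to\mathbb{R}^d$ is a fixed, time-independent, Lipschitz, divergence-free vector field, with flow map $\Phi_t$ defined by $\frac{\mathrm{d}}{\mathrm{d}t}\Phi_t(x)=\boldsymbol{u}(\Phi_t(x))$, $\Phi_0(x)=x$. $\{S(t)\}_{t\in\mathbb{R}}$ is the unitary group on $L^2$ solving $\partial_t f+\boldsymbol{u}\cdot\nabla f=0$, $f(0)=f_0$, i.e. $S(t)f_0(x)=f_0(\Phi_{-t}(x))$. A Borel probability measure $\mu_0$ on $L^2$ is invariant for $S(t)$ if $\mu_0(A)=\mu_0(S(t)A)$ for all Borel $A\subset L^2$ and all $t\in\mathbb{R}$. The support $\mathrm{spt}(\mu_0)$ is the intersection of all closed sets of $\mu_0$-measure one. $$E=\overline{\mathrm{span}\{\varphi\in H^1:\ \boldsymbol{u}\cdot\nabla\varphi=i\lambda\varphi,\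 \lambda\in\mathbb{R}\}}^{L^2}.$$ Since eigenfunctions may be complex-valued, $E$ is taken in the complexification of $L^2$ (which contains $L^2$); intersection with $E$ and inclusion in $E$ are understood accordingly. *)

(* Defs.v *)
From HB Require Import structures.
From mathcomp Require Import all_boot all_order all_algebra.
From mathcomp Require Import complex.
From mathcomp Require Import all_classical all_reals all_analysis.
From mathcomp Require Import measurable_realfun.

Set Implicit Arguments.
Unset Strict Implicit.
Unset Printing Implicit Defensive.
Import Order.TTheory GRing.Theory Num.Theory.
Import numFieldNormedType.Exports.

Local Open Scope classical_set_scope.
Local Open Scope ring_scope.

Definition rV_display : measure_display.
Proof. exact: default_measure_display. Qed.

Section measurable_rV.
Variables (R : realType) (n : nat).

Let coor : 'I_n -> 'rV[R]_n -> R := fun i x => x ord0 i.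

Let rV_set0 : g_sigma_preimage coor set0.
Proof. exact: sigma_algebra0. Qed.

Let rV_setC A : g_sigma_preimage coor A -> g_sigma_preimage coor (~` A).
Proof. exact: sigma_algebraC. Qed.

Let rV_bigcup (F : _^nat) : (forall i, g_sigma_preimage coor (F i)) ->
  g_sigma_preimage coor (\bigcup_i (F i)).
Proof. exact: sigma_algebra_bigcup. Qed.

HB.instance Definition _ := @isMeasurable.Build rV_display
  'rV[R]_n (g_sigma_preimage coor) rV_set0 rV_setC rV_bigcup.

Lemma measurable_coor (i : 'I_n) :
  measurable_fun [set: 'rV[R]_n] (fun x : 'rV[R]_n => x ord0 i).
Proof.
move=> _ Y mY; rewrite setTI; apply: sub_sigma_algebra => /=.
rewrite -bigcup_seq/=; exists i => /=; first by rewrite mem_index_enum.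
by exists Y => //; rewrite setTI.
Qed.

Lemma measurable_fun_rV d (T : measurableType d) (f : T -> 'rV[R]_n) :
  (forall i, measurable_fun [set: T] (fun t => f t ord0 i)) ->
  measurable_fun [set: T] f.
Proof.
move=> mf; apply: (@measurability _ _ _ _ _ _ (\big[setU/set0]_(i < n)
  preimage_set_system setT (coor i) measurable)) => //.
move=> _ [B + <-].
rewrite -bigcup_seq => -[i _ [A mA <-]].
by have := mf i measurableT A mA; rewrite setTI setTI setTI.
Qed.

End measurable_rV.

(* The torus is R^d / (2 pi Z)^d.  Its points are represented in the cube
   [0, 2 pi]^d, and [torus R d] is Lebesgue measure on 'rV[R]_d restricted to
   this cube, obtained as an iterated product of the one-dimensional measure. *)
Section torus_measure.
Variable R : realType.

Lemma circle_lty : (lebesgue_measure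
  ([set` `[0%R, (pi *+ 2)%R]] : set (measurableTypeR R)) < +oo)%E.
Proof. by rewrite lebesgue_measure_itv; case: ifP => // _; rewrite ltry. Qed.

Definition circle : {finite_measure set (measurableTypeR R) -> \bar R} :=
  [the {finite_measure set (measurableTypeR R) -> \bar R} of
   @mfrestr _ (measurableTypeR R) R _
     (lebesgue_measure : {measure set (measurableTypeR R) -> \bar R})
     (measurable_itv `[0%R, (pi *+ 2)%R]) circle_lty].

Definition consrV n (p : measurableTypeR R * 'rV[R]_n) : 'rV[R]_n.+1 :=
  row_mx (const_mx p.1 : 'rV[R]_1) p.2.

Lemma measurable_consrV n : measurable_fun [set: _] (@consrV n).
Proof.
apply: measurable_fun_rV => i; rewrite /consrV.
case: (@split_ordP 1 n i) => j ->.
  rewrite (_ : (fun _ => _) = fst); first exact: measurable_fst.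
  by apply/funext => p; apply: etrans (row_mxEl _ _ _ _) _; rewrite mxE.
rewrite (_ : (fun _ => _) = (fun x : 'rV[R]_n => x ord0 j) \o snd).
  exact: (measurableT_comp (measurable_coor j) measurable_snd).
by apply/funext => p; exact: row_mxEr.
Qed.

Section cons_measure.
Variables (n : nat) (m : {finite_measure set 'rV[R]_n -> \bar R}).

Definition cons_measure : set 'rV[R]_n.+1 -> \bar R :=
  pushforward (circle \x m)%E (@consrV n).

HB.instance Definition _ := Measure.copy cons_measure
  (measure_function_pushforward__canonical__measure_function_Measure
    (circle \x m)%E (@measurable_consrV n)).

Let cons_measure_fin : fin_num_fun cons_measure.
Proof.
move=> A mA; rewrite ge0_fin_numE ?measure_ge0//.
pose cm : measure _ R := [the measure _ _ of (circle \x m)%E].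
have mA' : measurable (@consrV n @^-1` A).
  by rewrite -[X in measurable X]setTI; exact: measurable_consrV.
apply: (@le_lt_trans _ _ (cm setT)).
  by apply: (@le_measure _ _ _ cm); rewrite ?inE.
rewrite -setXTT [ltLHS](product_measure1E circle m measurableT measurableT).
by rewrite lte_mul_pinfty ?measure_ge0 ?fin_num_measure// -ge0_fin_numE
  ?measure_ge0// fin_num_measure.
Qed.

HB.instance Definition _ :=
  Measure_isFinite.Build _ _ _ cons_measure cons_measure_fin.

End cons_measure.

Fixpoint torus n : {finite_measure set 'rV[R]_n -> \bar R} :=
  match n with
  | 0 => \d_(0 : 'rV[R]_0)
  | n'.+1 => cons_measure (torus n')
  end.

End torus_measure.


Section L2_space.
Variables (R : realType) (d : nat).
Notation mu := (torus R d).
Notation T := 'rV[R]_d.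

(* Classes of real-valued square-integrable functions with mean zero. *)
Record L2 := MkL2 {
  L2val :> LspaceType mu (lee1n 2);
  L2_mean0 : \int[mu]_x (L2val : T -> R) x = 0
}.

Definition is_L2 (h : T -> R) :=
  h \in Lfun mu 2%:E /\ \int[mu]_x h x = 0.

Lemma L2_measurable (f : L2) : measurable_fun [set: T] (f : T -> R).
Proof.
exact: (@measurable_funPT _ _ T (measurableTypeR R)
          (repr (f : {mfun_ mu, T >-> measurableTypeR R}))).
Qed.

Lemma L2_is_L2 (f : L2) : is_L2 f.
Proof.
split; last exact: L2_mean0.
rewrite inE; apply/andP; split; rewrite inE/=; first exact: L2_measurable.
exact: Lebesgue_finite.
Qed.

Lemma L2_ae_inj (f g : L2) : {ae mu, forall x, f x = g x} -> f = g.
Proof.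
case: f g => -[f [[Hf]]] Mf [[g [[Hg]]] Mg] /= fg.
have ? : f = g.
  rewrite -[f]reprK -[g]reprK; apply/eqP; rewrite eqmodE; apply/asboolP.
  by apply: filterS fg => x fgx _; exact: fgx.
subst g; rewrite (Prop_irrelevance Hg Hf) in Mg *.
by rewrite (Prop_irrelevance Mg Mf).
Qed.

Lemma Lnorm_ae_eq (f g : T -> R) :
  measurable_fun [set: T] f -> measurable_fun [set: T] g ->
  {ae mu, forall x, f x = g x} ->
  ('N[mu]_2%:E[EFin \o f] = 'N[mu]_2%:E[EFin \o g])%E.
Proof.
move=> mf mg fg; rewrite unlock /Lnorm; congr (_ `^ _)%E.
apply: ge0_ae_eq_integral => //.
- apply/measurable_EFinP.
  apply/(@measurableT_comp _ _ _ _ _ _ (fun x : R => x `^ 2)%R) => //.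
  exact/measurableT_comp.
- apply/measurable_EFinP.
  apply/(@measurableT_comp _ _ _ _ _ _ (fun x : R => x `^ 2)%R) => //.
  exact/measurableT_comp.
- by move=> x _; exact: poweR_ge0.
- by move=> x _; exact: poweR_ge0.
- by apply: filterS fg => x /= -> _.
Qed.

Lemma Rintegral_ae_eq (f g : T -> R) :
  measurable_fun [set: T] f -> measurable_fun [set: T] g ->
  {ae mu, forall x, f x = g x} ->
  \int[mu]_x f x = \int[mu]_x g x.
Proof.
move=> mf mg fg; congr fine; apply: ae_eq_integral => //.
- exact/measurable_EFinP.
- exact/measurable_EFinP.
- by apply: filterS fg => x /= -> _.
Qed.

Lemma L2_exists (h : T -> R) :
  is_L2 h -> exists f : L2, {ae mu, forall x, f x = h x}.
Proof.
move=> [hL h0].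
have mh : measurable_fun setT h := set_mem (sub_Lfun_mfun hL).
pose hm : {mfun T >-> measurableTypeR R} :=
  HB.pack h (isMeasurableFun.Build _ _ _ (measurableTypeR R) h mh).
pose q : {mfun_ mu, T >-> measurableTypeR R} :=
  (\pi_({mfun_ mu, T >-> measurableTypeR R}) hm)%qT.
have qh : {ae mu, forall x, q x = h x}.
  have : (repr q == hm %[mod {mfun_ mu, T >-> measurableTypeR R}])%qT.
    by rewrite reprK.
  rewrite eqmodE => /asboolP.
  by apply: filterS => x /(_ I).
have mq : measurable_fun setT (q : T -> R).
  exact: (@measurable_funPT _ _ T (measurableTypeR R) (repr q)).
have qfin : finite_norm mu 2 q.
  rewrite /finite_norm (Lnorm_ae_eq mq mh qh).
  by have := set_mem (sub_Lfun_finLfun hL).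
pose Q : LspaceType mu (lee1n 2) := HB.pack q (isFinLebesgue.Build _ _ _ _ _ (lee1n 2) q qfin).
have Q0 : \int[mu]_x (Q : T -> R) x = 0 by rewrite (Rintegral_ae_eq mq mh qh).
by exists (MkL2 Q0).
Qed.
Lemma is_L2_integrable (h : T -> R) : is_L2 h -> mu.-integrable setT (EFin \o h).
Proof.
move=> [hL _]; apply/Lfun1_integrable; apply: Lfun_subset12 hL => //.
exact: fin_num_measure.
Qed.

Lemma is_L2_0 : is_L2 (cst 0).
Proof.
split; last by rewrite /Rintegral integral0.
exact: (Lfun_submod_closed mu (lee1n 2)).1.
Qed.

Lemma is_L2D (f g : T -> R) : is_L2 f -> is_L2 g -> is_L2 (f \+ g).
Proof.
move=> hf hg; split.
  exact: (Lfun_addr_closed mu (lee1n 2)).2 hf.1 hg.1.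
by rewrite RintegralD ?hf.2 ?hg.2 ?addr0//; exact: is_L2_integrable.
Qed.

Lemma is_L2Z c (f : T -> R) : is_L2 f -> is_L2 (fun x => c * f x).
Proof.
move=> hf; split.
  have := (Lfun_submod_closed mu (lee1n 2)).2 c _ _ hf.1 is_L2_0.1.
  by rewrite (_ : c *: f + _ = (fun x => c * f x))//; apply/funext => x; exact: addr0.
by rewrite RintegralZl ?hf.2 ?mulr0//; exact: is_L2_integrable.
Qed.

End L2_space.

Definition L2_zero (R : realType) d : L2 R d := sval (cid (L2_exists (is_L2_0 R d))).

(* The class of [h], when [h] is square integrable with mean zero. *)
HB.lock Definition L2_of (R : realType) d (h : 'rV[R]_d -> R) : L2 R d :=
  if pselect (is_L2 h) is left H then sval (cid (L2_exists H)) else L2_zero R d.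

Canonical L2_of_unlockable := Unlockable L2_of.unlock.

Section L2_normed.
Variables (R : realType) (d : nat).
Notation mu := (torus R d).
Notation T := 'rV[R]_d.

Lemma L2_ofE (h : T -> R) : is_L2 h -> {ae mu, forall x, L2_of h x = h x}.
Proof. by move=> H; rewrite unlock; case: pselect => // H'; case: cid. Qed.

Let ae4 (P Q S U V : T -> Prop) : (forall x, P x -> Q x -> S x -> U x -> V x) ->
  {ae mu, forall x, P x} -> {ae mu, forall x, Q x} -> {ae mu, forall x, S x} ->
  {ae mu, forall x, U x} -> {ae mu, forall x, V x}.
Proof.
move=> PV p q s r; apply: filterS2 (filterI p q) (filterI s r) => x [px qx] [sx rx].
exact: PV.
Qed.

HB.instance Definition _ := gen_eqMixin (L2 R d).
HB.instance Definition _ := gen_choiceMixin (L2 R d).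

Definition L2_add (f g : L2 R d) : L2 R d := L2_of (fun x => f x + g x).
Definition L2_opp (f : L2 R d) : L2 R d := L2_of (fun x => - f x).
Definition L2_scale (c : R) (f : L2 R d) : L2 R d := L2_of (fun x => c * f x).
Definition L2_norm (f : L2 R d) : R := fine ('N[mu]_2%:E[EFin \o (f : T -> R)])%E.

Lemma L2_zeroE : {ae mu, forall x, L2_zero R d x = 0}.
Proof. by rewrite /L2_zero; case: cid. Qed.

Lemma L2_addE f g : {ae mu, forall x, L2_add f g x = f x + g x}.
Proof. exact: L2_ofE (is_L2D (L2_is_L2 f) (L2_is_L2 g)). Qed.

Lemma L2_scaleE c f : {ae mu, forall x, L2_scale c f x = c * f x}.
Proof. exact: L2_ofE (is_L2Z c (L2_is_L2 f)). Qed.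

Lemma L2_oppE f : {ae mu, forall x, L2_opp f x = - f x}.
Proof.
apply: L2_ofE; rewrite (_ : (fun x => - f x) = (fun x => -1 * f x)).
  exact: is_L2Z (L2_is_L2 f).
by apply/funext => x; rewrite mulN1r.
Qed.

Lemma L2_addA : associative L2_add.
Proof.
move=> f g h; apply: L2_ae_inj.
have := L2_addE f (L2_add g h); have := L2_addE g h.
have := L2_addE (L2_add f g) h; have := L2_addE f g.
by apply: ae4 => x fg fgh gh fgh'; rewrite fgh' gh fgh fg addrA.
Qed.

Lemma L2_addC : commutative L2_add.
Proof.
move=> f g; apply: L2_ae_inj; have := L2_addE f g; have := L2_addE g f.
by apply: filterS2 => x -> ->; rewrite addrC.
Qed.

Lemma L2_add0 : left_id (L2_zero R d) L2_add.
Proof.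
move=> f; apply: L2_ae_inj; have := L2_addE (L2_zero R d) f; have := L2_zeroE.
by apply: filterS2 => x f0 ->; rewrite f0 add0r.
Qed.

Lemma L2_addN : left_inverse (L2_zero R d) L2_opp L2_add.
Proof.
move=> f; apply: L2_ae_inj; have := L2_addE (L2_opp f) f; have := L2_zeroE.
by have := L2_oppE f; apply: filterS3 => x fo f0 ->; rewrite fo f0 addNr.
Qed.

HB.instance Definition _ :=
  GRing.isZmodule.Build (L2 R d) L2_addA L2_addC L2_add0 L2_addN.

Lemma L2_scaleA a b f : L2_scale a (L2_scale b f) = L2_scale (a * b) f.
Proof.
apply: L2_ae_inj; have := L2_scaleE a (L2_scale b f); have := L2_scaleE b f.
by have := L2_scaleE (a * b) f; apply: filterS3 => x -> fb ->; rewrite fb mulrA.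
Qed.

Lemma L2_scale1 : left_id 1 L2_scale.
Proof.
by move=> f; apply: L2_ae_inj; have := L2_scaleE 1 f; apply: filterS => x ->;
  rewrite mul1r.
Qed.

Lemma L2_scaleDr : right_distributive L2_scale L2_add.
Proof.
move=> c f g; apply: L2_ae_inj.
have h : {ae mu, forall x, L2_scale c (L2_add f g) x = c * f x + c * g x}.
  apply: filterS2 (L2_scaleE c (L2_add f g)) (L2_addE f g) => x -> ->.
  by rewrite mulrDr.
have := L2_addE (L2_scale c f) (L2_scale c g); move: h.
have := L2_scaleE c f; have := L2_scaleE c g.
by apply: ae4 => x cg cf -> ->; rewrite cf cg.
Qed.

Lemma L2_scaleDl f a b :
  L2_scale (a + b) f = L2_add (L2_scale a f) (L2_scale b f).
Proof.
apply: L2_ae_inj.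
have := L2_addE (L2_scale a f) (L2_scale b f); have := L2_scaleE (a + b) f.
have := L2_scaleE a f; have := L2_scaleE b f.
by apply: ae4 => x bf af -> ->; rewrite bf af mulrDl.
Qed.

HB.instance Definition _ := GRing.Zmodule_isLmodule.Build R (L2 R d)
  L2_scaleA L2_scale1 L2_scaleDr L2_scaleDl.

Lemma L2_normE f : (L2_norm f)%:E = ('N[mu]_2%:E[EFin \o (f : T -> R)])%E.
Proof.
rewrite /L2_norm fineK// fin_numElt (lt_le_trans ltNy0) ?Lnorm_ge0//=.
exact: (@Lebesgue_finite _ _ _ _ _ _ (L2val f)).
Qed.

Lemma L2_normD f g : L2_norm (f + g) <= L2_norm f + L2_norm g.
Proof.
rewrite -lee_fin EFinD !L2_normE.
rewrite (@Lnorm_ae_eq _ _ (f + g) (fun x => f x + g x)).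
- by apply: eminkowski; rewrite ?lee1n//; exact: L2_measurable.
- exact: L2_measurable.
- by apply: measurable_funD; exact: L2_measurable.
- exact: L2_addE.
Qed.

Lemma L2_normZ c f : L2_norm (c *: f) = `|c| * L2_norm f.
Proof.
apply/EFin_inj; rewrite EFinM !L2_normE.
have [_ /andP[fm fL]] := (I, (L2_is_L2 f).1).
have -> := @Lnorm_ae_eq _ _ (c *: f) (c *: (f : T -> R)).
- by rewrite -(LnormZ (Lfun_Sub (lee1n 2) (L2_is_L2 f).1)).
- exact: L2_measurable.
- by apply: measurable_funM => //; exact: L2_measurable.
- exact: L2_scaleE.
Qed.

Lemma L2_norm_eq0 f : L2_norm f = 0 -> f = 0.
Proof.
move=> f0; apply: L2_ae_inj.
have : ('N[mu]_2%:E[EFin \o (f : T -> R)] = 0)%E by rewrite -L2_normE f0.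
move=> /Lnorm_eq0_eq0 => /(_ _ _)/wrap[].
  by apply/measurable_EFinP; exact: L2_measurable.
  by rewrite lte_fin.
by apply: filterS2 L2_zeroE => x x0 /(_ I) [->].
Qed.

HB.instance Definition _ := Lmodule_isNormed.Build R (L2 R d)
  L2_normD L2_normZ L2_norm_eq0.

End L2_normed.

Section vector_fields.
Variables (R : realType) (d : nat).
Notation T := 'rV[R]_d.

Definition periodic2pi (Y : Type) (f : T -> Y) :=
  forall (x : T) (j : 'I_d), f (x + (pi *+ 2) *: delta_mx 0 j) = f x.

Definition pderiv (j : 'I_d) (psi : T -> R) : T -> R :=
  'D_(delta_mx 0 j) psi.

Definition C1_periodic (psi : T -> R) :=
  periodic2pi psi /\
  forall j, (forall x, derivable psi x (delta_mx 0 j)) /\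
            continuous (pderiv j psi).

(* Divergence in the sense of distributions, as [u] is only Lipschitz. *)
Definition divergence_free (u : T -> T) :=
  forall psi, C1_periodic psi ->
    \int[torus R d]_x (\sum_j u x 0 j * pderiv j psi x) = 0.

Definition is_flow (u : T -> T) (Phi : R -> T -> T) :=
  (forall x, Phi 0 x = x) /\
  forall t x, is_derive (t : R^o) (1 : R^o) (Phi ^~ x) (u (Phi t x)).

(* The representative in [0, 2 pi[^d of a point of R^d modulo (2 pi Z)^d. *)
Definition torus_repr (x : T) : T :=
  \row_j (x 0 j - (Num.floor (x 0 j / (pi *+ 2)))%:~R * (pi *+ 2)).

(* The a.e. class of f \o Phi (- t) does not depend on the representative of
   the class [f], because the flow of a divergence-free field preserves
   Lebesgue measure. *)
Definition transport (Phi : R -> T -> T) (t : R) (f : L2 R d) : L2 R d :=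
  L2_of (fun x => f (torus_repr (Phi (- t) x))).

End vector_fields.

Section sobolev.
Variables (R : realType) (d : nat).
Notation T := 'rV[R]_d.
Notation mu := (torus R d).

Definition dotZ (k : 'rV[int]_d) (x : T) : R := \sum_j (k 0 j)%:~R * x 0 j.

Definition normZ (k : 'rV[int]_d) : R := Num.sqrt (\sum_j ((k 0 j)%:~R) ^+ 2).

(* (2 pi)^(-d) times the integral of f(x) exp(- i k.x) *)
Definition fourier (f : L2 R d) (k : 'rV[int]_d) : R[i] :=
  Complex ((\int[mu]_x (f x * cos (dotZ k x))) / (pi *+ 2) ^+ d)
          (- (\int[mu]_x (f x * sin (dotZ k x))) / (pi *+ 2) ^+ d).

(* g = (- Delta)^(1/2) f, the Fourier multiplier with symbol |k| *)
Definition is_sqrt_laplacian (f g : L2 R d) :=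
  forall k, fourier g k = (normZ k)%:C%C * fourier f k.

Definition H1 : set (L2 R d) := [set f | exists g, is_sqrt_laplacian f g].

(* The infimum is over a set with one element if f is in H1, and is +oo
   otherwise. *)
Definition H1norm (f : L2 R d) : \bar R :=
  ereal_inf [set `|g|%:E | g in is_sqrt_laplacian f].

(* g is the weak partial derivative of f *)
Definition is_partial (j : 'I_d) (f g : L2 R d) :=
  forall psi, C1_periodic psi ->
    \int[mu]_x (f x * pderiv j psi x) = - \int[mu]_x (g x * psi x).

(* u . grad f = h almost everywhere *)
Definition is_advection (u : T -> T) (f : L2 R d) (h : T -> R) :=
  exists2 g : 'I_d -> L2 R d, (forall j, is_partial j f (g j)) &
    {ae mu, forall x, \sum_j u x 0 j * g j x = h x}.

End sobolev.

(* The pair (a, b) stands for the complex-valued function a + i b.  The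
   (max) norm of the product is equivalent to the L^2 norm of a + i b, so that
   it gives the same closed sets. *)
Notation L2C R d := (L2 R d * L2 R d)%type.

Section eigenfunctions.
Variables (R : realType) (d : nat).
Implicit Types phi : L2C R d.

Definition cscale (c : R[i]) phi : L2C R d :=
  (complex.Re c *: phi.1 - complex.Im c *: phi.2,
   complex.Re c *: phi.2 + complex.Im c *: phi.1).

Definition cspan (A : set (L2C R d)) : set (L2C R d) :=
  [set f | exists n (c : 'I_n -> R[i]) (phi : 'I_n -> L2C R d),
     (forall i, A (phi i)) /\ f = \sum_i cscale (c i) (phi i)].

(* u . grad (a + i b) = i lambda (a + i b) *)
Definition eigenfunction (u : 'rV[R]_d -> 'rV[R]_d) (lambda : R) phi :=
  is_advection u phi.1 (fun x => - (lambda * phi.2 x)) /\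
  is_advection u phi.2 (fun x => lambda * phi.1 x).

Definition spaceE (u : 'rV[R]_d -> 'rV[R]_d) : set (L2C R d) :=
  closure (cspan [set phi | [/\ H1 phi.1, H1 phi.2 &
                              exists lambda, eigenfunction u lambda phi]]).

Definition complexify (f : L2 R d) : L2C R d := (f, 0).

End eigenfunctions.

Section measures.
Variables (R : realType) (d : nat).

Definition borelL2 := g_sigma_algebraType (@open (L2 R d)).

Definition invariant_measure (mu0 : probability borelL2 R)
    (S : R -> L2 R d -> L2 R d) :=
  forall (A : set borelL2) (t : R), measurable A -> mu0 A = mu0 (S t @` A).

Definition spt (mu0 : probability borelL2 R) : set (L2 R d) :=
  \bigcap_(C in [set C : set (L2 R d) | closed C /\ mu0 C = 1%E]) C.

End measures.

(* Main.v *)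
Require Import Defs.
From HB Require Import structures.
From mathcomp Require Import all_boot all_order all_algebra.
From mathcomp Require Import complex.
From mathcomp Require Import all_classical all_reals all_analysis.
From mathcomp Require Import measurable_realfun.
From mathcomp Require Import ring lra.
Set Implicit Arguments.
Unset Strict Implicit.
Unset Printing Implicit Defensive.
Import Order.TTheory GRing.Theory Num.Theory.
Import numFieldNormedType.Exports.
Local Open Scope classical_set_scope.
Local Open Scope ring_scope.

(** The operator A is unbounded, and it is diagonalised only on finite-dimensional spaces that the
    second moment of mu0 places inside H^1. There it is a real antisymmetric matrix, and complex
    scalars enter only at this point; everything before is real. The relation between B and A is
    first obtained on the Fourier basis, whose functions can be differentiated explicitly along the
    flow, and then extended to eigenvectors by expansion. As u is merely Lipschitz and its
    divergence vanishes only weakly, volume preservation is not read off a Jacobian. It is derived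
    from the vanishing of the time derivative of the integral of f o Phi_t. This function is only
    Lipschitz, hence no test function for the divergence, and mollifying it must cost at most e |h|
    in a time step h, with e arbitrarily small; a bound on the first moment of the kernel provides
    this. Statements on almost every zeta are reduced to countably many, one for each basis vector.
    The H^1 norm enters through its Fourier series, which is measurable in zeta. *)

(* Let B(f, g) be the mu0-integral of <f, zeta> <g, zeta>, a positive bilinear
   form of trace class because zeta has finite second moment. Its eigenspaces
   with positive eigenvalue are finite dimensional, and lie in H^1 because zeta
   has finite second moment in H^1. Differentiating the invariance of mu0 along
   the flow shows that B commutes with A = u . grad, so A maps each of these
   eigenspaces to itself. There A is antisymmetric, since u is divergence free,
   hence diagonalisable over the complex numbers with imaginary eigenvalues:
   the eigenspaces lie in E. By compactness B vanishes on the orthogonal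
   complement of all its eigenspaces, so almost every zeta is orthogonal to that
   complement and thus belongs to the closed space E. That S(t) is unitary
   follows from the invariance of Lebesgue measure under the flow of the
   Lipschitz field u, obtained by mollifying with trigonometric kernels. *)

(** * Trigonometric polynomials *)

Section step_approximation.
Variable R : realType.

Lemma bernoulli_add (y : R) n : 0 <= y -> 1 + n%:R * y <= (1 + y) ^+ n.
Proof.
move=> y0; elim: n => [|n IH]; first by rewrite mul0r addr0 expr0.
rewrite exprS; apply: (@le_trans _ _ ((1 + y) * (1 + n%:R * y))).
  have := mulr_ge0 (ler0n R n) (mulr_ge0 y0 y0).
  rewrite -natr1; nra.
by rewrite ler_wpM2l// addr_ge0.
Qed.

Lemma bernoulli_sub (y : R) n : 0 <= y <= 1 -> 1 - n%:R * y <= (1 - y) ^+ n.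
Proof.
move=> /andP[y0 y1]; elim: n => [|n IH]; first by rewrite mul0r subr0 expr0.
rewrite exprS; apply: (@le_trans _ _ ((1 - y) * (1 - n%:R * y))).
  have := mulr_ge0 (ler0n R n) (mulr_ge0 y0 y0).
  rewrite -natr1; nra.
by rewrite ler_wpM2l// subr_ge0.
Qed.

Lemma cvg_natM_geometric (r : R) : 0 <= r < 1 ->
  (fun n => n%:R * r ^+ n) @ \oo --> (0 : R).
Proof.
move=> /andP[r0 r1]; have [->|rn0] := eqVneq r 0.
  apply: (@cvg_trans _ ((fun=> 0 : R) @ \oo)); last exact: cvg_cst.
  apply: near_eq_cvg; near=> n; rewrite expr0n.
  have -> : (n == 0)%N = false by apply/negbTE; rewrite -lt0n; near: n; exists 1.
  by rewrite mulr0.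
have rp : 0 < r by rewrite lt_neqAle eq_sym rn0.
(* Bernoulli for 1 / q = 1 + y gives q^n <= 1 / (n y), hence r^n = q^(2n) <= (n y)^-2: the square
   leaves a power of n to absorb the factor [n%:R]. *)
pose q := Num.sqrt r; have qp : 0 < q by rewrite sqrtr_gt0.
have q2 : q ^+ 2 = r by rewrite sqr_sqrtr.
have q1 : q < 1 by rewrite -(sqrtr1 R) ltr_sqrt.
pose y := q^-1 - 1; have y0 : 0 < y by rewrite subr_gt0 invf_gt1.
(* [harmonic n] is 1 / (n + 1); the factor 2 pays for 1 / n <= 2 / (n + 1) when n > 0. *)
have hn n : n%:R * r ^+ n <= (y ^- 2) * 2 * harmonic n.
  have qE : q = (1 + y)^-1 by rewrite /y addrC subrK invrK.
  have b := bernoulli_add n (ltW y0).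
  have rE : r ^+ n = ((1 + y) ^+ n) ^- 2.
    by rewrite -q2 qE -exprM mulnC exprM exprVn exprVn.
  have [->|n0] := posnP n.
    by rewrite mul0r !mulr_ge0// ?invr_ge0 ?exprn_ge0// ltW.
  rewrite rE; apply: (@le_trans _ _ (n%:R * (n%:R * y) ^- 2)).
    have ny : 0 < n%:R * y by rewrite mulr_gt0 ?ltr0n.
    have nyb : n%:R * y <= (1 + y) ^+ n by apply: le_trans b; rewrite lerDr.
    rewrite ler_wpM2l// lef_pV2; last 2 first.
    - by rewrite posrE; apply: exprn_gt0; exact: lt_le_trans nyb.
    - by rewrite posrE exprn_gt0.
    by rewrite ler_sqr ?nnegrE ?(ltW ny) ?nyb ?(le_trans (ltW ny) nyb).
  have n0' : n%:R != 0 :> R by rewrite pnatr_eq0 -lt0n.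
  have -> : n%:R / (n%:R * y) ^+ 2 = y ^- 2 * n%:R^-1 by field; rewrite n0' gt_eqF.
  rewrite -mulrA; apply: ler_wpM2l; first by rewrite invr_ge0 exprn_ge0// ltW.
  rewrite /harmonic/= ler_pdivlMr ?ltr0n// -natr1 mulrDr mulVf// mulr1.
  have : n%:R^-1 <= 1 :> R by rewrite invf_le1 ?ltr0n// ler1n.
  lra.
apply: (@squeeze_cvgr _ _ _ _ (fun=> 0) (fun n => (y ^- 2) * 2 * harmonic n)).
- by apply: nearW => n; rewrite hn mulr_ge0// exprn_ge0// ltW.
- exact: cvg_cst.
- rewrite -[X in _ --> X](mulr0 ((y ^- 2) * 2)); apply: cvgMr => //.
  exact: cvg_harmonic.
Unshelve. all: by end_near.
Qed.

(* The exponent [n * 2 ^ n] is chosen so that the limit is also [0] at the jump [1 / 2]. *)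
Definition step_approx n (t : R) : R := (1 - t ^+ n) ^+ (n * 2 ^ n).

Lemma step_approx_itv n (t : R) : 0 <= t <= 1 -> 0 <= step_approx n t <= 1.
Proof.
move=> /andP[t0 t1]; have h : 0 <= 1 - t ^+ n <= 1.
  by rewrite subr_ge0 exprn_ile1// gerBl exprn_ge0.
by have /andP[h0 h1] := h; rewrite exprn_ge0// exprn_ile1.
Qed.

(** Put y = t^n and N = n 2^n, so that N y = n (2 t)^n. If t < 1/2 this tends to 0, and Bernoulli
    bounds (1 - y)^N below by 1 - N y. If t >= 1/2 it is at least n, and (1 - y)^N (1 + N y) <= (1 -
    y^2)^N <= 1 bounds the power by 1 / (n + 1). *)
Lemma cvg_step_approx (t : R) : 0 <= t <= 1 ->
  step_approx n t @[n --> \oo] --> ((t < 2^-1)%R%:R : R).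
Proof.
move=> /[dup] t01 /andP[t0 t1].
have expE n : (n * 2 ^ n)%:R * t ^+ n = n%:R * (2 * t) ^+ n :> R.
  by rewrite natrM natrX -mulrA -exprMn.
have tn n : 0 <= t ^+ n <= 1 by rewrite exprn_ge0//= exprn_ile1.
case: ltP => t2.
  apply: (@squeeze_cvgr _ _ _ _ (fun n => 1 - n%:R * (2 * t) ^+ n) (fun=> 1)).
  - apply: nearW => n; rewrite (andP (step_approx_itv n t01)).2 andbT.
    by rewrite -expE; exact: bernoulli_sub.
  - rewrite -[X in _ --> X](subr0 1); apply: cvgB; first exact: cvg_cst.
    by apply: cvg_natM_geometric; lra.
  - exact: cvg_cst.
apply: (@squeeze_cvgr _ _ _ _ (fun=> 0) harmonic).
- apply: nearW => n; rewrite (andP (step_approx_itv n t01)).1/=.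
  set N := (n * 2 ^ n)%N; have y0 := tn n; set y := t ^+ n in y0 *.
  have nN : n%:R <= N%:R * y.
    rewrite expE ler_peMr// exprn_ege1//; lra.
  have h : step_approx n t * (1 + N%:R * y) <= 1.
    rewrite /step_approx -/N -/y; apply: (@le_trans _ _ ((1 - y) ^+ N * (1 + y) ^+ N)).
      by rewrite ler_wpM2l ?bernoulli_add ?exprn_ge0//; lra.
    by rewrite -exprMn exprn_ile1//; nra.
  rewrite /harmonic/= -[leRHS]mul1r ler_pdivlMr// -natr1 addrC.
  apply: le_trans h; rewrite ler_wpM2l//; first exact: (andP (step_approx_itv n t01)).1.
  lra.
- exact: cvg_cst.
- exact: cvg_harmonic.
Qed.

(* [s |-> cos (s - b / 2) - cos (b / 2)] is positive exactly on the arc ]0, b[. *)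
Lemma cos_arc (b s : R) : 0 < b <= pi *+ 2 -> 0 <= s < pi *+ 2 ->
  (cos (b / 2) < cos (s - b / 2)) = (0 < s < b).
Proof.
move=> /andP[b0 b2] /andP[s0 s2]; rewrite -subr_gt0.
have -> : cos (s - b / 2) - cos (b / 2) = 2 * (sin (s / 2) * sin ((b - s) / 2)).
  have -> : s - b / 2 = s / 2 - (b - s) / 2 by field.
  have -> : b / 2 = s / 2 + (b - s) / 2 by field.
  by rewrite cosB cosD; ring.
rewrite pmulr_rgt0//; have [->|sn0] := eqVneq s 0.
  by rewrite mul0r sin0 mul0r !ltxx.
have sp : 0 < s by rewrite lt_neqAle eq_sym sn0.
have p0 := pi_gt0 R.
rewrite sp/= pmulr_rgt0; last by apply: sin_gt0_pi; lra.
have [bs|] := ltP s b; first by apply: sin_gt0_pi; lra.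
rewrite le_eqVlt => /predU1P[->|bs]; first by rewrite subrr mul0r sin0 ltxx.
apply/negbTE; rewrite -leNgt -oppr_ge0 -sinN ltW//; apply: sin_gt0_pi; lra.
Qed.

(** The difference of cosines, positive exactly on the arc, lies in [-2, 2]. Dividing it by 8 and
    subtracting from 1/2 gives an argument for [step_approx] that stays in [0, 1] and is below 1/2
    exactly on the arc. *)
Definition arc_arg (b s : R) : R := 2^-1 - (cos (s - b / 2) - cos (b / 2)) / 8.

Lemma arc_arg_itv b s : 0 <= arc_arg b s <= 1.
Proof.
rewrite /arc_arg.
have := (cos_le1 (s - b / 2), cos_geN1 (s - b / 2), cos_le1 (b / 2), cos_geN1 (b / 2)).
by move=> [[[? ?] ?] ?]; apply/andP; split; lra.
Qed.

(* On [0, 2 pi[ this tends to the indicator of ]-oo, b[; the two arcs used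
   are ]0, 2 pi[ and ]0, b[. *)
Definition ray_approx (b : R) n (s : R) : R :=
  if b <= 0 then 0 else if pi *+ 2 <= b then 1 else
  1 - step_approx n (arc_arg (pi *+ 2) s) + step_approx n (arc_arg b s).

Lemma ray_approx_itv b n s : 0 <= ray_approx b n s <= 2.
Proof.
rewrite /ray_approx; case: ifP => _; first by lra.
case: ifP => _; first by lra.
have := step_approx_itv n (arc_arg_itv b s).
have := step_approx_itv n (arc_arg_itv (pi *+ 2) s); lra.
Qed.

Lemma cvg_ray_approx (b s : R) : 0 <= s < pi *+ 2 ->
  ray_approx b n s @[n --> \oo] --> ((s < b)%R%:R : R).
Proof.
move=> /[dup] s02 /andP[s0 s2]; rewrite /ray_approx; case: (boolP (b <= 0)) => [b0|].
  by rewrite ltNge (le_trans b0)//; exact: cvg_cst.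
rewrite -ltNge => b0; case: (boolP (_ <= b)) => [b2|].
  by rewrite (lt_le_trans s2)//; exact: cvg_cst.
rewrite -ltNge => b2.
have arcE (c : R) : 0 < c <= pi *+ 2 -> (arc_arg c s < 2^-1) = (0 < s < c).
  by move=> c0; rewrite -cos_arc// /arc_arg; apply/idP/idP; lra.
(* The arc ]0, 2 pi[ misses only s = 0, so 1 minus its indicator restores the one point that ]0, b[
   leaves out. *)
have -> : (s < b)%R%:R = 1 - (arc_arg (pi *+ 2) s < 2^-1)%R%:R + (arc_arg b s < 2^-1)%R%:R :> R.
  rewrite arcE; last by rewrite lexx mulrn_wgt0 ?pi_gt0.
  rewrite arcE; last by rewrite b0 ltW.
  rewrite s2 andbT.
  have [_|] := ltP 0 s; first by rewrite subrr add0r.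
  by move=> s0'; rewrite (le_lt_trans s0' b0) subr0 addr0.
by apply: cvgD; [apply: cvgB; first exact: cvg_cst|]; apply: cvg_step_approx;
  exact: arc_arg_itv.
Qed.

End step_approximation.

(** * A monotone class theorem for real trigonometric polynomials *)

Section trigpoly.
Variables (R : realType) (d : nat).
Notation T := 'rV[R]_d.
Implicit Types (f g : T -> R) (k : 'rV[int]_d) (x y : T).

Lemma dotZ0 x : dotZ 0 x = 0.
Proof. by rewrite /dotZ big1// => j _; rewrite mxE mul0r. Qed.

Lemma dotZDl k l x : dotZ (k + l) x = dotZ k x + dotZ l x.
Proof.
by rewrite /dotZ -big_split; apply: eq_bigr => j _; rewrite mxE intrD mulrDl.
Qed.

Lemma dotZNl k x : dotZ (- k) x = - dotZ k x.
Proof.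
by rewrite /dotZ -sumrN; apply: eq_bigr => j _; rewrite mxE mulrNz mulNr.
Qed.

Lemma dotZDr k x y : dotZ k (x + y) = dotZ k x + dotZ k y.
Proof. by rewrite /dotZ -big_split; apply: eq_bigr => j _; rewrite mxE mulrDr. Qed.

Lemma dotZZr k c x : dotZ k (c *: x) = c * dotZ k x.
Proof. by rewrite /dotZ mulr_sumr; apply: eq_bigr => j _; rewrite mxE mulrCA. Qed.

Lemma dotZNr k x : dotZ k (- x) = - dotZ k x.
Proof. by rewrite /dotZ -sumrN; apply: eq_bigr => j _; rewrite mxE mulrN. Qed.

Lemma dotZ_delta (j : 'I_d) x : dotZ (delta_mx 0 j) x = x 0 j.
Proof.
rewrite /dotZ (bigD1 j)//= mxE !eqxx mul1r big1 ?addr0// => i ij.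
by rewrite mxE (negbTE ij) andbF mul0r.
Qed.

Lemma dotZ_delta_mx k (j : 'I_d) : dotZ k (delta_mx 0 j : T) = (k 0 j)%:~R.
Proof.
rewrite /dotZ (bigD1 j)//= mxE !eqxx mulr1 big1 ?addr0// => i ij.
by rewrite mxE (negbTE ij) andbF mulr0.
Qed.

Lemma measurable_dotZ k : measurable_fun [set: T] (dotZ k).
Proof.
apply: measurable_sum => j; apply: measurable_funM => //; exact: measurable_coor.
Qed.

(** The phase [a] covers the sines, which keeps the algebra real. As an inductive predicate it lets
    bounds, derivatives and integral identities be checked on single waves, without coefficients. *)
Inductive trigpoly : (T -> R) -> Prop :=
| trigpoly_cos k a : trigpoly (fun x => cos (dotZ k x + a))
| trigpolyD f g : trigpoly f -> trigpoly g -> trigpoly (fun x => f x + g x)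
| trigpolyZ c f : trigpoly f -> trigpoly (fun x => c * f x).

Lemma trigpoly_cst c : trigpoly (fun=> c).
Proof.
have := trigpolyZ c (trigpoly_cos 0 0).
by congr trigpoly; apply/funext => x; rewrite dotZ0 addr0 cos0 mulr1.
Qed.

Lemma trigpolyN f : trigpoly f -> trigpoly (fun x => - f x).
Proof.
move=> /(trigpolyZ (-1)); congr trigpoly; apply/funext => x; exact: mulN1r.
Qed.

Lemma trigpolyB f g : trigpoly f -> trigpoly g -> trigpoly (fun x => f x - g x).
Proof. by move=> tf /trigpolyN; exact: trigpolyD. Qed.

Lemma trigpolyM f g : trigpoly f -> trigpoly g -> trigpoly (fun x => f x * g x).
Proof.
elim=> {f}[k a|f f' _ IH _ IH' tg|c f _ IH tg]; last first.
- have := trigpolyZ c (IH tg).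
  by congr trigpoly; apply/funext => x; rewrite mulrA.
- have := trigpolyD (IH tg) (IH' tg).
  by congr trigpoly; apply/funext => x; rewrite mulrDl.
elim=> {g}[l b|g g' _ IH _ IH'|c g _ IH]; last first.
- have := trigpolyZ c IH.
  by congr trigpoly; apply/funext => x; rewrite mulrCA.
- have := trigpolyD IH IH'.
  by congr trigpoly; apply/funext => x; rewrite mulrDr.
have := trigpolyZ 2^-1 (trigpolyD (trigpoly_cos (k + l) (a + b)) (trigpoly_cos (k - l) (a - b))).
congr trigpoly; apply/funext => x; rewrite !dotZDl dotZNl.
have -> : dotZ k x + dotZ l x + (a + b) = (dotZ k x + a) + (dotZ l x + b) by ring.
have -> : dotZ k x - dotZ l x + (a - b) = (dotZ k x + a) - (dotZ l x + b) by ring.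
by rewrite cosD cosB; field.
Qed.

Lemma trigpolyX f n : trigpoly f -> trigpoly (fun x => f x ^+ n).
Proof.
move=> tf; elim: n => [|n IH]; first exact: trigpoly_cst.
by have := trigpolyM tf IH; congr trigpoly; apply/funext => x; rewrite exprS.
Qed.

Lemma trigpoly_prod (I : Type) (s : seq I) (F : I -> T -> R) :
  (forall i, trigpoly (F i)) -> trigpoly (fun x => \prod_(i <- s) F i x).
Proof.
move=> tF; elim: s => [|i s IH].
  have := trigpoly_cst 1; congr trigpoly; apply/funext => x; by rewrite big_nil.
have := trigpolyM (tF i) IH; congr trigpoly; apply/funext => x; by rewrite big_cons.
Qed.

Lemma trigpoly_step_approx n f : trigpoly f -> trigpoly (fun x => step_approx n (f x)).
Proof.
by move=> tf; apply: trigpolyX; apply: trigpolyB; [exact: trigpoly_cst|exact: trigpolyX].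
Qed.

Lemma trigpoly_ray_approx b n (j : 'I_d) : trigpoly (fun x => ray_approx b n (x 0 j)).
Proof.
rewrite /ray_approx; case: (b <= 0); first exact: trigpoly_cst.
case: (_ <= b); first exact: trigpoly_cst.
have targ c : trigpoly (fun x => arc_arg c (x 0 j)).
  apply: trigpolyB; first exact: trigpoly_cst.
  have := trigpolyM (trigpolyB (trigpoly_cos (delta_mx 0 j) (- (c / 2)))
    (trigpoly_cst (cos (c / 2)))) (trigpoly_cst 8^-1).
  by congr trigpoly; apply/funext => x; rewrite dotZ_delta.
apply: trigpolyD; last exact: trigpoly_step_approx.
by apply: trigpolyB; [exact: trigpoly_cst|exact: trigpoly_step_approx].
Qed.

Lemma measurable_trigpoly f : trigpoly f -> measurable_fun [set: T] f.
Proof.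
elim=> {f}[k a|f g _ mf _ mg|c f _ mf].
- apply: (@measurableT_comp _ _ _ _ _ _ (@cos R)).
    by apply: continuous_measurable_fun; exact: continuous_cos.
  by apply: measurable_funD => //; exact: measurable_dotZ.
- exact: measurable_funD.
- exact: measurable_funM.
Qed.

Lemma trigpoly_bounded f : trigpoly f -> exists M, forall x, `|f x| <= M.
Proof.
elim=> {f}[k a|f g _ [M fM] _ [N gN]|c f _ [M fM]].
- by exists 1 => x; rewrite ler_norml cos_geN1 cos_le1.
- by exists (M + N) => x; rewrite (le_trans (ler_normD _ _))// lerD.
- by exists (`|c| * M) => x; rewrite normrM ler_wpM2l.
Qed.

Definition box_approx (b : T) n x := \prod_(j < d) ray_approx (b 0 j) n (x 0 j).

Lemma trigpoly_box_approx b n : trigpoly (box_approx b n).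
Proof. apply: trigpoly_prod => j; exact: trigpoly_ray_approx. Qed.

Lemma box_approx_itv b n x : 0 <= box_approx b n x <= 2 ^+ d.
Proof.
have h (j : 'I_d) := ray_approx_itv (b 0 j) n (x 0 j).
rewrite prodr_ge0/=; last by move=> j _; have /andP[] := h j.
rewrite -[X in _ <= _ ^+ X]card_ord -prodr_const ler_prod//.
Qed.

(** Half-open fundamental domain, where [torus_repr] takes its values. The measure [torus] lives on
    the closed cube; the faces removed here are negligible. *)
Definition cell : set T := [set x | forall j : 'I_d, 0 <= x 0 j < pi *+ 2].

Definition lowerbox (b : T) : set T := [set x | forall j : 'I_d, x 0 j < b 0 j].

Lemma measurable_lowerbox b : measurable (lowerbox b).
Proof.
have -> : lowerbox b = \bigcap_(j in [set: 'I_d]) ((fun x : T => x 0 j) @^-1` `]-oo, b 0 j[%classic).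
  by apply/seteqP; split => x /= h j; have := h j; rewrite /= in_itv/=; auto.
apply: fin_bigcap_measurable => // j _; rewrite -[X in measurable X]setTI.
by apply: measurable_coor => //; exact: measurable_itv.
Qed.

Lemma cvg_box_approx b x : cell x ->
  box_approx b n x @[n --> \oo] --> (\1_(lowerbox b) x : R).
Proof.
move=> cx; rewrite indicE.
have -> : (x \in lowerbox b)%:R = \prod_(j < d) (x 0 j < b 0 j)%R%:R :> R.
  case: (boolP (x \in lowerbox b)) => [|xb].
    by rewrite inE => xb; rewrite big1// => j _; rewrite xb.
  have /existsP[j /negbTE jb] : [exists j, ~~ (x 0 j < b 0 j)].
    rewrite -negb_forall; apply: contra xb => /forallP xb; rewrite inE => j; exact: xb.
  by rewrite (bigD1 j)//= jb mul0r.
rewrite /box_approx; elim: (index_enum _) => [|j s IH].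
  rewrite big_nil; under eq_fun do rewrite big_nil; exact: cvg_cst.
rewrite big_cons; under eq_fun do rewrite big_cons.
by apply: cvgM => //; exact: cvg_ray_approx.
Qed.

(** Dynkin's pi-lambda argument on lower boxes, which are stable under intersection and generate the
    sigma-algebra. Their indicators are bounded limits of trigonometric polynomials, but on [cell]
    only, since the approximants are periodic and the boxes are not; hence the limit hypothesis asks
    for convergence on [cell] alone. *)
Lemma trig_monotone_class (P : (T -> R) -> Prop) :
  (forall f, trigpoly f -> P f) ->
  (forall f g, P f -> P g -> P (fun x => f x - g x)) ->
  (forall (f_ : nat -> T -> R) g (M : R), (forall n, P (f_ n)) ->
    (forall n, measurable_fun [set: T] (f_ n)) -> measurable_fun [set: T] g ->
    (forall n x, `|f_ n x| <= M) ->
    (forall x, cell x -> f_ n x @[n --> \oo] --> (g x : R)) -> P g) ->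
  forall A, measurable A -> P (\1_A).
Proof.
move=> Ptrig PB Plim.
pose G := [set A : set T | exists b, A = lowerbox b].
have GI : setI_closed G.
  move=> _ _ [a ->] [b ->]; exists (\row_j Num.min (a 0 j) (b 0 j)).
  apply/seteqP; split => x /=.
    by move=> [xa xb] j; rewrite mxE lt_min xa xb.
  by move=> h; split => j; have := h j; rewrite mxE lt_min => /andP[].
have mGE : @measurable _ T = <<s G >>.
  apply/seteqP; split; last first.
    apply: smallest_sub; first exact: sigma_algebra_measurable.
    by move=> _ [b ->]; exact: measurable_lowerbox.
  apply: smallest_sub; first exact: smallest_sigma_algebra.
  rewrite -bigcup_seq => A [j _ [B mB <-]]; rewrite setTI.
  suff : <<s @RGenInftyO.G R >> `<=` [set B | <<s G >> ((fun x : T => x 0 j) @^-1` B)].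
    have : @measurable _ (g_sigma_algebraType (@ocitv R)) B by exact: mB.
    by rewrite RGenInftyO.measurableE => mB'; apply.
  apply: smallest_sub.
    have [s0 sC sU] := smallest_sigma_algebra setT G; split => /=.
    - by rewrite preimage_set0.
    - by move=> C GC; rewrite setTD preimage_setC -setTD; exact: sC.
    - by move=> F GF; rewrite preimage_bigcup; exact: sU.
  move=> _ [c ->] /=.
  have -> : (fun x : T => x 0 j) @^-1` `]-oo, c[%classic =
      \bigcup_n lowerbox (\row_i if i == j then c else n%:R).
    apply/seteqP; split => x /=; rewrite in_itv/=; last first.
      by move=> [n _ /(_ j)]; rewrite mxE eqxx.
    move=> xc; pose M := \sum_i `|x 0 i|; exists (Num.truncn M).+1 => // i.
    rewrite mxE; case: ifP => [/eqP ->//|_].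
    apply: le_lt_trans (truncnS_gt M).
    rewrite /M (bigD1 i)//= (le_trans (ler_norm _))// lerDl sumr_ge0//.
  have [_ _ sU] := smallest_sigma_algebra setT G; apply: sU => n.
  by apply: sub_gen_smallest; eexists.
move=> A mA.
have : <<s G >> A by rewrite -mGE.
suff: <<s G >> `<=` [set A | measurable A /\ P \1_A] by move=> h /h[].
have ind1 (C : set T) x : `|\1_C x : R| <= 1.
  by rewrite indicE; case: (x \in C); rewrite ?normr1 ?normr0.
apply: lambda_system_subset => //.
- split => //=.
  + split => //; have := Ptrig _ (trigpoly_cst 1); congr P.
    by apply/funext => x; rewrite indicT.
  + move=> A' B' BA [mA' PA] [mB' PB']; split; first exact: measurableD.
    have := PB _ _ PA PB'; congr P; apply/funext => x; rewrite !indicE in_setD.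
    case: (boolP (x \in B')) => xB /=; last by rewrite subr0 andbT.
    have -> : x \in A' by rewrite inE; apply: BA; rewrite -in_setE.
    by rewrite subrr.
  + move=> F ndF FP; have mU : measurable (\bigcup_n F n).
      by apply: bigcupT_measurable => n; have [] := FP n.
    split => //; apply: (Plim (fun n => \1_(F n)) _ 1).
    * by move=> n; have [] := FP n.
    * by move=> n; apply: measurable_indic; have [] := FP n.
    * exact: measurable_indic.
    * by move=> n x; exact: ind1.
    move=> x _; rewrite indicE; case: (boolP (x \in _)) => [|xU].
      rewrite inE => -[n _ Fnx].
      apply: (@cvg_trans _ ((fun=> 1 : R) @ \oo)); last exact: cvg_cst.
      apply: near_eq_cvg; near=> m; rewrite indicE mem_set//.
      have : F n `<=` F m by apply/subsetPset; apply: ndF; near: m; exists n.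
      exact.
    apply: (@cvg_trans _ ((fun=> 0 : R) @ \oo)); last exact: cvg_cst.
    apply: near_eq_cvg; near=> m; rewrite indicE memNset// => Fx.
    by move: xU; rewrite notin_setE; apply; exists m.
- move=> B [b ->]; have mB := measurable_lowerbox b.
  split => //; apply: (Plim (box_approx b) _ (2 ^+ d)).
  + by move=> n; apply: Ptrig; exact: trigpoly_box_approx.
  + by move=> n; apply: measurable_trigpoly; exact: trigpoly_box_approx.
  + exact: measurable_indic.
  + by move=> n x; rewrite ger0_norm; have /andP[] := box_approx_itv b n x.
  + exact: cvg_box_approx.
Unshelve. all: by end_near.
Qed.

End trigpoly.

Lemma bounded_integrable (dT : measure_display) (T : measurableType dT) (R : realType)
    (m : {finite_measure set T -> \bar R}) (f : T -> R) (M : R) :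
  measurable_fun setT f -> (forall x, `|f x| <= M) -> m.-integrable setT (EFin \o f).
Proof.
move=> mf fM; apply: measurable_bounded_integrable => //.
  by rewrite -ge0_fin_numE ?measure_ge0// fin_num_measure.
by exists M; split; [exact: num_real|move=> B MB x _ /=; rewrite (le_trans (fM x))// ltW].
Qed.

Arguments bounded_integrable {dT T R m f} M.

Section Rintegrable.
Context (dT : measure_display) (T : measurableType dT) (R : realType).
Variable m : {measure set T -> \bar R}.
Implicit Types f g : T -> R.
Notation intg f := (m.-integrable setT (EFin \o f)).

Lemma Rintegrable_measurable f : intg f -> measurable_fun setT f.
Proof. by move=> /integrableP[/measurable_EFinP]. Qed.

Lemma RintegrableD f g : intg f -> intg g -> intg (fun x => f x + g x).
Proof. exact: integrableD. Qed.

Lemma RintegrableB f g : intg f -> intg g -> intg (fun x => f x - g x).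
Proof. exact: integrableB. Qed.

Lemma RintegrableZ c f : intg f -> intg (fun x => c * f x).
Proof. exact: integrableZl. Qed.

Lemma le_Rintegrable f g : measurable_fun setT f -> intg g ->
  (forall x, `|f x| <= g x) -> intg f.
Proof.
move=> mf ig fg; apply: (le_integrable measurableT) ig; first exact/measurable_EFinP.
by move=> x _ /=; rewrite lee_fin (le_trans (fg x)) ?ler_norm.
Qed.

Lemma RintegrableM_bounded f g (M : R) : intg f -> measurable_fun setT g ->
  (forall x, `|g x| <= M) -> intg (fun x => f x * g x).
Proof.
move=> intf mg gM; have mf := Rintegrable_measurable intf.
apply: (@le_Rintegrable _ (fun x => M * `|f x|)).
- exact: measurable_funM.
- by apply: RintegrableZ; exact: integrable_norm.
- by move=> x; rewrite normrM mulrC ler_wpM2r.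
Qed.

Lemma Rintegrable_sum (I : Type) (s : seq I) (F : I -> T -> R) :
  (forall i, intg (F i)) -> intg (fun x => \sum_(i <- s) F i x).
Proof.
move=> iF; elim: s => [|i s IH].
  rewrite (_ : _ \o _ = cst 0%E); first exact: integrable0.
  by apply/funext => x /=; rewrite big_nil.
have := RintegrableD (iF i) IH.
by congr (m.-integrable _ _); apply/funext => x /=; rewrite big_cons.
Qed.

Lemma Rintegral_sum (I : Type) (s : seq I) (F : I -> T -> R) :
  (forall i, intg (F i)) ->
  \int[m]_x \sum_(i <- s) F i x = \sum_(i <- s) \int[m]_x F i x.
Proof.
move=> iF; elim: s => [|i s IH].
  by rewrite big_nil; under eq_Rintegral do rewrite big_nil; rewrite /Rintegral integral0.
rewrite big_cons -IH -RintegralD//; last exact: Rintegrable_sum.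
by apply: eq_Rintegral => x _; rewrite big_cons.
Qed.

End Rintegrable.

(** * Integration on the torus *)

Section periodicity.
Variable R : realType.

Lemma cos_periodZ (x : R) (m : int) : cos (x + m%:~R * (pi *+ 2)) = cos x.
Proof.
have h (n : nat) (y : R) : cos (y + n%:R * (pi *+ 2)) = cos y.
  elim: n => [|n IH]; first by rewrite mul0r addr0.
  by rewrite -natr1 mulrDl mul1r addrA cosD2pi.
case: m => n; first exact: h.
by rewrite NegzE mulrNz mulNr -[LHS](h n.+1) subrK.
Qed.

Lemma sin_periodZ (x : R) (m : int) : sin (x + m%:~R * (pi *+ 2)) = sin x.
Proof.
have sE (y : R) : sin y = cos (y - pi / 2) by rewrite cosBpihalf.
by rewrite !sE addrAC cos_periodZ.
Qed.

End periodicity.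

Section torus_integrals.
Variable R : realType.
Notation circle := (circle R).
Notation mu := (torus R).

Lemma consrV0 n (p : measurableTypeR R * 'rV[R]_n) : consrV p 0 ord0 = p.1.
Proof.
rewrite /consrV (_ : ord0 = @lshift 1 n ord0); last exact: val_inj.
by apply: etrans (row_mxEl _ _ _ _) _; rewrite mxE.
Qed.

Lemma consrVS n (p : measurableTypeR R * 'rV[R]_n) j :
  consrV p 0 (lift ord0 j) = p.2 0 j.
Proof.
rewrite /consrV (_ : lift ord0 j = @rshift 1 n j); last exact: val_inj.
exact: row_mxEr.
Qed.

Lemma dotZ_consrV n (k : 'rV[int]_n.+1) (p : measurableTypeR R * 'rV[R]_n) :
  dotZ k (consrV p) = (k 0 ord0)%:~R * p.1 + dotZ (\row_j k 0 (lift ord0 j)) p.2 :> R.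
Proof.
rewrite /dotZ big_ord_recl consrV0; congr (_ + _).
by apply: eq_bigr => j _; rewrite mxE consrVS.
Qed.

Lemma circleE (A : set (measurableTypeR R)) :
  circle A = lebesgue_measure (A `&` `[0%R, (pi *+ 2)%R]).
Proof. by []. Qed.

Lemma circle_setT : circle setT = (pi *+ 2 : R)%:E.
Proof.
rewrite circleE setTI lebesgue_measure_itv/= lte_fin mulrn_wgt0 ?pi_gt0//.
by rewrite oppr0 adde0.
Qed.

Lemma circle_itv (e : R) : 0 < e <= pi *+ 2 -> circle `[0%R, e[%classic = e%:E.
Proof.
move=> /andP[e0 e2]; rewrite circleE (_ : _ `&` _ = `[0%R, e[%classic).
  by rewrite lebesgue_measure_itv/= lte_fin e0 oppr0 adde0.
apply/setIidl => x /=; rewrite !in_itv/= => /andP[-> xe]/=.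
by rewrite (le_trans (ltW xe)).
Qed.

Lemma circle_cell : circle `[0%R, (pi *+ 2)%R[%classic = circle setT.
Proof.
by rewrite circle_setT circle_itv// lexx mulrn_wgt0// pi_gt0.
Qed.

(** Brings integrals against [circle] to the form on which the fundamental theorem of calculus
    applies. *)
Lemma integral_circle (f : measurableTypeR R -> R) :
  circle.-integrable setT (EFin \o f) ->
  (\int[circle]_x (f x)%:E =
   \int[lebesgue_measure]_(x in `[0%R, (pi *+ 2)%R]) (f x)%:E)%E.
Proof.
move=> intf.
have mI : measurable (`[0%R, (pi *+ 2)%R]%classic : set (measurableTypeR R)).
  exact: measurable_itv.
rewrite (@negligible_integral _ _ _ circle setT (~` `[0%R, (pi *+ 2)%R]%classic)) //.
- rewrite setTD setCK; apply: eq_measure_integral => A mA AI.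
  by rewrite [LHS]circleE setIidl.
- exact: measurableC.
- by apply: etrans (circleE _) _; rewrite setICl measure0.
Qed.

Lemma cell_consrV n : @consrV R n @^-1` (@cell R n.+1) = `[0, pi *+ 2[%classic `*` @cell R n.
Proof.
apply/seteqP; split => [p cp|p [p1 p2] j].
  split => [|j]; first by have := cp ord0; rewrite consrV0/= in_itv/=.
  by have := cp (lift ord0 j); rewrite consrVS.
case: (unliftP ord0 j) => [i|] ->; first by rewrite consrVS.
by rewrite consrV0; move: p1; rewrite /= in_itv.
Qed.

Lemma measurable_cell n : measurable (@cell R n).
Proof.
have -> : @cell R n = \bigcap_(j in [set: 'I_n]) ((fun x : 'rV[R]_n => x 0 j) @^-1` `[0, pi *+ 2[%classic).
  by apply/seteqP; split => x /= h j; have := h j; rewrite /= in_itv/=; auto.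
apply: fin_bigcap_measurable => // j _; rewrite -[X in measurable X]setTI.
by apply: measurable_coor => //; exact: measurable_itv.
Qed.

Lemma torusS n A : mu n.+1 A = (circle \x mu n)%E (@consrV R n @^-1` A).
Proof. by []. Qed.

Lemma torusS_setT n : mu n.+1 setT = (circle setT * mu n setT)%E.
Proof. by rewrite torusS preimage_setT -setXTT product_measure1E. Qed.

Lemma torus_gt0 n : (0 < mu n setT)%E.
Proof.
elim: n => [|n IH]; first by rewrite /= diracT lte01.
by rewrite torusS_setT circle_setT mule_gt0// lte_fin mulrn_wgt0// pi_gt0.
Qed.

Lemma torus_cell n : mu n (@cell R n) = mu n setT.
Proof.
elim: n => [|n IH].
  by congr (mu 0 _); apply/seteqP; split => // x _ [].
rewrite torusS cell_consrV torusS_setT -IH -circle_cell.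
by apply: product_measure1E; [exact: measurable_itv|exact: measurable_cell].
Qed.

Lemma torus_cellC n : mu n (~` @cell R n) = 0%E.
Proof.
have mc := @measurable_cell n.
rewrite -setTD measureD// ?setTI.
  transitivity (mu n setT - mu n setT)%E; last by rewrite subee// fin_num_measure.
  by congr (_ - _)%E; exact: torus_cell.
by rewrite -ge0_fin_numE ?measure_ge0// fin_num_measure.
Qed.

Lemma integral_circle_cos (m : int) (a : R) : m != 0 ->
  (\int[circle]_x (cos (m%:~R * x + a))%:E = 0)%E.
Proof.
move=> m0; have mR : m%:~R != 0 :> R by rewrite intr_eq0.
have p0 : 0 < pi *+ 2 :> R by rewrite mulrn_wgt0// pi_gt0.
have ccont : continuous (fun x : R => cos (m%:~R * x + a)).
  move=> x; apply: continuous_comp; last exact: continuous_cos.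
  by apply: cvgD; [apply: cvgMr; exact: cvg_id|exact: cvg_cst].
rewrite integral_circle; last first.
  apply: (@bounded_integrable _ _ R _ _ 1).
    exact: continuous_measurable_fun.
  by move=> x; rewrite ler_norml cos_geN1 cos_le1.
pose F (x : R) : R := m%:~R^-1 * sin (m%:~R * x + a).
have dF (x : R) : is_derive x 1 F (cos (m%:~R * x + a)).
  rewrite /F; apply: is_derive_eq.
  by rewrite addr0 /GRing.scale/= mulr1 mulrCA mulVf// mulr1.
rewrite (@continuous_FTC2 _ _ F)//.
- by rewrite /F mulr0 add0r [_ + a]addrC sin_periodZ subee.
- exact: continuous_subspaceT.
- split.
  + by move=> x _; apply: ex_derive.
  + apply: cvg_at_right_filter; apply: differentiable_continuous; apply/derivable1_diffP; exact: ex_derive.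
  + apply: cvg_at_left_filter; apply: differentiable_continuous; apply/derivable1_diffP; exact: ex_derive.
- by move=> x _; rewrite derive1E; apply: derive_val.
Qed.

(** The arbitrary phase carries the induction: after Fubini the first coordinate is absorbed in the
    phase of the inner integral. That integral vanishes by induction unless all remaining
    frequencies are 0; then the first one is not, and the integral over the circle vanishes. *)
Lemma integral_torus_cos n (k : 'rV[int]_n) (a : R) : k != 0 ->
  (\int[mu n]_x (cos (dotZ k x + a))%:E = 0)%E.
Proof.
elim: n k a => [|n IH] k a k0.
  by move: k0; rewrite thinmx0 eqxx.
have intc : (mu n.+1).-integrable setT (EFin \o (fun x => cos (dotZ k x + a))).
  apply: (@bounded_integrable _ _ R _ _ 1).
    by apply: measurable_trigpoly; exact: trigpoly_cos.
  by move=> x; rewrite ler_norml cos_geN1 cos_le1.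
have mT m := @fin_num_measure _ _ _ (mu m) _ measurableT.
have meas_cons (g : 'rV[R]_n.+1 -> R) : measurable_fun setT g ->
    measurable_fun setT (EFin \o g \o @consrV R n).
  move=> mg; apply: measurableT_comp; last exact: measurable_consrV.
  exact/measurable_EFinP.
have mcos : measurable_fun setT (fun x => cos (dotZ k x + a)).
  by apply: measurable_trigpoly; exact: trigpoly_cos.
rewrite -[LHS]/(\int[pushforward (circle \x mu n)%E (@consrV R n)]_x
  ((EFin \o (fun x => cos (dotZ k x + a))) x))%E.
pose k' := \row_j k 0 (lift ord0 j).
have cE : (EFin \o (fun x => cos (dotZ k x + a))) \o @consrV R n =
    (fun p => (cos ((k 0 ord0)%:~R * p.1 + dotZ k' p.2 + a))%:E).
  by apply/funext => p /=; rewrite dotZ_consrV.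
have intp : (circle \x mu n)%E.-integrable setT
    (fun p => (cos ((k 0 ord0)%:~R * p.1 + dotZ k' p.2 + a))%:E).
  apply: measurable_bounded_integrable => //.
  - have : (mu n.+1 setT < +oo)%E by rewrite ltey_eq mT.
    by [].
  - by have := meas_cons _ mcos; rewrite -/(comp _ _) cE => /measurable_EFinP.
  - exists 1; split; [exact: num_real|move=> B B1 x _ /=].
    by rewrite (le_trans _ (ltW B1))// ler_norml cos_geN1 cos_le1.
rewrite integral_pushforward//; last 3 first.
- exact: measurable_consrV.
- exact/measurable_EFinP.
- by rewrite preimage_setT cE.
rewrite preimage_setT cE -integral12_prod_meas1//.
rewrite /fubini_F/=.
have [k'0|k'0] := eqVneq k' 0; last first.
  apply: integral0_eq => x _.
  rewrite -[RHS](IH k' ((k 0 ord0)%:~R * x + a) k'0).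
  by apply: eq_integral => y _; congr (cos _)%:E; ring.
have k00 : k 0 ord0 != 0.
  apply: contra k0 => /eqP kj0; apply/eqP/rowP => j; rewrite mxE.
  case: (unliftP ord0 j) => [i|] -> //.
  by have /rowP/(_ i) := k'0; rewrite !mxE.
transitivity (\int[circle]_x ((cos ((k 0 ord0)%:~R * x + a))%:E * (fine (mu n setT))%:E))%E.
  apply: eq_integral => x _; rewrite fineK; last exact: mT.
  rewrite -[RHS](@integral_cst _ _ _ (mu n) setT measurableT).
  by apply: eq_integral => y _; rewrite k'0 dotZ0 addr0.
rewrite integralZr//.
  by rewrite integral_circle_cos// mul0e.
apply: (@bounded_integrable _ _ R _ _ 1).
  apply: continuous_measurable_fun => x.
  apply: continuous_comp; last exact: continuous_cos.
  by apply: cvgD; [apply: cvgMr; exact: cvg_id|exact: cvg_cst].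
by move=> x; rewrite ler_norml cos_geN1 cos_le1.
Qed.

End torus_integrals.

Section Rintegral_convergence.
Context (dT : measure_display) (T : measurableType dT) (R : realType).
Variable m : {measure set T -> \bar R}.

Lemma Rintegral_dominated (f_ : nat -> T -> R) (f g : T -> R) :
  (forall n, measurable_fun setT (f_ n)) -> measurable_fun setT f ->
  {ae m, forall x, f_ n x @[n --> \oo] --> f x} ->
  m.-integrable setT (EFin \o g) ->
  {ae m, forall x, forall n, `|f_ n x| <= g x} ->
  m.-integrable setT (EFin \o f) /\
  \int[m]_x f_ n x @[n --> \oo] --> \int[m]_x f x.
Proof.
move=> mf_ mf ff intg fg.
have [||||| intf _ cvgf] := @dominated_convergence _ _ _ m setT measurableT
  (fun n x => (f_ n x)%:E) (EFin \o f) (EFin \o g).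
- by move=> n; exact/measurable_EFinP.
- exact/measurable_EFinP.
- apply: filterS ff => x h _; apply: cvg_EFin => //; exact: nearW.
- by [].
- by apply: filterS fg => x h n _ /=; rewrite lee_fin.
split => //; rewrite /Rintegral; apply: fine_cvg.
by rewrite fineK//; exact: integrable_fin_num.
Qed.

Lemma le_Rintegral_norm (f g : T -> R) : m.-integrable setT (EFin \o f) ->
  m.-integrable setT (EFin \o g) -> (forall x, `|f x| <= g x) ->
  `|\int[m]_x f x| <= \int[m]_x g x.
Proof.
move=> intf intg fg; apply: le_trans (le_normr_Rintegral _ _) _ => //.
by apply: le_Rintegral => //; exact: integrable_norm.
Qed.

End Rintegral_convergence.

Section periodic.
Variables (R : realType) (d : nat).
Notation T := 'rV[R]_d.

Lemma periodic_shiftZ (Y : Type) (f : T -> Y) (x : T) (j : 'I_d) (m : int) :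
  periodic2pi f -> f (x + (m%:~R * (pi *+ 2)) *: delta_mx 0 j) = f x.
Proof.
move=> pf; have h (n : nat) (y : T) : f (y + (n%:R * (pi *+ 2)) *: delta_mx 0 j) = f y.
  elim: n => [|n IH]; first by rewrite mul0r scale0r addr0.
  by rewrite -natr1 mulrDl mul1r scalerDl addrA pf.
case: m => n; first exact: h.
by rewrite NegzE mulrNz mulNr -[LHS](h n.+1) scaleNr subrK.
Qed.

Lemma periodic_lattice (Y : Type) (f : T -> Y) (x : T) (m : 'I_d -> int) :
  periodic2pi f -> f (x + \row_j ((m j)%:~R * (pi *+ 2))) = f x.
Proof.
move=> pf; have -> : \row_j ((m j)%:~R * (pi *+ 2)) =
    \sum_j ((m j)%:~R * (pi *+ 2)) *: delta_mx 0 j :> T.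
  by rewrite [LHS]row_sum_delta; apply: eq_bigr => j _; rewrite mxE.
elim: (index_enum _) x => [|j s IH] x; first by rewrite big_nil addr0.
by rewrite big_cons addrA IH periodic_shiftZ.
Qed.

Lemma torus_repr_lattice (x : T) : exists m : 'I_d -> int,
  torus_repr x = x + \row_j ((m j)%:~R * (pi *+ 2)).
Proof.
exists (fun j => - Num.floor (x 0 j / (pi *+ 2))).
by apply/rowP => j; rewrite !mxE mulrNz mulNr.
Qed.

Lemma periodic_torus_repr (Y : Type) (f : T -> Y) (x : T) :
  periodic2pi f -> f (torus_repr x) = f x.
Proof. by move=> pf; have [m ->] := torus_repr_lattice x; exact: periodic_lattice. Qed.

Lemma periodic_trigpoly (f : T -> R) : trigpoly f -> periodic2pi f.
Proof.
elim=> {f}[k a|f g _ pf _ pg|c f _ pf] x j; last 2 first.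
- by rewrite pf pg.
- by rewrite pf.
by rewrite dotZDr dotZZr dotZ_delta_mx addrAC mulrC cos_periodZ.
Qed.

Lemma cell_torus_repr (x : T) : cell (torus_repr x).
Proof.
move=> j; rewrite mxE; have p0 : 0 < pi *+ 2 :> R by rewrite mulrn_wgt0// pi_gt0.
have /andP[] := floor_itv (x 0 j / (pi *+ 2)).
rewrite ler_pdivlMr// ltr_pdivrMr// intrD mulrDl mul1r => h1 h2.
by rewrite subr_ge0 h1/= ltrBlDl.
Qed.

Lemma torus_repr_id (x : T) : cell x -> torus_repr x = x.
Proof.
move=> cx; apply/rowP => j; rewrite mxE; have /andP[x0 x2] := cx j.
have p0 : 0 < pi *+ 2 :> R by rewrite mulrn_wgt0// pi_gt0.
have -> : Num.floor (x 0 j / (pi *+ 2)) = 0.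
  apply: floor_def; rewrite divr_ge0 ?(ltW p0)//=.
  by rewrite add0r ltr_pdivrMr// mul1r.
by rewrite mul0r subr0.
Qed.

Lemma measurable_torus_repr : measurable_fun setT (@torus_repr R d).
Proof.
apply: measurable_fun_rV => j.
under eq_fun do rewrite mxE.
apply: measurable_funB; first exact: measurable_coor.
apply: measurable_funM => //.
apply: (@measurableT_comp _ _ _ _ _ _ (fun t : R => (Num.floor t)%:~R : R)).
  by apply: nondecreasing_measurable => // s t st; rewrite ler_int le_floor.
by apply: measurable_funM => //; exact: measurable_coor.
Qed.

End periodic.
Section measure_preserving.
Variables (R : realType) (d : nat).
Notation T := 'rV[R]_d.
Notation mu := (torus R d).

Definition measure_preserving (F : T -> T) :=
  measurable_fun setT F /\ forall A, measurable A -> mu (F @^-1` A) = mu A.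

Lemma measure_preserving_ae F (P : T -> Prop) : measure_preserving F ->
  {ae mu, forall x, P x} -> {ae mu, forall x, P (F x)}.
Proof.
move=> [mF muF] [N [mN N0 PN]]; exists (F @^-1` N); split.
- by rewrite -[X in measurable X]setTI; exact: mF.
- by rewrite -N0; exact: muF.
- by move=> x /= nP; exact: PN.
Qed.

Lemma measure_preserving_ge0_integral F (f : T -> \bar R) : measure_preserving F ->
  measurable_fun setT f -> (forall x, 0 <= f x)%E ->
  (\int[mu]_x f (F x) = \int[mu]_x f x)%E.
Proof.
move=> [mF muF] mf f0.
have := @ge0_integral_pushforward _ _ _ _ _ F mF mu setT f measurableT mf.
rewrite preimage_setT => h; rewrite -[LHS]h//.
by apply: eq_measure_integral => A mA _; exact: muF.
Qed.

Lemma measure_preserving_integrable F (f : T -> R) : measure_preserving F ->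
  mu.-integrable setT (EFin \o f) -> mu.-integrable setT (EFin \o (f \o F)).
Proof.
move=> mF /integrableP[mf ifin]; apply/integrableP; split.
  by apply: (measurableT_comp (f := EFin \o f)) => //; exact: mF.1.
rewrite (@measure_preserving_ge0_integral F (fun x => `|(f x)%:E|)%E)//.
exact: measurableT_comp.
Qed.

Lemma measure_preserving_Rintegral F (f : T -> R) : measure_preserving F ->
  mu.-integrable setT (EFin \o f) -> \int[mu]_x f (F x) = \int[mu]_x f x.
Proof.
move=> mF intf; have /integrableP[mf _] := intf.
rewrite /Rintegral; congr fine.
have := @integral_pushforward _ _ _ _ _ F mF.1 mu setT (EFin \o f) mf.
rewrite preimage_setT => /(_ _ measurableT) h; rewrite -[LHS]h; last first.
  exact: measure_preserving_integrable.
by case: mF => mF muF; apply: eq_measure_integral => A mA _; exact: muF.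
Qed.

Lemma cell_ae : {ae mu, forall x, cell x}.
Proof.
exists (~` @cell R d); split => //; last exact: torus_cellC.
by apply: measurableC; exact: measurable_cell.
Qed.

(** A finite measure on the torus is determined by the integrals of waves. The values of [F] lie in
    [cell] so that the convergence granted by [trig_monotone_class] also holds after composition
    with [F]. *)
Lemma measure_preserving_trig F : measurable_fun setT F -> (forall x, cell (F x)) ->
  (forall k a, \int[mu]_x cos (dotZ k (F x) + a) = \int[mu]_x cos (dotZ k x + a)) ->
  measure_preserving F.
Proof.
move=> mF cF trigF; split => //.
pose P (f : T -> R) := [/\ mu.-integrable setT (EFin \o f),
  mu.-integrable setT (EFin \o (f \o F)) & \int[mu]_x f (F x) = \int[mu]_x f x].
have PE A : measurable A -> P \1_A.
  apply: trig_monotone_class => {A}.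
  - move=> f tf; have [M fM] := trigpoly_bounded tf.
    have mf := measurable_trigpoly tf; split.
    + exact: (bounded_integrable M).
    + apply: (bounded_integrable M); last by move=> x; exact: fM.
      exact: measurableT_comp.
    + elim: tf {fM mf} => {f}[k a|f g tf IH tg IH'|c f tf IH].
      * exact: trigF.
      * have iD h : trigpoly h -> mu.-integrable setT (EFin \o h) /\
            mu.-integrable setT (EFin \o (h \o F)).
          move=> th; have [N hN] := trigpoly_bounded th; have mh := measurable_trigpoly th.
          split; apply: (bounded_integrable N) => //; last by move=> x; exact: hN.
          exact: measurableT_comp.
        have [if1 if2] := iD _ tf; have [ig1 ig2] := iD _ tg.
        by rewrite !RintegralD// IH IH'.
      * have [N hN] := trigpoly_bounded tf; have mh := measurable_trigpoly tf.
        rewrite !RintegralZl//; last 2 first.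
        - exact: (bounded_integrable N).
        - apply: (bounded_integrable N); last by move=> x; exact: hN.
          exact: measurableT_comp.
        by rewrite IH.
  - move=> f g [if1 if2 ef] [ig1 ig2 eg]; split.
    + by rewrite /comp; under eq_fun do rewrite EFinB; exact: integrableB.
    + by rewrite /comp; under eq_fun do rewrite EFinB; exact: integrableB.
    + by rewrite !RintegralB// ef eg.
  - move=> f_ g M Pf mf mg fM fg.
    have fg_ae : {ae mu, forall x, f_ n x @[n --> \oo] --> g x}.
      by apply: filterS cell_ae => x; exact: fg.
    have iM : mu.-integrable setT (EFin \o cst M).
      apply: (bounded_integrable `|M|) => //.
    have [ig cg] := Rintegral_dominated mf mg fg_ae iM (aeW _ (fun x n => fM n x)).
    have [igF cgF] := @Rintegral_dominated _ _ _ mu (fun n => f_ n \o F) (g \o F) _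
      (fun n => measurableT_comp (mf n) mF) (measurableT_comp mg mF)
      (aeW _ (fun x => fg _ (cF x))) iM (aeW _ (fun x n => fM n (F x))).
    split => //; apply: (cvg_unique _ cgF) => //.
    rewrite /=; under eq_fun => n do (have [_ _ ->] := Pf n).
    exact: cg.
move=> A mA; have [_ _] := PE A mA.
rewrite /Rintegral.
have -> : (\int[mu]_x (\1_A (F x))%:E = mu (F @^-1` A))%E.
  have mFA : measurable (F @^-1` A) by rewrite -[X in measurable X]setTI; exact: mF.
  have := @integral_indic _ _ _ mu setT measurableT _ mFA.
  by rewrite setIT => h; exact: h.
rewrite integral_indic// setIT => h; move: (congr1 EFin h).
by rewrite !fineK// fin_num_measure// -[X in measurable X]setTI; exact: mF.
Qed.

Lemma Rintegral_cos (k : 'rV[int]_d) (a : R) : k != 0 ->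
  \int[mu]_x cos (dotZ k x + a) = 0.
Proof. by move=> k0; rewrite /Rintegral integral_torus_cos. Qed.

(** The map turns the frequency [k] into [s *: k], which is again integral and vanishes only with
    [k], so both integrals are 0 for [k != 0]. The cases 1 and -1 of [s] give translations and
    reflections. *)
Lemma measure_preserving_affine (s : int) (y : T) : s != 0 ->
  measure_preserving (fun x => torus_repr (y + s%:~R *: x)).
Proof.
move=> s0; apply: measure_preserving_trig.
- apply: measurableT_comp; first exact: measurable_torus_repr.
  apply: measurable_fun_rV => j; under eq_fun do rewrite !mxE.
  by apply: measurable_funD => //; apply: measurable_funM => //; exact: measurable_coor.
- by move=> x; exact: cell_torus_repr.
- move=> k a.
  have E x : cos (dotZ k (torus_repr (y + s%:~R *: x)) + a) =
      cos (dotZ (s *: k) x + (dotZ k y + a)).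
    have := @periodic_torus_repr _ _ _ (fun x => cos (dotZ k x + a)) (y + s%:~R *: x).
    rewrite /= => ->; last by apply: periodic_trigpoly; exact: trigpoly_cos.
    congr cos; rewrite dotZDr dotZZr; suff -> : dotZ (s *: k) x = s%:~R * dotZ k x by ring.
    rewrite /dotZ mulr_sumr; apply: eq_bigr => j _.
    by rewrite mxE intrM mulrA.
  under eq_Rintegral do rewrite E.
  have [->|k0] := eqVneq k 0.
    by rewrite scaler0; apply: eq_Rintegral => x _; rewrite !dotZ0 add0r.
  by rewrite !Rintegral_cos// scalemx_eq0 negb_or s0.
Qed.

Lemma Rintegral_translate (f : T -> R) (y : T) : periodic2pi f ->
  mu.-integrable setT (EFin \o f) -> \int[mu]_x f (x + y) = \int[mu]_x f x.
Proof.
move=> pf intf; rewrite -(measure_preserving_Rintegral (@measure_preserving_affine 1 y isT) intf).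
by apply: eq_Rintegral => x _; rewrite periodic_torus_repr// scale1r addrC.
Qed.

Lemma Rintegral_reflect (f : T -> R) (y : T) : periodic2pi f ->
  mu.-integrable setT (EFin \o f) -> \int[mu]_x f (y - x) = \int[mu]_x f x.
Proof.
move=> pf intf; rewrite -(measure_preserving_Rintegral (@measure_preserving_affine (-1) y isT) intf).
by apply: eq_Rintegral => x _; rewrite periodic_torus_repr// scaleN1r.
Qed.

End measure_preserving.

(** * The flow of a Lipschitz field *)

Section one_variable.
Variable R : realType.

Lemma is_derive1_continuous (f df : R -> R) :
  (forall t : R, is_derive t 1 f (df t)) -> continuous f.
Proof.
move=> fdf t; apply: differentiable_continuous; apply/derivable1_diffP.
exact: ex_derive.
Qed.

Lemma mean_value_bound (f df : R -> R) (a h M : R) :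
  (forall t : R, is_derive t 1 f (df t)) ->
  (forall t, `|t| <= `|h| -> `|df (a + t)| <= M) ->
  `|f (a + h) - f a| <= M * `|h|.
Proof.
move=> fdf dfM; have cf := is_derive1_continuous fdf.
have seg x y : x <= y -> exists2 c, c \in `[x, y] & f y - f x = df c * (y - x).
  move=> xy; apply: MVT_segment => //; exact: continuous_subspaceT.
have [h0|h0] := leP 0 h.
  have [|c] := seg a (a + h); first by rewrite lerDl.
  rewrite in_itv/= => /andP[ac ch] ->; rewrite addrAC subrr add0r normrM ler_wpM2r//.
  by rewrite -(subrKC a c) dfM// !ger0_norm ?subr_ge0// lerBlDl.
have [|c] := seg (a + h) a; first by rewrite gerDl ltW.
rewrite in_itv/= => /andP[ac ch]; rewrite distrC => ->.
rewrite opprD addrA subrr add0r normrM normrN ler_wpM2r//.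
rewrite -(subrKC a c) dfM// !ler0_norm ?subr_le0// ?(ltW h0)//.
by rewrite opprB lerBlDl -lerBlDr opprK.
Qed.

Lemma sin_lipschitz (a b : R) : `|sin b - sin a| <= `|b - a|.
Proof.
rewrite -[in leLHS](subrKC a b) -[leRHS]mul1r.
apply: (@mean_value_bound sin cos) => t _.
by rewrite ler_norml cos_geN1 cos_le1.
Qed.

Lemma cos_taylor1 (a b : R) : `|cos (a + b) - cos a + b * sin a| <= b ^+ 2.
Proof.
pose f t := cos (a + t) - cos a + t * sin a.
pose df t := - sin (a + t) + sin a.
have fdf (t : R) : is_derive t 1 f (df t).
  rewrite /f /df; apply: is_derive_eq.
  by rewrite !scaler0 ?add0r ?addr0 ?oppr0 ?addr0 /GRing.scale/= !mulr1.
have := @mean_value_bound f df 0 b `|b| fdf _.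
rewrite add0r {2}/f addr0 subrr mul0r addr0 subr0 -normrM -expr2 ger0_norm ?sqr_ge0//.
apply => t tb; rewrite add0r /df -normrN opprD opprK; apply: le_trans tb.
by rewrite (le_trans (sin_lipschitz _ _))// addrAC subrr add0r.
Qed.

(** Forward in time, G s * exp (- c s) is nonincreasing. The hypothesis bounds |dg s| and not just
    [dg s], so that s -> g (- s) satisfies the same inequality and negative times follow. *)
Lemma gronwall (g dg : R -> R) (c t : R) : (forall s : R, is_derive s 1 g (dg s)) ->
  (forall s, `|dg s| <= c * g s) -> g t <= g 0 * expR (c * `|t|).
Proof.
move=> gdg dgc.
have h (G dG : R -> R) (r : R) : (forall s : R, is_derive s 1 G (dG s)) ->
    (forall s, dG s <= c * G s) -> 0 <= r -> G r <= G 0 * expR (c * r).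
  move=> GdG dGc r0; pose f s := G s * expR (- c * s).
  have fd (s : R) : is_derive s 1 f ((dG s - c * G s) * expR (- c * s)).
    rewrite /f; apply: is_derive_eq.
    rewrite /GRing.scale/=; ring.
  have := @ler0_derive1_nincr R f 0 r _ _ _ 0 r (lexx _) r0 (lexx _).
  rewrite /f mulr0 expR0 mulr1 mulNr expRN ler_pdivrMr ?expR_gt0//; apply.
  - by move=> s _; apply: ex_derive.
  - move=> s _; rewrite derive1E derive_val mulr_le0_ge0 ?expR_ge0// subr_le0.
    exact: dGc.
  - by apply: continuous_subspaceT; exact: is_derive1_continuous fd.
have [t0|t0] := leP 0 t.
  rewrite (ger0_norm t0); apply: (h _ dg) => // s.
  by rewrite (le_trans (ler_norm _)).
rewrite (ltr0_norm t0) -{1}(opprK t).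
rewrite -[X in X * _](congr1 g (oppr0 R)).
apply: (h (fun s => g (- s)) (fun s => - dg (- s))) => //; last by rewrite oppr_ge0 ltW.
- move=> s; have := @is_derive1_comp R g (fun s => - s) s (dg (- s)) (- 1) _ _.
  by rewrite mulrN1; apply.
- by move=> s; rewrite (le_trans (ler_norm _))// normrN.
Qed.

End one_variable.

Section row_norm.
Variables (R : realType) (d : nat).
Notation T := 'rV[R]_d.

Lemma entry_le_norm (x : T) (j : 'I_d) : `|x 0 j| <= `|x|.
Proof.
rewrite [leRHS]/Num.Def.normr/= mx_normrE.
exact: (le_bigmax _ _ (0, j)).
Qed.

Lemma norm_le_entries (x : T) (M : R) : 0 <= M -> (forall j, `|x 0 j| <= M) -> `|x| <= M.
Proof.
move=> M0 xM; rewrite [leLHS]/Num.Def.normr/= mx_normrE.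
by apply: bigmax_le => // -[i j] _; rewrite /= ord1.
Qed.

Lemma is_derive_entry (X : R -> T) (t : R) (v : T) (j : 'I_d) :
  is_derive (t : R^o) (1 : R^o) X v -> is_derive t 1 (fun s => X s 0 j) (v 0 j).
Proof.
move=> [dX Xv]; have dX' := (derivable_mxP _ _ _).1 dX.
apply: DeriveDef; first exact: dX'.
by rewrite -Xv derive_mx// mxE.
Qed.

Lemma sum_sqr_le (x : T) : \sum_j x 0 j ^+ 2 <= d%:R * `|x| ^+ 2.
Proof.
rewrite -[X in X%:R]card_ord mulr_natl -sumr_const; apply: ler_sum => j _.
by rewrite -(ger0_norm (sqr_ge0 (x 0 j))) normrX lerXn2r ?nnegrE// entry_le_norm.
Qed.

Lemma norm_sqr_le (x : T) : `|x| ^+ 2 <= \sum_j x 0 j ^+ 2.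
Proof.
have S0 : 0 <= \sum_j x 0 j ^+ 2 by apply: sumr_ge0 => j _; exact: sqr_ge0.
rewrite -(sqr_sqrtr S0) ler_sqr ?nnegrE ?sqrtr_ge0//.
apply: norm_le_entries; first exact: sqrtr_ge0.
move=> j; rewrite -sqrtr_sqr ler_sqrt// (bigD1 j)//= lerDl sumr_ge0// => i _.
exact: sqr_ge0.
Qed.

(* Rational boxes form a countable base. *)
Lemma open_measurable_rV (A : set T) : open A -> measurable A.
Proof.
move=> oA.
pose box (qn : 'rV[rat]_d * nat) : set T := \bigcap_(j in [set: 'I_d])
  ((fun x : T => x 0 j) @^-1` `]ratr (qn.1 0 j) - qn.2.+1%:R^-1, ratr (qn.1 0 j) + qn.2.+1%:R^-1[%classic).
have mbox qn : measurable (box qn).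
  apply: fin_bigcap_measurable => // j _; rewrite -[X in measurable X]setTI.
  by apply: measurable_coor => //; exact: measurable_itv.
have -> : A = \bigcup_(qn in [set: 'rV[rat]_d * nat]) (if `[< box qn `<=` A >] then box qn else set0).
  apply/seteqP; split => [x Ax|x [qn _]]; last first.
    by case: ifPn => // /asboolP qA xq; exact: qA.
  have /nbhs_ballP[e /= e0 eA] := oA _ Ax.
  have [n ne] : exists n : nat, n.+1%:R^-1 < e / 2.
    exists (Num.truncn (e / 2)^-1); rewrite -[ltRHS]invrK ltf_pV2 ?posrE ?invr_gt0 ?divr_gt0//.
    exact: truncnS_gt.
  have n0 : 0 < n.+1%:R^-1 :> R by rewrite invr_gt0.
  have /all_sig[q hq] (j : 'I_d) : {q : rat | x 0 j - n.+1%:R^-1 < ratr q < x 0 j + n.+1%:R^-1}.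
    apply: cid; have lt_x : x 0 j - n.+1%:R^-1 < x 0 j + n.+1%:R^-1.
      by rewrite ltrD2l (lt_trans _ n0)// oppr_lt0.
    by have [q] := rat_in_itvoo lt_x; rewrite in_itv/=; exists q.
  have bA : box (\row_j q j, n) `<=` A.
    move=> y yb; apply: eA; rewrite /= -ball_normE /ball_/= (le_lt_trans (y := n.+1%:R^-1 *+ 2))//.
      apply: norm_le_entries; first by rewrite mulrn_wge0// ltW.
      move=> j; have := yb j I; have := hq j; rewrite /= in_itv/= !mxE => h1 h2.
      move: h1 h2; set c := n.+1%:R^-1 => h1 h2; rewrite ler_norml mulr2n; lra.
    by rewrite mulr2n; move: ne; set c := n.+1%:R^-1 => ne; lra.
  exists (\row_j q j, n) => //; case: ifPn => [_ j _|/negP]; last first.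
    by move=> h; exfalso; apply: h; apply/asboolP.
  by have := hq j; rewrite /= in_itv/= mxE; set c := n.+1%:R^-1 => h; lra.
apply: countable_bigcupT_measurable => //.
by move=> qn; case: ifPn.
Qed.

Lemma continuous_measurable_rV (f : T -> R) : continuous f -> measurable_fun setT f.
Proof.
move=> cf; apply: (measurability (@RGenOpens.G R)) => //.
  exact: RGenOpens.measurableE.
move=> _ [_ [a [b ->]] <-]; rewrite setTI; apply: open_measurable_rV.
apply: open_comp; last exact: interval_open.
by move=> x _; exact: cf.
Qed.

Lemma lipschitz_continuous_rV (f : T -> R) (L : R) :
  (forall x y, `|f x - f y| <= L * `|x - y|) -> continuous f.
Proof.
move=> fL x A /nbhs_ballP[e /= e0 eA].
have L0 : 0 < `|L| + 1 by rewrite ltr_wpDl.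
apply/nbhs_ballP; exists (e / (`|L| + 1)); first by rewrite /= divr_gt0.
move=> y; rewrite -ball_normE /= ltr_pdivlMr// => xy.
apply: eA; rewrite -ball_normE /=; apply: le_lt_trans xy.
rewrite (le_trans (fL x y))// mulrC ler_wpM2l//.
by rewrite (le_trans (ler_norm _))// lerDl.
Qed.

Lemma lipschitz_measurable (f : T -> R) (L : R) :
  (forall x y, `|f x - f y| <= L * `|x - y|) -> measurable_fun setT f.
Proof. by move=> fL; apply: continuous_measurable_rV; exact: lipschitz_continuous_rV fL. Qed.

End row_norm.

Section flow.
Variables (R : realType) (d : nat).
Notation T := 'rV[R]_d.
Implicit Types (u X Y : R -> T).

Definition solution (v : T -> T) (X : R -> T) :=
  forall t, is_derive (t : R^o) (1 : R^o) X (v (X t)).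

(** The norm of 'rV is the maximum norm, which is not differentiable; Gronwall is applied to the sum
    of squares, comparable to its square up to the factor d. *)
Lemma solution_dist (v : T -> T) (K : R) X Y t : 0 <= K ->
  (forall x y, `|v x - v y| <= K * `|x - y|) -> solution v X -> solution v Y ->
  `|X t - Y t| ^+ 2 <= (\sum_j (X 0 - Y 0) 0 j ^+ 2) * expR (2 * d%:R * K * `|t|).
Proof.
move=> K0 vK sX sY; apply: le_trans (norm_sqr_le _) _.
apply: (gronwall (g := fun t => \sum_j (X t - Y t) 0 j ^+ 2)
  (dg := fun t => \sum_j 2 * ((X t - Y t) 0 j * (v (X t) - v (Y t)) 0 j))) => s.
  have -> : (fun t => \sum_j (X t - Y t) 0 j ^+ 2) = \sum_j (fun t => (X t - Y t) 0 j ^+ 2).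
    by apply/funext => r; rewrite fct_sumE.
  apply: is_derive_sum => j.
  have dX := is_derive_entry j (sX s); have dY := is_derive_entry j (sY s).
  have -> : (fun t => (X t - Y t) 0 j ^+ 2) = (fun t => (X t 0 j - Y t 0 j) ^+ 2).
    by apply/funext => r; rewrite !mxE.
  apply: is_derive_eq; rewrite !mxE /GRing.scale/=; ring.
apply: (le_trans (ler_norm_sum _ _ _)).
apply: (@le_trans _ _ (\sum_(j < d) 2 * (K * `|X s - Y s| ^+ 2))).
  apply: ler_sum => j _; rewrite normrM ger0_norm// ler_wpM2l// normrM expr2 mulrCA.
  apply: ler_pM => //; first exact: entry_le_norm.
  by apply: le_trans (entry_le_norm _ _) _; exact: vK.
rewrite sumr_const card_ord -[leLHS]mulr_natl.
have := norm_sqr_le (X s - Y s); set a := _ ^+ 2; set b := \sum_j _ => ab.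
have -> : d%:R * (2 * (K * a)) = 2 * d%:R * K * a by ring.
by rewrite ler_wpM2l// !mulr_ge0.
Qed.

Lemma solution_unique (v : T -> T) (K : R) X Y : 0 <= K ->
  (forall x y, `|v x - v y| <= K * `|x - y|) -> solution v X -> solution v Y ->
  X 0 = Y 0 -> X = Y.
Proof.
move=> K0 vK sX sY XY0; apply/funext => t; apply/eqP; rewrite -subr_eq0 -normr_eq0.
rewrite -sqrf_eq0 eq_le sqr_ge0 andbT (le_trans (solution_dist t K0 vK sX sY))//.
by rewrite XY0 subrr big1 ?mul0r// => j _; rewrite mxE expr0n.
Qed.

Variable u : T -> T.
Hypotheses (u_periodic : periodic2pi u) (u_lipschitz : lipschitz u).
Variable Phi : R -> T -> T.
Hypothesis Phi_flow : is_flow u Phi.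

Lemma flow0 x : Phi 0 x = x. Proof. exact: Phi_flow.1. Qed.

Lemma flow_solution x : solution u (Phi ^~ x).
Proof. by move=> t; exact: Phi_flow.2. Qed.

Lemma field_lipschitz : exists2 K, 0 <= K & forall x y, `|u x - u y| <= K * `|x - y|.
Proof.
have [M [_ hM]] := u_lipschitz.
exists (`|M| + 1) => [|x y]; first by rewrite addr_ge0.
have := hM (`|M| + 1); rewrite ltr_pwDr ?ler_norm// => /(_ isT (x, y)).
exact.
Qed.

Lemma field_bounded : exists2 U, 0 <= U & forall x, `|u x| <= U.
Proof.
have [K K0 uK] := field_lipschitz; have p0 : 0 <= pi *+ 2 :> R by rewrite mulrn_wge0// pi_ge0.
exists (`|u 0| + K * (pi *+ 2)) => [|x]; first by rewrite addr_ge0// mulr_ge0.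
rewrite -(periodic_torus_repr x u_periodic) -(subrK (u 0) (u _)) addrC.
apply: le_trans (ler_normD _ _) _; rewrite lerD2l.
apply: le_trans (uK _ _) _; rewrite ler_wpM2l// subr0 norm_le_entries// => j.
by have /andP[h1 h2] := cell_torus_repr x j; rewrite ger0_norm// ltW.
Qed.

(** Uniqueness: t -> Phi t x + w solves the same equation, with initial value x + w. *)
Lemma flow_translate t x (w : T) : (forall y, u (y + w) = u y) ->
  Phi t (x + w) = Phi t x + w.
Proof.
move=> uw; have [K K0 uK] := field_lipschitz.
have : Phi^~ (x + w) = (fun t => Phi t x + w).
  apply: (solution_unique K0 uK); first exact: flow_solution.
    move=> s; rewrite uw; have := @flow_solution x s => h.
    by apply: is_derive_eq; rewrite addr0.
  by rewrite !flow0.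
by move=> /(congr1 (fun f => f t)).
Qed.

Lemma flow_periodic t x j : Phi t (x + (pi *+ 2) *: delta_mx 0 j) = Phi t x + (pi *+ 2) *: delta_mx 0 j.
Proof. by apply: flow_translate => y; exact: u_periodic. Qed.

Lemma is_derive_shift (X : R -> T) (r t : R) (v : T) :
  is_derive (r + t : R^o) (1 : R^o) X v ->
  is_derive (r : R^o) (1 : R^o) (fun s => X (s + t)) v.
Proof.
have E : (fun h : R => h^-1 *: (((fun s => X (s + t)) \o shift r) (h *: (1 : R^o)) - X (r + t))) =
    (fun h : R => h^-1 *: ((X \o shift (r + t)) (h *: (1 : R^o)) - X (r + t))).
  by apply/funext => h /=; rewrite addrA.
move=> [dX Xv]; split; first by rewrite /derivable E.
by rewrite -Xv /derive E.
Qed.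

Lemma flow_add s t x : Phi s (Phi t x) = Phi (s + t) x.
Proof.
have [K K0 uK] := field_lipschitz.
have : Phi^~ (Phi t x) = (fun s => Phi (s + t) x).
  apply: (solution_unique K0 uK); first exact: flow_solution.
    by move=> r; have := flow_solution x (r + t); exact: is_derive_shift.
  by rewrite !flow0 add0r.
by move=> /(congr1 (fun f => f s)).
Qed.

Lemma flow_lipschitz t : exists2 C, 0 <= C & forall x y, `|Phi t x - Phi t y| <= C * `|x - y|.
Proof.
have [K K0 uK] := field_lipschitz.
pose q : R := d%:R * expR (2 * d%:R * K * `|t|).
have q0 : 0 <= q by rewrite mulr_ge0// expR_ge0.
(* [q] is the constant for squared distances, and q <= (1 + q)^2 avoids a square root. *)
exists (1 + q) => [|x y]; first by rewrite addr_ge0.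
rewrite -ler_sqr ?nnegrE ?mulr_ge0 ?addr_ge0//.
apply: (@le_trans _ _ (q * `|x - y| ^+ 2)).
  apply: le_trans (solution_dist t K0 uK (flow_solution x) (flow_solution y)) _.
  rewrite !flow0 /q -[leRHS]mulrA [expR _ * _]mulrC mulrA.
  by apply: ler_wpM2r; [exact: expR_ge0|exact: sum_sqr_le].
rewrite exprMn ler_wpM2r ?sqr_ge0//; nra.
Qed.

Lemma flow_near U h x : 0 <= U -> (forall x, `|u x| <= U) -> `|Phi h x - x| <= U * `|h|.
Proof.
move=> U0 uU; apply: norm_le_entries => [|j]; first by rewrite mulr_ge0.
rewrite !mxE -{2}(flow0 x) -[h in leLHS]add0r.
apply: (@mean_value_bound R (fun t => Phi t x 0 j) (fun t => u (Phi t x) 0 j)) => t.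
  exact: is_derive_entry (flow_solution x t).
by move=> _; rewrite (le_trans (entry_le_norm _ _)).
Qed.

(** The t-derivative of Phi t x - t u(x) is u(Phi t x) - u(x), at most K U |t|. A Lipschitz field
    thus already gives an error quadratic in the time step. *)
Lemma flow_euler K U h x : 0 <= K -> 0 <= U ->
  (forall x y, `|u x - u y| <= K * `|x - y|) -> (forall x, `|u x| <= U) ->
  `|Phi h x - (x + h *: u x)| <= K * U * `|h| ^+ 2.
Proof.
move=> K0 U0 uK uU; apply: norm_le_entries => [|j]; first by rewrite !mulr_ge0// exprn_ge0.
pose f t := Phi t x 0 j - t * u x 0 j.
have -> : (Phi h x - (x + h *: u x)) 0 j = f (0 + h) - f 0.
  by rewrite /f add0r flow0 !mxE mul0r subr0; ring.
rewrite expr2 mulrA.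
apply: (@mean_value_bound R f (fun t => u (Phi t x) 0 j - u x 0 j)) => t.
  have := is_derive_entry j (flow_solution x t) => h1; rewrite /f.
  apply: is_derive_eq; rewrite scaler0 add0r; congr (_ - _); exact: mulr1.
move=> th; rewrite add0r; apply: (@le_trans _ _ `|(u (Phi t x) - u x)|).
  by apply: le_trans (entry_le_norm _ j); rewrite !mxE.
apply: le_trans (uK _ _) _; rewrite -mulrA ler_wpM2l//.
by apply: le_trans (flow_near t x U0 uU) _; rewrite ler_wpM2l.
Qed.

Lemma measurable_field j : measurable_fun setT (fun x => u x 0 j).
Proof.
have [K K0 uK] := field_lipschitz; apply: (@lipschitz_measurable _ _ _ K) => x y.
by apply: le_trans (uK x y); apply: le_trans (entry_le_norm _ j); rewrite !mxE.
Qed.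

Lemma measurable_flow t : measurable_fun setT (Phi t).
Proof.
have [C C0 PC] := flow_lipschitz t.
apply: measurable_fun_rV => j; apply: (@lipschitz_measurable _ _ _ C) => x y.
by apply: le_trans (PC x y); apply: le_trans (entry_le_norm _ j); rewrite !mxE.
Qed.

End flow.

(** * Invariance of Lebesgue measure under the flow *)

Section trigpoly_calculus.
Variables (R : realType) (d : nat).
Notation T := 'rV[R]_d.
Notation mu := (torus R d).

Lemma trigpoly_integrable (f : T -> R) : trigpoly f -> mu.-integrable setT (EFin \o f).
Proof.
move=> tf; have [M fM] := trigpoly_bounded tf.
by apply: (bounded_integrable M) => //; exact: measurable_trigpoly.
Qed.

Lemma dotZ_bound (k : 'rV[int]_d) : exists2 C : R, 0 <= C & forall x : T, `|dotZ k x| <= C * `|x|.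
Proof.
exists (\sum_j `|(k 0 j)%:~R|) => [|x]; first by apply: sumr_ge0.
rewrite mulr_suml; apply: le_trans (ler_norm_sum _ _ _) _.
by apply: ler_sum => j _; rewrite normrM ler_wpM2l// entry_le_norm.
Qed.

Lemma trigpoly_lipschitz (f : T -> R) : trigpoly f ->
  exists2 L, 0 <= L & forall x y, `|f x - f y| <= L * `|x - y|.
Proof.
elim=> {f}[k a|f g _ [L L0 fL] _ [M M0 gM]|c f _ [L L0 fL]].
- have [C C0 kC] := dotZ_bound k; exists C => // x y; apply: le_trans (kC _).
  have cE (t : R) : cos t = sin (t + pi / 2) by rewrite sinDpihalf.
  rewrite !cE; apply: le_trans (sin_lipschitz _ _) _.
  rewrite (_ : _ - _ = dotZ k (x - y))//.
  by rewrite dotZDr dotZNr; ring.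
- exists (L + M) => [|x y]; first by rewrite addr_ge0.
  rewrite opprD addrACA mulrDl; apply: le_trans (ler_normD _ _) _.
  by rewrite lerD.
- exists (`|c| * L) => [|x y]; first by rewrite mulr_ge0.
  by rewrite -mulrBr normrM -mulrA ler_wpM2l.
Qed.

(** The remainder is uniform in [x] and is obtained by induction on [f], from the cosine alone.
    [trigpoly_gradient] then identifies [G] with the partial derivatives. *)
Lemma trigpoly_taylor (f : T -> R) : trigpoly f ->
  exists (G : 'I_d -> T -> R) (C : R), [/\ forall j, trigpoly (G j), 0 <= C &
    forall x v, `|f (x + v) - f x - \sum_j v 0 j * G j x| <= C * `|v| ^+ 2].
Proof.
elim=> {f}[k a|f g _ [F [C [tF C0 fC]]] _ [G [D [tG D0 gD]]]|c f _ [F [C [tF C0 fC]]]].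
(* The derivative - sin, written as a cosine with shifted phase so that it is visibly a
   [trigpoly]. *)
- exists (fun j x => (k 0 j)%:~R * cos (dotZ k x + (a + pi / 2))).
  have [C C0 kC] := dotZ_bound k; exists (C ^+ 2); split.
  + by move=> j; apply: trigpolyZ; exact: trigpoly_cos.
  + exact: sqr_ge0.
  + move=> x v; rewrite (_ : \sum_j _ = - (dotZ k v * sin (dotZ k x + a))); last first.
      rewrite /dotZ mulr_suml -sumrN; apply: eq_bigr => j _.
      by rewrite addrA cosDpihalf; ring.
    rewrite opprK dotZDr (addrAC (dotZ k x)); apply: le_trans (cos_taylor1 _ _) _.
    rewrite -exprMn -(ger0_norm (sqr_ge0 (dotZ k v))) normrX lerXn2r ?nnegrE//.
    by rewrite mulr_ge0.
- exists (fun j x => F j x + G j x), (C + D); split.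
  + by move=> j; exact: trigpolyD.
  + exact: addr_ge0.
  + move=> x v; rewrite mulrDl; apply: le_trans (lerD (fC x v) (gD x v)).
    apply: le_trans (ler_normD _ _); rewrite le_eqVlt; apply/orP; left; apply/eqP; congr `|_|.
    under eq_bigr do rewrite mulrDr.
    by rewrite big_split/=; ring.
- exists (fun j x => c * F j x), (`|c| * C); split.
  + by move=> j; exact: trigpolyZ.
  + exact: mulr_ge0.
  + move=> x v; rewrite -mulrA; apply: le_trans (ler_wpM2l (normr_ge0 c) (fC x v)).
    rewrite -normrM; rewrite le_eqVlt; apply/orP; left; apply/eqP; congr `|_|.
    rewrite !mulrBr mulr_sumr; congr (_ - _); apply: eq_bigr => j _; ring.
Qed.

Lemma is_derive_taylor (f : T -> R) (x v : T) (l C : R) :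
  (forall h : R, `|f (x + h *: v) - f x - h * l| <= C * `|h| ^+ 2) -> is_derive x v f l.
Proof.
move=> fC; have h : h^-1 *: ((f \o shift x) (h *: v) - f x) @[h --> 0^'] --> l.
  apply/cvgrPdist_le => e e0; near=> h.
  have h0 : h != 0 by near: h; exact: nbhs_dnbhs_neq.
  have -> : l - h^-1 *: ((f \o shift x) (h *: v) - f x) =
      - (h^-1 * (f (x + h *: v) - f x - h * l)).
    by rewrite /= [h *: v + x]addrC /GRing.scale/= [in RHS]mulrBr mulKf// opprB.
  rewrite normrN normrM normfV ler_pdivrMl ?normr_gt0//.
  apply: le_trans (fC h) _; rewrite expr2 mulrA mulrC ler_wpM2l//.
  apply: (@le_trans _ _ ((`|C| + 1) * `|h|)).
    by rewrite ler_wpM2r// (le_trans (ler_norm _))// lerDl.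
  rewrite mulrC -ler_pdivlMr ?ltr_wpDl//; near: h.
  by apply: dnbhs0_le; rewrite divr_gt0// ltr_wpDl.
apply: DeriveDef; first by apply/cvg_ex; exists l.
exact/cvg_lim.
Unshelve. all: by end_near. Qed.

Lemma trigpoly_gradient (f : T -> R) : trigpoly f ->
  (forall j x, derivable f x (delta_mx 0 j)) /\ (forall j, trigpoly (pderiv j f)) /\
  exists2 C, 0 <= C &
    forall x v, `|f (x + v) - f x - \sum_j v 0 j * pderiv j f x| <= C * `|v| ^+ 2.
Proof.
move=> tf; have [G [C [tG C0 fC]]] := trigpoly_taylor tf.
have D j x : is_derive x (delta_mx 0 j) f (G j x).
  apply: (@is_derive_taylor _ _ _ _ (C * `|delta_mx 0 j : T| ^+ 2)) => h.
  have := fC x (h *: delta_mx 0 j); rewrite normrZ exprMn mulrCA [_ * (C * _)]mulrC.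
  congr (`|_ - _| <= _).
  rewrite (bigD1 j)//= big1 => [|i ij]; first by rewrite addr0 !mxE !eqxx mulr1.
  by rewrite !mxE (negbTE ij) andbF mulr0 mul0r.
have DE j : pderiv j f = G j by apply/funext => x; rewrite /pderiv derive_val.
split; first by move=> j x; apply: ex_derive.
split; first by move=> j; rewrite DE.
by exists C => // x v; under eq_bigr do rewrite DE; exact: fC.
Qed.

Lemma trigpoly_continuous (f : T -> R) : trigpoly f -> continuous f.
Proof. by move=> /trigpoly_lipschitz[L _]; exact: lipschitz_continuous_rV. Qed.

Lemma trigpoly_C1 (f : T -> R) : trigpoly f -> C1_periodic f.
Proof.
move=> tf; split; first exact: periodic_trigpoly.
have [df [tdf _]] := trigpoly_gradient tf => j; split; first exact: df.
exact: trigpoly_continuous.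
Qed.

End trigpoly_calculus.

(** * Nonnegative trigonometric kernels concentrated near 0 *)

Section trig_kernel.
Variables (R : realType) (d : nat).
Notation T := 'rV[R]_d.
Notation mu := (torus R).

Lemma torus_box_gt0 n (e : R) : 0 < e <= pi *+ 2 ->
  (0 < mu n (@cell R n `&` lowerbox (const_mx e)))%E.
Proof.
move=> /andP[e0 e2]; elim: n => [|n IH].
  rewrite (_ : _ `&` _ = setT); first exact: torus_gt0.
  by apply/seteqP; split => // x _; split => -[].
have mbox : measurable (@cell R n `&` lowerbox (const_mx e)).
  by apply: measurableI; [exact: measurable_cell|exact: measurable_lowerbox].
rewrite torusS (_ : _ @^-1` _ = `[0, e[%classic `*` (@cell R n `&` lowerbox (const_mx e))).
  have mI : measurable (`[0, e[%classic : set (measurableTypeR R)) by exact: measurable_itv.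
  rewrite [ltRHS](product_measure1E (circle R) (mu n) mI mbox) mule_gt0//.
  apply: (@lt_le_trans _ _ e%:E); first by rewrite lte_fin.
  by have := @circle_itv R e; rewrite e0 e2 => <-.
apply/seteqP; split => [p [cp bp]|p [p1 [cp bp]]].
  split; first by have := cp ord0; have := bp ord0; rewrite consrV0 mxE /= in_itv/= => -> /andP[->].
  split => j; first by have := cp (lift ord0 j); rewrite consrVS.
  by have := bp (lift ord0 j); rewrite /= consrVS !mxE.
move: p1; rewrite /= in_itv/= => /andP[p0 pe].
split => j; (case: (unliftP ord0 j) => [i|] ->; first rewrite consrVS).
- exact: cp.
- by rewrite consrV0 p0 (lt_le_trans pe).
- by have := bp i; rewrite !mxE.
- by rewrite consrV0 mxE.
Qed.

(** This is not the distance to 0 on the torus: points with a coordinate just below 2 pi count as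
    far. It serves because the kernels below concentrate at the corner 0 from inside [cell]. *)
Definition torus_norm (y : T) : R := `|torus_repr y|.

Lemma torus_norm_itv y : 0 <= torus_norm y <= pi *+ 2.
Proof.
rewrite /torus_norm normr_ge0/=; apply: norm_le_entries => [|j].
  by rewrite mulrn_wge0// pi_ge0.
by have /andP[h1 h2] := cell_torus_repr y j; rewrite ger0_norm// ltW.
Qed.

Lemma measurable_torus_norm : measurable_fun setT torus_norm.
Proof.
apply: (@measurableT_comp _ _ _ _ _ _ (fun y : T => `|y|)); last exact: measurable_torus_repr.
apply: (@lipschitz_measurable _ _ _ 1) => x y; rewrite mul1r; exact: ler_dist_dist.
Qed.

(** The approximants of the indicator of the box [0, b[^d, with b < e, are nonnegative trigonometric
    polynomials. On the box [torus_norm] is at most b, so far enough in the sequence the normalised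
    approximant has first moment at most e. *)
Lemma trig_kernel (e : R) : 0 < e -> exists F : T -> R,
  [/\ trigpoly F, forall y, 0 <= F y, \int[mu d]_y F y = 1 &
      \int[mu d]_y (torus_norm y * F y) <= e].
Proof.
move=> e0.
pose b := Num.min (e / 2) (pi *+ 2).
have b0 : 0 < b <= pi *+ 2.
  by rewrite /b lt_min divr_gt0//= mulrn_wgt0 ?pi_gt0//= ge_min lexx orbT.
have be : b < e by rewrite /b gt_min; apply/orP; left; lra.
pose Q := @cell R d `&` lowerbox (const_mx b).
have mQ : measurable Q by apply: measurableI; [exact: measurable_cell|exact: measurable_lowerbox].
pose G := box_approx (const_mx b : T).
have tG n : trigpoly (G n) by exact: trigpoly_box_approx.
have G0 n y : 0 <= G n y by have /andP[] := box_approx_itv (const_mx b : T) n y.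
have G2 n y : G n y <= 2 ^+ d by have /andP[] := box_approx_itv (const_mx b : T) n y.
have mG n : measurable_fun setT (G n) by exact: measurable_trigpoly.
have mtn := measurable_torus_norm.
have iG n : (mu d).-integrable setT (EFin \o (fun y => torus_norm y * G n y)).
  apply: (bounded_integrable ((pi *+ 2) * 2 ^+ d)); first exact: measurable_funM.
  move=> y; have /andP[t0 t1] := torus_norm_itv y.
  by rewrite ger0_norm ?mulr_ge0// ler_pM.
have iGn n := trigpoly_integrable (tG n).
have IE n : \int[mu d]_y ((torus_norm y - e) * G n y) =
    \int[mu d]_y (torus_norm y * G n y) - e * \int[mu d]_y G n y.
  under eq_Rintegral do rewrite mulrBl.
  rewrite RintegralB// ?RintegralZl//.
  exact: RintegrableZ.
(* This single inequality yields both that [G n] has positive mass, so that it can be normalised,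
   and that its first moment is below e times this mass. *)
have [n Gn] : exists n, \int[mu d]_y ((torus_norm y - e) * G n y) < 0.
  have [] := @Rintegral_dominated _ _ R (mu d) (fun n y => (torus_norm y - e) * G n y)
    (fun y => (torus_norm y - e) * \1_Q y) (cst ((pi *+ 2 + e) * 2 ^+ d)).
  - by move=> n; apply: measurable_funM => //; exact: measurable_funB.
  - by apply: measurable_funM; [exact: measurable_funB|exact: measurable_indic].
  - apply: filterS (@cell_ae R d) => y cy; apply: cvgMr.
    have -> : \1_Q y = \1_(lowerbox (const_mx b)) y :> R.
      by rewrite !indicE in_setI (mem_set cy).
    exact: cvg_box_approx.
  - by apply: (bounded_integrable `|(pi *+ 2 + e) * 2 ^+ d|).
  - apply/aeW => y n; rewrite normrM ler_pM// ?(ger0_norm (G0 _ _))//.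
    have /andP[t0 t1] := torus_norm_itv y.
    by rewrite (le_trans (ler_normB _ _))// (ger0_norm t0) (gtr0_norm e0) lerD.
  move=> iQ cvgI.
  have I_lt0 : \int[mu d]_y ((torus_norm y - e) * \1_Q y) < 0.
    apply: (@le_lt_trans _ _ ((b - e) * fine (mu d Q))); last first.
      rewrite nmulr_rlt0 ?subr_lt0// fine_gt0// torus_box_gt0//=.
      by rewrite ltey_eq fin_num_measure.
    have -> : fine (mu d Q) = \int[mu d]_y \1_Q y.
      by rewrite /Rintegral integral_indic// setIT.
    have i1 : (mu d).-integrable setT (EFin \o (\1_Q : T -> R)).
      by apply: integrable_indic => //; rewrite ltey_eq fin_num_measure.
    rewrite -RintegralZl//; apply: le_Rintegral => //.
      exact: RintegrableZ.
    move=> y _; rewrite indicE; case: (boolP (y \in Q)); last by rewrite !mulr0.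
    rewrite inE => -[cy by_]; rewrite !mulr1 lerD2r /torus_norm torus_repr_id//.
    apply: norm_le_entries => [|j]; first by have /andP[/ltW] := b0.
    have /andP[h1 _] := cy j; have := by_ j; rewrite mxE => h2.
    by rewrite ger0_norm// ltW.
  have [m _ hm] : \forall n \near \oo, \int[mu d]_y ((torus_norm y - e) * G n y) < 0.
    exact: (cvgr_lt _ cvgI _ I_lt0).
  by exists m; apply: hm => /=.
have Gn_gt0 : 0 < \int[mu d]_y G n y.
  have t0 : 0 <= \int[mu d]_y (torus_norm y * G n y).
    apply: Rintegral_ge0 => y _; rewrite mulr_ge0//.
    by have /andP[] := torus_norm_itv y.
  have : 0 < e * \int[mu d]_y G n y by move: Gn; rewrite IE; lra.
  by rewrite pmulr_rgt0.
exists (fun y => (\int[mu d]_y G n y)^-1 * G n y); split.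
- exact: trigpolyZ.
- by move=> y; rewrite mulr_ge0// invr_ge0 ltW.
- by rewrite RintegralZl// mulVf// gt_eqF.
- under eq_Rintegral do rewrite mulrCA.
  rewrite RintegralZl// ler_pdivrMl// mulrC.
  by move: Gn; rewrite IE subr_lt0 => /ltW.
Qed.

End trig_kernel.

(** * Mollification and the time derivative of integrals along the flow *)

Section flow_measure_preserving.
Variables (R : realType) (d : nat).
Notation T := 'rV[R]_d.
Notation mu := (torus R d).

Lemma Rintegral_exchange (g : T * T -> R) (M : R) :
  measurable_fun setT g -> (forall p, `|g p| <= M) ->
  mu.-integrable setT (EFin \o (fun x => \int[mu]_y g (x, y))) /\
  \int[mu]_x (\int[mu]_y g (x, y)) = \int[mu]_y (\int[mu]_x g (x, y)).
Proof.
move=> mg gM.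
have ig : (mu \x mu)%E.-integrable setT (EFin \o g).
  apply: measurable_bounded_integrable => //.
    rewrite -setXTT [ltLHS](product_measure1E mu mu measurableT measurableT).
    by rewrite lte_mul_pinfty ?measure_ge0 ?fin_num_measure// ltey_eq fin_num_measure.
  by exists M; split; [exact: num_real|move=> B MB x _ /=; rewrite (le_trans (gM x))// ltW].
have i1 x : mu.-integrable setT (fun y => (g (x, y))%:E).
  by apply: (bounded_integrable M) => //; exact: measurableT_comp.
have i2 y : mu.-integrable setT (fun x => (g (x, y))%:E).
  by apply: (bounded_integrable M) => //; exact: measurableT_comp.
have E1 x : (\int[mu]_y (g (x, y))%:E)%E = (\int[mu]_y g (x, y))%:E.
  by rewrite /Rintegral fineK//; exact: integrable_fin_num.
have E2 y : (\int[mu]_x (g (x, y))%:E)%E = (\int[mu]_x g (x, y))%:E.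
  by rewrite /Rintegral fineK//; exact: integrable_fin_num.
split.
  have := integrable_fubini_F ig; congr (integrable _ _ _).
  by apply/funext => x; exact: E1.
rewrite [LHS]/Rintegral [RHS]/Rintegral; congr fine.
have := Fubini ig; rewrite /=.
under eq_integral do rewrite E1.
by under [in X in _ = X -> _]eq_integral do rewrite E2.
Qed.

Lemma measurable_sub_rV : measurable_fun setT (fun p : T * T => p.1 - p.2).
Proof.
apply: measurable_fun_rV => j; under eq_fun do rewrite !mxE.
apply: measurable_funB.
  by apply: (measurableT_comp (measurable_coor j)); exact: measurable_fst.
by apply: (measurableT_comp (measurable_coor j)); exact: measurable_snd.
Qed.

Lemma lipschitz_periodic_bounded (f : T -> R) (L : R) : periodic2pi f ->
  (forall x y, `|f x - f y| <= L * `|x - y|) -> exists2 M, 0 <= M & forall x, `|f x| <= M.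
Proof.
move=> pf fL; exists (`|f 0| + `|L| * (pi *+ 2)) => [|x].
  by rewrite addr_ge0// mulr_ge0// mulrn_wge0// pi_ge0.
rewrite -(periodic_torus_repr x pf) -(subrK (f 0) (f _)) addrC.
apply: le_trans (ler_normD _ _) _; rewrite lerD2l.
apply: le_trans (fL _ _) _; rewrite subr0.
apply: (@le_trans _ _ (`|L| * torus_norm x)).
  by rewrite ler_wpM2r// ler_norm.
by rewrite ler_wpM2l//; have /andP[] := torus_norm_itv x.
Qed.

Definition convolution (f F : T -> R) (x : T) := \int[mu]_y (f (x - y) * F y).

(** A reflection moves [x] into the argument of the kernel, where the addition formula separates it
    from the integration variable. *)
Lemma trigpoly_convolution (f F : T -> R) : periodic2pi f -> measurable_fun setT f ->
  (exists M, forall x, `|f x| <= M) -> trigpoly F -> trigpoly (convolution f F).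
Proof.
move=> pf mf [M fM] tF.
have intf : mu.-integrable setT (EFin \o f) by exact: (bounded_integrable M).
have iM (g : T -> R) : trigpoly g -> mu.-integrable setT (EFin \o (fun z => f z * g z)).
  move=> tg; have [N gN] := trigpoly_bounded tg.
  by apply: (RintegrableM_bounded (M := N)) => //; exact: measurable_trigpoly.
have trefl (g : T -> R) x : trigpoly g -> trigpoly (fun z => g (x - z)).
  elim=> {g}[k a|g h _ tg _ th|c g _ tg].
  - have := @trigpoly_cos R d (- k) (dotZ k x + a); congr trigpoly.
    by apply/funext => z; rewrite dotZNl dotZDr dotZNr; congr cos; ring.
  - exact: trigpolyD.
  - exact: trigpolyZ.
have -> : convolution f F = (fun x => \int[mu]_z (f z * F (x - z))).
  apply/funext => x; rewrite /convolution.
  rewrite -(@Rintegral_reflect _ _ (fun z => f z * F (x - z)) x).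
  - by apply: eq_Rintegral => y _; rewrite subKr.
  - move=> z j; rewrite pf; congr (_ * _).
    by have := periodic_trigpoly (trefl F x tF) z j.
  - by apply: iM; exact: trefl.
elim: tF => {F}[k a|F G tF IH tG IH'|c F tF IH].
- have -> : (fun x => \int[mu]_z (f z * cos (dotZ k (x - z) + a))) =
     (fun x => cos (dotZ k x + a) * (\int[mu]_z (f z * cos (dotZ k z + 0))) +
               cos (dotZ k x + (a - pi / 2)) * (\int[mu]_z (f z * cos (dotZ k z + (- (pi / 2)))))).
    apply/funext => x.
    rewrite -!RintegralZl ?iM//; try exact: trigpoly_cos.
    rewrite -RintegralD//; try by apply: RintegrableZ; apply: iM; exact: trigpoly_cos.
    apply: eq_Rintegral => z _; rewrite addr0 addrA !cosBpihalf dotZDr dotZNr.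
    have -> : dotZ k x - dotZ k z + a = dotZ k x + a - dotZ k z by ring.
    by rewrite cosB; ring.
  by apply: trigpolyD; apply: trigpolyM; (exact: trigpoly_cos || exact: trigpoly_cst).
- have := trigpolyD IH IH'; congr trigpoly; apply/funext => x.
  rewrite -RintegralD//; try (by apply: iM; exact: trefl).
  by apply: eq_Rintegral => z _; rewrite mulrDr.
- have := trigpolyZ c IH; congr trigpoly; apply/funext => x.
  rewrite -RintegralZl//; last by apply: iM; exact: trefl.
  by apply: eq_Rintegral => z _; rewrite mulrCA.
Qed.

Definition volume := fine (mu setT).
Local Notation vol := volume.

Lemma Rintegral_cst_torus (c : R) : \int[mu]_x c = c * vol.
Proof. by rewrite Rintegral_cst. Qed.

Lemma volume_gt0 : 0 < vol.
Proof. by rewrite fine_gt0// torus_gt0/= ltey_eq fin_num_measure. Qed.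

Lemma periodic_sub_torus_repr (Y : Type) (f : T -> Y) (x y : T) : periodic2pi f ->
  f (x - torus_repr y) = f (x - y).
Proof.
move=> pf; have [m ->] := torus_repr_lattice y.
rewrite -(@periodic_lattice _ _ _ f (x - y) (fun j => - m j))//; congr f.
by apply/rowP => j; rewrite !mxE mulrNz; ring.
Qed.

Variable u : T -> T.
Hypotheses (u_periodic : periodic2pi u) (u_lipschitz : lipschitz u).
Hypothesis u_divergence_free : divergence_free u.

Lemma measurable_euler h : measurable_fun [set: T] (fun x : T => x + h *: u x).
Proof.
apply: measurable_fun_rV => j; under eq_fun do rewrite !mxE.
apply: measurable_funD; first exact: measurable_coor.
by apply: measurable_funM => //; exact: measurable_field.
Qed.

(* Translation invariance of the torus turns the difference of the two
   integrals into an average of f (x + h u(x) - y) - f (x - y + h u(x - y)),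
   whose arguments differ by h (u(x) - u(x - y)). *)
Lemma convolution_euler (f F : T -> R) (L K e h : R) : 0 <= L -> 0 <= K ->
  periodic2pi f -> (forall x y, `|f x - f y| <= L * `|x - y|) ->
  (forall x y, `|u x - u y| <= K * `|x - y|) ->
  trigpoly F -> (forall y, 0 <= F y) -> \int[mu]_y F y = 1 ->
  \int[mu]_y (torus_norm y * F y) <= e ->
  `|\int[mu]_x convolution f F (x + h *: u x) - \int[mu]_x f (x + h *: u x)|
    <= `|h| * (L * K * e * vol).
Proof.
move=> L0 K0 pf fL uK tF F0 F1 Fe.
pose S (x : T) : T := x + h *: u x; pose g (x : T) : R := f (S x).
have [M M0 fM] := lipschitz_periodic_bounded pf fL.
have mf := lipschitz_measurable fL.
have mg : measurable_fun setT g by apply: measurableT_comp => //; exact: measurable_euler.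
have ig : mu.-integrable setT (EFin \o g).
  by apply: (bounded_integrable M) => // x; exact: fM.
have pg : periodic2pi g.
  by move=> x j; rewrite /g /S u_periodic addrAC pf.
have [N FN] := trigpoly_bounded tF; have mF := measurable_trigpoly tF.
have iF := trigpoly_integrable tF.
have mS := @measurable_euler h.
have mconv (k : T * T -> R) : measurable_fun setT k ->
    measurable_fun setT (fun p => k p * F p.2).
  by move=> mk; apply: measurable_funM => //; exact: measurableT_comp.
have bconv (k : T * T -> R) : (forall p, `|k p| <= M) -> forall p, `|k p * F p.2| <= M * N.
  by move=> kM p; rewrite normrM ler_pM.
have [|iG EG] := @Rintegral_exchange (fun p => g (p.1 - p.2) * F p.2) (M * N) _ (bconv _ (fun p => fM _)).
  by apply: mconv; apply: (measurableT_comp (f := g)) => //; exact: measurable_sub_rV.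
have [|iH _] := @Rintegral_exchange (fun p => f (S p.1 - p.2) * F p.2) (M * N) _ (bconv _ (fun p => fM _)).
  apply: mconv; apply: (measurableT_comp (f := f)) => //.
  apply: (measurableT_comp (f := fun p : T * T => p.1 - p.2) (g := fun p : T * T => (S p.1, p.2))).
    exact: measurable_sub_rV.
  apply/measurable_fun_pairP; split => /=; last exact: measurable_snd.
  by apply: (measurableT_comp mS); exact: measurable_fst.
rewrite /= in iG EG iH.
have iy (k : T -> R) : measurable_fun setT k -> (forall y, `|k y| <= M) ->
    mu.-integrable setT (EFin \o (fun y => k y * F y)).
  move=> mk kM; apply: (bounded_integrable (M * N)); first exact: measurable_funM.
  by move=> y; rewrite normrM ler_pM.
have msub (x : T) : measurable_fun setT (fun y : T => x - y).
  apply: measurable_fun_rV => j; under eq_fun do rewrite !mxE.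
  by apply: measurable_funB => //; exact: measurable_coor.
have -> : \int[mu]_x g x = \int[mu]_x (\int[mu]_y (g (x - y) * F y)).
  rewrite EG.
  have E y : \int[mu]_x (g (x - y) * F y) = (\int[mu]_x g x) * F y.
    rewrite -(@Rintegral_translate _ _ g (- y))// -RintegralZr//.
    apply: (bounded_integrable M) => [|x]; last exact: fM.
    apply: (measurableT_comp mg); apply: measurable_fun_rV => j; under eq_fun do rewrite !mxE.
    by apply: measurable_funB => //; exact: measurable_coor.
  under [RHS]eq_Rintegral do rewrite E.
  by rewrite RintegralZl// F1 mulr1.
rewrite -RintegralB//.
have bound x : `|convolution f F (S x) - \int[mu]_y (g (x - y) * F y)| <= `|h| * (L * K * e).
  rewrite /convolution -RintegralB//; last 2 first.
  - by apply: iy => //; apply: measurableT_comp.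
  - by apply: iy => [|y]; [exact: (measurableT_comp mg)|exact: fM].
  apply: (@le_trans _ _ (\int[mu]_y (`|h| * (L * K) * (torus_norm y * F y)))).
    apply: le_Rintegral_norm.
    - apply: RintegrableB; first by apply: iy => //; apply: measurableT_comp.
      by apply: iy => [|y]; [exact: (measurableT_comp mg)|exact: fM].
    - apply: RintegrableZ; apply: (bounded_integrable ((pi *+ 2) * N)).
        by apply: measurable_funM => //; exact: measurable_torus_norm.
      move=> y; rewrite normrM ler_pM//.
      by have /andP[t0 t1] := torus_norm_itv y; rewrite ger0_norm.
    - move=> y; rewrite -mulrBl normrM (ger0_norm (F0 y)) mulrA ler_wpM2r//.
      (* By periodicity [y] may be replaced by its representative, whose norm is [torus_norm y],
         small on average by [Fe]. *)
      rewrite -(periodic_sub_torus_repr _ y pf) -(periodic_sub_torus_repr _ y pg).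
      apply: le_trans (fL _ _) _.
      have -> : `|h| * (L * K) * torus_norm y = L * (`|h| * (K * torus_norm y)) by ring.
      apply: ler_wpM2l => //.
      rewrite (_ : _ - _ = h *: (u x - u (x - torus_repr y))); last first.
        by apply/rowP => j; rewrite !mxE; ring.
      rewrite normrZ; apply: ler_wpM2l => //; apply: le_trans (uK _ _) _.
      by rewrite subKr.
  rewrite RintegralZl//.
    by rewrite [leRHS]mulrA; apply: ler_wpM2l => //; rewrite !mulr_ge0.
  apply: (bounded_integrable ((pi *+ 2) * N)).
    by apply: measurable_funM => //; exact: measurable_torus_norm.
  move=> y; rewrite normrM ler_pM//.
  by have /andP[t0 t1] := torus_norm_itv y; rewrite ger0_norm.
have -> : `|h| * (L * K * e * vol) = \int[mu]_x (`|h| * (L * K * e)).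
  by rewrite Rintegral_cst_torus mulrA.
apply: le_Rintegral_norm => //; first exact: RintegrableB.
by set c := (X in (fun=> X)); apply: (bounded_integrable `|c|).
Qed.

(** The first-order term of the Taylor expansion is h times the integral of u . grad f, which is 0
    by the weak divergence condition; only the quadratic remainder is left. *)
Lemma trigpoly_euler (f : T -> R) : trigpoly f -> exists2 C, 0 <= C & forall h,
  `|\int[mu]_x f (x + h *: u x) - \int[mu]_x f x| <= C * `|h| ^+ 2.
Proof.
move=> tf; have [df [tdf [C C0 fC]]] := trigpoly_gradient tf.
have [U U0 uU] := field_bounded u_periodic u_lipschitz.
exists (C * U ^+ 2 * vol) => [|h]; first by rewrite !mulr_ge0 ?exprn_ge0// ltW ?volume_gt0.
have mu_ j := measurable_field u_lipschitz j.
have mf := measurable_trigpoly tf; have [M fM] := trigpoly_bounded tf.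
have iud : mu.-integrable setT (EFin \o (fun x => \sum_j u x 0 j * pderiv j f x)).
  apply: Rintegrable_sum => j; have [N dN] := trigpoly_bounded (tdf j).
  apply: (bounded_integrable (U * N)).
    by apply: measurable_funM => //; exact: measurable_trigpoly.
  by move=> x; rewrite normrM ler_pM// (le_trans (entry_le_norm _ _)).
have i1 : mu.-integrable setT (EFin \o (fun x => f (x + h *: u x))).
  apply: (bounded_integrable M) => //; apply: measurableT_comp => //.
  exact: measurable_euler.
have i2 := trigpoly_integrable tf.
have -> : \int[mu]_x f (x + h *: u x) - \int[mu]_x f x =
    \int[mu]_x (f (x + h *: u x) - f x - h * (\sum_j u x 0 j * pderiv j f x)).
  rewrite RintegralB//; [|exact: RintegrableB|exact: RintegrableZ].
  rewrite RintegralB// RintegralZl// u_divergence_free ?mulr0 ?subr0//.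
  exact: trigpoly_C1.
have -> : C * U ^+ 2 * vol * `|h| ^+ 2 = \int[mu]_x (C * (`|h| * U) ^+ 2).
  by rewrite Rintegral_cst_torus; ring.
apply: le_Rintegral_norm.
- by apply: RintegrableB; [exact: RintegrableB|exact: RintegrableZ].
- by apply: (bounded_integrable (`|C * (`|h| * U) ^+ 2|)).
- move=> x; have := fC x (h *: u x).
  under eq_bigr do rewrite mxE -mulrA.
  rewrite -mulr_sumr => /le_trans; apply; rewrite ler_wpM2l//.
  by rewrite lerXn2r ?nnegrE ?mulr_ge0// normrZ ler_wpM2l.
Qed.

(** Mollifying [f] costs e |h|, and the mollified function obeys the quadratic bound. [C] depends on
    the kernel, hence on [e], but [e] is fixed before [h] tends to 0, which is all that a zero
    derivative requires. *)
Lemma lipschitz_euler (f : T -> R) (L e : R) : periodic2pi f -> 0 <= L ->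
  (forall x y, `|f x - f y| <= L * `|x - y|) -> 0 < e ->
  exists2 C, 0 <= C & forall h,
    `|\int[mu]_x f (x + h *: u x) - \int[mu]_x f x| <= e * `|h| + C * `|h| ^+ 2.
Proof.
move=> pf L0 fL e0; have [K K0 uK] := field_lipschitz u_lipschitz.
pose q := L * K * vol + 1.
have q0 : 0 < q by rewrite ltr_wpDl// !mulr_ge0// ltW// volume_gt0.
have [F [tF F0 F1 Fe]] := @trig_kernel R d (e / q) (divr_gt0 e0 q0).
have [M M0 fM] := lipschitz_periodic_bounded pf fL.
have mf := lipschitz_measurable fL.
have tc : trigpoly (convolution f F) by apply: trigpoly_convolution => //; exists M.
have [C C0 hC] := trigpoly_euler tc; exists C => // h.
have h1 := convolution_euler h L0 K0 pf fL uK tF F0 F1 Fe.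
(* At h = 0 the bound is 0: mollification preserves the integral of f. *)
have h0 := convolution_euler 0 L0 K0 pf fL uK tF F0 F1 Fe.
move: h0; rewrite normr0 mul0r.
under eq_Rintegral do rewrite scale0r addr0.
under [X in _ - X]eq_Rintegral do rewrite scale0r addr0.
rewrite normr_le0 subr_eq0 => /eqP E0.
have := hC h; rewrite E0.
set a := \int[mu]_x convolution _ _ _ in h1 *; set b := \int[mu]_x f x.
set c := \int[mu]_x f _ in h1 * => ab.
rewrite -(subrKA a); apply: le_trans (ler_normD _ _) _; rewrite lerD// distrC.
apply: le_trans h1 _; rewrite mulrC ler_wpM2r//.
have -> : L * K * (e / q) * vol = (L * K * vol) * (e / q) by ring.
rewrite mulrA ler_pdivrMr// mulrC; apply: ler_wpM2l; first exact: ltW.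
by rewrite /q lerDl.
Qed.

Variable Phi : R -> T -> T.
Hypothesis Phi_flow : is_flow u Phi.

(** The derivative in t is 0 everywhere. With g = f o Phi_t, the group law reduces this to the time
    0 for g, which is periodic and Lipschitz but no longer trigonometric; hence [lipschitz_euler].
    Replacing Phi_h by an Euler step costs O(h^2). *)
Lemma Rintegral_flow (f : T -> R) (t : R) : trigpoly f ->
  \int[mu]_x f (Phi t x) = \int[mu]_x f x.
Proof.
move=> tf; pose I t := \int[mu]_x f (Phi t x).
have -> : \int[mu]_x f x = I 0.
  by apply: eq_Rintegral => x _; rewrite (flow0 Phi_flow).
apply: (@is_derive_0_is_cst R I) => {}t.
have [L L0 fL] := trigpoly_lipschitz tf.
have [C C0 PC] := flow_lipschitz u_lipschitz Phi_flow t.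
pose g x := f (Phi t x).
have pg : periodic2pi g.
  by move=> x j; rewrite /g (flow_periodic u_periodic u_lipschitz Phi_flow) periodic_trigpoly.
have gL x y : `|g x - g y| <= L * C * `|x - y|.
  by rewrite (le_trans (fL _ _))// -mulrA ler_wpM2l.
have LC0 : 0 <= L * C by rewrite mulr_ge0.
have [K K0 uK] := field_lipschitz u_lipschitz.
have [U U0 uU] := field_bounded u_periodic u_lipschitz.
have mg := lipschitz_measurable gL.
have [M M0 gM] := lipschitz_periodic_bounded pg gL.
have IE h : I (h + t) = \int[mu]_x g (Phi h x).
  apply: eq_Rintegral => x _; rewrite /g (flow_add u_lipschitz Phi_flow).
  by rewrite addrC.
have Ig : I t = \int[mu]_x g x by [].
have bound e : 0 < e -> exists2 D, 0 <= D & forall h, `|I (h + t) - I t| <= e * `|h| + D * `|h| ^+ 2.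
  move=> e0; have [D D0 hD] := lipschitz_euler pg LC0 gL e0.
  exists (L * C * (K * U) * vol + D) => [|h].
    by rewrite addr_ge0// !mulr_ge0// ltW// volume_gt0.
  rewrite IE Ig -(subrKA (\int[mu]_x g (x + h *: u x))).
  apply: le_trans (ler_normD _ _) _.
  rewrite mulrDl addrCA lerD//.
  rewrite -RintegralB//; last 2 first.
  - apply: (bounded_integrable M) => //; apply: measurableT_comp => //.
    exact: (measurable_flow u_lipschitz Phi_flow).
  - apply: (bounded_integrable M) => //; apply: measurableT_comp => //.
    exact: measurable_euler.
  have -> : L * C * (K * U) * vol * `|h| ^+ 2 = \int[mu]_x (L * C * (K * U * `|h| ^+ 2)).
    by rewrite Rintegral_cst_torus; ring.
  apply: le_Rintegral_norm.
  - apply: RintegrableB; apply: (bounded_integrable M) => //; apply: measurableT_comp => //.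
      exact: (measurable_flow u_lipschitz Phi_flow).
    exact: measurable_euler.
  - by apply: (bounded_integrable `|(L * C * (K * U * `|h| ^+ 2))|).
  - move=> x; rewrite (le_trans (gL _ _))// ler_wpM2l//.
    exact: (flow_euler Phi_flow).
have h : h^-1 *: ((I \o shift t) (h *: 1) - I t) @[h --> 0^'] --> 0.
  apply/cvgr0Pnorm_le => e e0.
  have [D D0 hD] := bound (e / 2) ltac:(by rewrite divr_gt0).
  near=> h.
  have hn0 : h != 0 by near: h; exact: nbhs_dnbhs_neq.
  rewrite /= [h *: 1]mulr1 normrZ normfV ler_pdivrMl ?normr_gt0//.
  apply: le_trans (hD h) _.
  have -> : e / 2 * `|h| + D * `|h| ^+ 2 = `|h| * (e / 2 + D * `|h|) by ring.
  apply: ler_wpM2l => //; rewrite [leRHS](splitr e) lerD2l.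
  apply: (@le_trans _ _ ((D + 1) * `|h|)); first by rewrite ler_wpM2r// lerDl.
  rewrite mulrC -ler_pdivlMr ?ltr_wpDl//; near: h.
  by apply: dnbhs0_le; rewrite !divr_gt0// ltr_wpDl.
apply: DeriveDef; first by apply/cvg_ex; exists 0.
exact/cvg_lim.
Unshelve. all: by end_near. Qed.

Lemma measure_preserving_flow t : measure_preserving (fun x => torus_repr (Phi t x)).
Proof.
apply: measure_preserving_trig.
- apply: measurableT_comp; first exact: measurable_torus_repr.
  exact: (measurable_flow u_lipschitz Phi_flow).
- by move=> x; exact: cell_torus_repr.
- move=> k a; have tc := @trigpoly_cos R d k a.
  rewrite -(Rintegral_flow t tc); apply: eq_Rintegral => x _.
  exact: (periodic_torus_repr _ (periodic_trigpoly tc)).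
Qed.

End flow_measure_preserving.

(** The first-order condition at a minimum. The chosen t is the minimiser with c + 1 in place of c,
    so that c = 0 needs no separate case. *)
Lemma quadratic_ge0_lin (R : realFieldType) (b c : R) : 0 <= c ->
  (forall t, 0 <= 2 * t * b + t ^+ 2 * c) -> b = 0.
Proof.
move=> c0 /(_ (- (b / (c + 1)))).
have c1 : 0 < c + 1 by rewrite ltr_wpDl.
have -> : 2 * - (b / (c + 1)) * b + (- (b / (c + 1))) ^+ 2 * c =
    - (b ^+ 2 * ((c + 2) / (c + 1) ^+ 2)) by field; rewrite gt_eqF.
rewrite oppr_ge0 pmulr_lle0 ?divr_gt0 ?exprn_gt0 ?ltr_wpDl// => b0.
by apply/eqP; rewrite -sqrf_eq0 eq_le b0 sqr_ge0.
Qed.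

(** * Hilbert spaces and compact forms *)

Section inner_product.
Variables (R : realType) (H : normedModType R) (ip : H -> H -> R).
Hypotheses (ipC : forall x y, ip x y = ip y x)
  (ipDl : forall x y z, ip (x + y) z = ip x z + ip y z)
  (ipZl : forall c x y, ip (c *: x) y = c * ip x y)
  (ip_norm : forall x, ip x x = `|x| ^+ 2).

Lemma ipDr x y z : ip x (y + z) = ip x y + ip x z.
Proof. by rewrite ipC ipDl !(ipC x). Qed.

Lemma ipZr c x y : ip x (c *: y) = c * ip x y.
Proof. by rewrite ipC ipZl ipC. Qed.

Lemma ipNl x y : ip (- x) y = - ip x y.
Proof. by rewrite -scaleN1r ipZl mulN1r. Qed.

Lemma ipNr x y : ip x (- y) = - ip x y.
Proof. by rewrite ipC ipNl ipC. Qed.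

Lemma ipBl x y z : ip (x - y) z = ip x z - ip y z.
Proof. by rewrite ipDl ipNl. Qed.

Lemma ipBr x y z : ip x (y - z) = ip x y - ip x z.
Proof. by rewrite ipDr ipNr. Qed.

Lemma ip0l x : ip 0 x = 0.
Proof. by rewrite -(scale0r x) ipZl mul0r. Qed.

Lemma ip0r x : ip x 0 = 0.
Proof. by rewrite ipC ip0l. Qed.

Lemma ip_suml (I : Type) (s : seq I) (F : I -> H) y :
  ip (\sum_(i <- s) F i) y = \sum_(i <- s) ip (F i) y.
Proof.
elim: s => [|i s IH]; first by rewrite !big_nil ip0l.
by rewrite !big_cons ipDl IH.
Qed.

Lemma ip_sumr (I : Type) (s : seq I) (F : I -> H) y :
  ip y (\sum_(i <- s) F i) = \sum_(i <- s) ip y (F i).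
Proof. by rewrite ipC ip_suml; apply: eq_bigr => i _; rewrite ipC. Qed.

Lemma ip_eq0 x : ip x x = 0 -> x = 0.
Proof. by rewrite ip_norm => /eqP; rewrite sqrf_eq0 normr_eq0 => /eqP. Qed.

Lemma ip_unit x : x != 0 -> ip (`|x|^-1 *: x) (`|x|^-1 *: x) = 1.
Proof.
move=> x0; rewrite ipZl ipZr ip_norm mulrA -invfM -expr2 mulVf// expf_eq0/=.
by rewrite normr_eq0.
Qed.

Lemma ip_cauchy x y : `|ip x y| <= `|x| * `|y|.
Proof.
have [->|y0] := eqVneq y 0; first by rewrite ip0r !normr0 mulr0.
have ny : 0 < `|y| by rewrite normr_gt0.
rewrite -ler_sqr ?nnegrE ?mulr_ge0// exprMn -!ip_norm -normrX ger0_norm ?sqr_ge0//.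
have yy : 0 < ip y y by rewrite ip_norm exprn_gt0.
have := sqr_ge0 `|x - (ip x y / ip y y) *: y|.
rewrite -ip_norm ipBl !ipBr !ipZl !ipZr (ipC y x).
set a := ip x x; set b := ip x y; set c := ip y y in yy *.
have -> : a - b / c * b - (b / c * b - b / c * (b / c * c)) = (a * c - b ^+ 2) / c.
  by field; rewrite gt_eqF.
by rewrite pmulr_lge0 ?invr_gt0// subr_ge0.
Qed.

Lemma parallelogram (x y : H) : `|x + y| ^+ 2 + `|x - y| ^+ 2 = 2 * `|x| ^+ 2 + 2 * `|y| ^+ 2.
Proof. by rewrite -!ip_norm !(ipDl, ipDr, ipNl, ipNr) (ipC y x); ring. Qed.

Lemma cvg_ip (s : nat -> H) l y : s n @[n --> \oo] --> l ->
  ip (s n) y @[n --> \oo] --> ip l y.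
Proof.
move=> sl; apply/cvgrPdist_le => e e0.
have y1 : 0 < `|y| + 1 by rewrite ltr_wpDl.
near=> n; rewrite -ipBl; apply: le_trans (ip_cauchy _ _) _.
apply: (@le_trans _ _ (`|l - s n| * (`|y| + 1))); first by rewrite ler_wpM2l// lerDl.
rewrite -ler_pdivlMr//; near: n.
by move/cvgrPdist_le : sl; apply; rewrite divr_gt0.
Unshelve. all: by end_near. Qed.

Hypothesis complete : forall s : nat -> H,
  (forall e, 0 < e -> exists N, forall m n, (N <= m)%N -> (N <= n)%N -> `|s m - s n| <= e) ->
  exists l : H, s n @[n --> \oo] --> l.

Definition subspace (K : set H) := [/\ K 0, forall x y, K x -> K y -> K (x + y) &
  forall c x, K x -> K (c *: x)].

Lemma subspaceB (K : set H) x y : subspace K -> K x -> K y -> K (x - y).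
Proof. by move=> [_ KD KZ] Kx Ky; apply: KD => //; rewrite -scaleN1r; exact: KZ. Qed.

Lemma subspace_sum (K : set H) (I : Type) (s : seq I) (F : I -> H) :
  subspace K -> (forall i, K (F i)) -> K (\sum_(i <- s) F i).
Proof.
move=> [K0 KD _] KF; elim: s => [|i s IH]; first by rewrite big_nil.
by rewrite big_cons; exact: KD.
Qed.

Theorem orthogonal_projection (K : set H) (x : H) : closed K -> subspace K ->
  exists2 p, K p & forall k, K k -> ip (x - p) k = 0.
Proof.
move=> clK sK; have [K0 KD KZ] := sK.
pose D := [set `|x - k| ^+ 2 | k in K].
have infD : has_inf D.
  split; first by exists (`|x - 0| ^+ 2), 0.
  by exists 0 => _ [k _ <-]; exact: sqr_ge0.
pose d := inf D.
have dle k : K k -> d <= `|x - k| ^+ 2 by move=> Kk; apply: ge_inf; [exact: infD.2|exists k].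
have /choice[s hs] : forall n : nat, exists k, K k /\ `|x - k| ^+ 2 < d + n.+1%:R^-1.
  move=> n; have n0 : 0 < n.+1%:R^-1 :> R by rewrite invr_gt0.
  by have [_ [k Kk <-] h] := inf_adherent n0 infD; exists k.
(* Parallelogram identity for x - s n and x - s m: the midpoint of s m and s n is in K, so its
   squared distance to x is at least d. *)
have dist m n : `|s m - s n| ^+ 2 <= 2 * m.+1%:R^-1 + 2 * n.+1%:R^-1.
  have := parallelogram (x - s n) (x - s m).
  have -> : x - s n - (x - s m) = s m - s n by rewrite opprB addrC addrA subrK.
  have -> : x - s n + (x - s m) = 2 *: (x - 2^-1 *: (s m + s n)).
    by rewrite scalerBr scalerA divff// scale1r scaler_nat mulr2n opprD addrACA [- s n - _]addrC.
  have Kmn : K (2^-1 *: (s m + s n)) by apply: KZ; apply: KD; have [] := hs m; have [] := hs n.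
  have := dle _ Kmn; have [_] := hs m; have [_] := hs n.
  rewrite normrZ exprMn (ger0_norm (ler0n R 2)).
  set a := `|x - s m| ^+ 2; set b := `|x - s n| ^+ 2; set c := `|x - 2^-1 *: _| ^+ 2.
  set q := `|s m - s n| ^+ 2; set r := m.+1%:R^-1; set t := n.+1%:R^-1.
  by move=> *; lra.
have [|p sp] := complete (s := s).
  move=> e e0; exists (Num.truncn (4 / e ^+ 2)).+1 => m n mN nN.
  have e2 : 0 < e ^+ 2 by rewrite exprn_gt0.
  have small k : ((Num.truncn (4 / e ^+ 2)).+1 <= k)%N -> k.+1%:R^-1 <= e ^+ 2 / 4 :> R.
    move=> Nk; rewrite -[leRHS]invrK lef_pV2 ?posrE ?invr_gt0 ?divr_gt0// invf_div.
    apply: ltW; apply: lt_le_trans (truncnS_gt _) _.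
    by rewrite ler_nat (leq_trans Nk).
  rewrite -ler_sqr ?nnegrE ?(ltW e0)//; apply: le_trans (dist m n) _.
  have := small m mN; have := small n nN.
  by set r := m.+1%:R^-1; set t := n.+1%:R^-1; move=> *; lra.
have Kp : K p by apply: closed_cvg sp => //; apply: nearW => n; have [] := hs n.
have xp : `|x - p| ^+ 2 <= d.
  have c1 : `|x - s n| ^+ 2 - n.+1%:R^-1 @[n --> \oo] --> `|x - p| ^+ 2 - 0.
    apply: cvgB; last exact: cvg_harmonic.
    apply: cvgM; apply: cvg_norm; apply: cvgB => //; exact: cvg_cst.
  rewrite -[leLHS]subr0; apply: (cvgr_to_le c1); apply: nearW => n.
  by rewrite lerBlDr ltW//; have [] := hs n.
exists p => // k Kk; apply: (@quadratic_ge0_lin _ _ (`|k| ^+ 2)) => // t.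
have Kt : K (p + (- t) *: k) by apply: KD => //; exact: KZ.
have := le_trans xp (dle _ Kt); rewrite opprD scaleNr opprK addrA.
rewrite -!ip_norm; move: (x - p) => y.
by rewrite !(ipDl, ipDr, ipZl, ipZr) (ipC k y); lra.
Qed.

(* An orthonormal sequence with zero entries where [nz] is false. *)
Variables (e : nat -> H) (nz : nat -> bool).
Hypotheses (e_orth : forall m n, ip (e m) (e n) = ((m == n) && nz n)%:R)
  (e_total : forall x, (forall n, ip x (e n) = 0) -> x = 0).

Definition expansion (a : nat -> R) n := \sum_(i < n) a i *: e i.

Definition projection x n := expansion (fun k => ip x (e k)) n.

Lemma ip_expansion a n k : ip (expansion a n) (e k) = (k < n)%N%:R * (nz k)%:R * a k.
Proof.
rewrite ip_suml; under eq_bigr do rewrite ipZl e_orth.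
have [kn|nk] := ltnP k n; last first.
  rewrite mul0r mul0r big1// => i _.
  by rewrite (ltn_eqF (leq_trans (ltn_ord i) nk)) mulr0.
rewrite (bigD1 (Ordinal kn))//= eqxx/= big1 => [|i ik].
  by rewrite addr0 mul1r mulrC.
by rewrite -val_eqE/= in ik; rewrite (negbTE ik) mulr0.
Qed.

Lemma nz_zero k : ~~ nz k -> e k = 0.
Proof. by move=> nk; apply: ip_eq0; rewrite e_orth (negbTE nk) andbF. Qed.

Lemma ip_nz x k : (nz k)%:R * ip x (e k) = ip x (e k).
Proof. by case: (boolP (nz k)) => [_|/nz_zero ->]; rewrite ?mul1r// ip0r mulr0. Qed.

Lemma ip_projection x n k : ip (projection x n) (e k) = (k < n)%N%:R * ip x (e k).
Proof. by rewrite ip_expansion -mulrA ip_nz. Qed.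

Lemma norm_expansion a n : (forall k, ~~ nz k -> a k = 0) ->
  `|expansion a n| ^+ 2 = \sum_(i < n) a i ^+ 2.
Proof.
move=> az; rewrite -ip_norm {2}/expansion ip_sumr; apply: eq_bigr => i _.
rewrite ipZr ip_expansion ltn_ord mul1r.
by case: (boolP (nz i)) => [_|/az ->]; rewrite /= ?mul1r ?mul0r ?expr0n// expr2.
Qed.

Lemma ip_projection_self x n : ip x (projection x n) = \sum_(i < n) ip x (e i) ^+ 2.
Proof. by rewrite ip_sumr; apply: eq_bigr => i _; rewrite ipZr expr2. Qed.

Lemma norm_projection x n : `|projection x n| ^+ 2 = \sum_(i < n) ip x (e i) ^+ 2.
Proof. by apply: norm_expansion => k /nz_zero ->; rewrite ip0r. Qed.

Lemma bessel x n : \sum_(i < n) ip x (e i) ^+ 2 <= `|x| ^+ 2.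
Proof.
have := sqr_ge0 `|x - projection x n|.
rewrite -(ip_norm (x - _)) ipBl !ipBr (ipC _ x) ip_projection_self !ip_norm norm_projection.
lra.
Qed.

Lemma norm_projection_sub x n : `|x - projection x n| <= `|x|.
Proof.
rewrite -ler_sqr ?nnegrE// -(ip_norm (x - _)) ipBl !ipBr (ipC _ x) ip_projection_self.
rewrite !ip_norm norm_projection subrr subr0 lerBlDr lerDl.
by apply: sumr_ge0 => i _; exact: sqr_ge0.
Qed.

Lemma projection_orth x n k : (k < n)%N -> ip (x - projection x n) (e k) = 0.
Proof. by move=> kn; rewrite ipBl ip_projection kn mul1r subrr. Qed.

Lemma expansion_sub a m n : (m <= n)%N ->
  expansion a n - expansion a m = expansion (fun k => (m <= k)%N%:R * a k) n.
Proof.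
move=> mn; rewrite /expansion (big_ord_widen n (fun k => a k *: e k) mn) [X in _ - X]big_mkcond/= -sumrB; apply: eq_bigr => i _.
by case: ltnP => _; rewrite ?subrr ?mul0r ?scale0r// subr0 mul1r.
Qed.

Theorem riesz_fischer (a : nat -> R) (M : R) : (forall k, ~~ nz k -> a k = 0) ->
  (forall n, \sum_(i < n) a i ^+ 2 <= M) ->
  exists x, [/\ forall k, ip x (e k) = a k, expansion a n @[n --> \oo] --> x & `|x| ^+ 2 <= M].
Proof.
move=> az aM; pose A n : R := \sum_(i < n) a i ^+ 2.
have ndA : nondecreasing_seq A.
  by apply/nondecreasing_seqP => n; rewrite /A big_ord_recr/= lerDl sqr_ge0.
have cA : cvgn A by apply: nondecreasing_is_cvgn => //; exists M => _ [n _ <-]; exact: aM.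
have dist m n : (m <= n)%N -> `|expansion a n - expansion a m| ^+ 2 = A n - A m.
  move=> mn; rewrite expansion_sub// norm_expansion; last by move=> k /az ->; rewrite mulr0.
  rewrite /A (big_ord_widen n (fun k => a k ^+ 2) mn) [X in _ - X]big_mkcond/= -sumrB.
  by apply: eq_bigr => i _; case: ltnP => _; rewrite ?subrr ?mul0r ?expr0n// subr0 mul1r.
have [|x ax] := complete (s := expansion a).
  move=> eps eps0; have eps2 : 0 < eps ^+ 2 by rewrite exprn_gt0.
  have /cvgrPdist_le /(_ _ eps2) [N _ hN] := cA.
  have h m n : (N <= m)%N -> (m <= n)%N -> `|expansion a n - expansion a m| <= eps.
    move=> Nm mn; rewrite -ler_sqr ?nnegrE ?(ltW eps0)// dist//.
    have An := nondecreasing_cvgn_le ndA cA n.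
    have /= := hN m Nm; rewrite ler_norml; lra.
  exists N => m n Nm Nn; have [mn|/ltnW nm] := leqP m n; last exact: h.
  by rewrite distrC; exact: h.
exists x; split => //.
  move=> k; have c1 := @cvg_ip _ _ (e k) ax.
  have c2 : ip (expansion a n) (e k) @[n --> \oo] --> a k.
    apply: (@cvg_trans _ ((fun=> a k) @ \oo)); last exact: cvg_cst.
    apply: near_eq_cvg; near=> n; rewrite ip_expansion.
    have -> : (k < n)%N by near: n; exists k.+1.
    by rewrite mul1r; case: (boolP (nz k)) => [_|/az ->]; rewrite ?mul1r ?mulr0.
  exact: cvg_unique c1 c2.
have c : `|expansion a n| ^+ 2 @[n --> \oo] --> `|x| ^+ 2.
  by apply: cvgM; apply: cvg_norm.
by apply: (cvgr_to_le c); apply: nearW => n; rewrite norm_expansion.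
Unshelve. all: by end_near. Qed.

Lemma cvg_projection x : projection x n @[n --> \oo] --> x.
Proof.
have [||y [ye cy _]] := @riesz_fischer (fun k => ip x (e k)) (`|x| ^+ 2).
- by move=> k /nz_zero ->; rewrite ip0r.
- exact: bessel.
suff yx : y = x by move: cy; rewrite yx.
by apply/eqP; rewrite -subr_eq0; apply/eqP/e_total => k; rewrite ipBl ye subrr.
Qed.

Lemma parseval x y : \sum_(i < n) ip x (e i) * ip y (e i) @[n --> \oo] --> ip x y.
Proof.
have h := @cvg_projection x; have := @cvg_ip _ _ y h.
apply: cvg_trans; apply: near_eq_cvg; apply: nearW => n; rewrite ip_suml.
by apply: eq_bigr => i _; rewrite ipZl (ipC _ y).
Qed.

(* Coordinatewise convergence along a subsequence, stated without extracting it. *)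
Theorem weak_cluster (f : nat -> H) : (forall n, `|f n| <= 1) ->
  exists2 g, `|g| <= 1 & forall N K eps, 0 < eps ->
    exists2 n, (N <= n)%N & forall k, (k < K)%N -> `|ip (f n - g) (e k)| <= eps.
Proof.
move=> f1.
(* By Bessel the coordinates of vectors of the unit ball lie in [-1, 1], so the sequences of
   coordinates have a cluster point in a compact product. *)
have cpt := @tychonoff nat (fun=> R) (fun=> `[-1, 1]%classic) (fun=> @segment_compact R (-1) 1).
pose F := (fun n k => ip (f n) (e k)) @ \oo.
have F1 : F [set f | (forall i : nat, `[-1, 1]%classic (f i))].
  exists 0%N => // n _ k /=; rewrite in_itv/= -ler_norml.
  rewrite -ler_sqr ?nnegrE// expr1n -normrX ger0_norm ?sqr_ge0//.
  apply: (@le_trans _ _ (`|f n| ^+ 2)); last by rewrite exprn_ile1.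
  apply: le_trans (bessel (f n) k.+1); rewrite big_ord_recr/= lerDr.
  by apply: sumr_ge0 => i _; exact: sqr_ge0.
have [g [_ gF]] := cpt F _ F1.
have near_coord K eps : 0 < eps -> \forall h \near g,
    forall k, (k < K)%N -> `|h k - g k| <= eps.
  move=> eps0; elim: K => [|K IH]; first by apply: filterE.
  have cK : \forall h \near g, `|h K - g K| <= eps.
    have pc := @proj_continuous nat (fun=> R) K g.
    have hb := pc _ (nbhsx_ballx (g K) eps eps0).
    have sub (a : R) : ball (g K) eps a -> `|a - g K| <= eps.
      by rewrite distrC => h; apply: ltW; exact: h.
    exact: (@filterS _ (nbhs g) _ _ _ (fun h => sub (h K)) hb).
  apply: filterS2 IH cK => h h1 h2 k; rewrite ltnS leq_eqVlt => /predU1P[->//|].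
  exact: h1.
have find N K eps : 0 < eps -> exists2 n, (N <= n)%N &
    forall k, (k < K)%N -> `|ip (f n) (e k) - g k| <= eps.
  move=> eps0.
  have FN : F [set h | exists2 n, (N <= n)%N & h = (fun k => ip (f n) (e k))].
    by exists N => // n /= Nn; exists n.
  have [h [[n Nn ->] hk]] := gF _ _ FN (near_coord K eps eps0).
  by exists n.
pose a k := (nz k)%:R * g k.
have a1 n : \sum_(i < n) a i ^+ 2 <= 1.
  have az k : ~~ nz k -> a k = 0 by move=> /negbTE nk; rewrite /a nk mul0r.
  rewrite -norm_expansion//; set p := expansion a n.
  (* |p|^2 is a limit of values of <f m, p>, each at most |p| since |f m| <= 1. *)
  suff pp : `|p| ^+ 2 <= `|p|.
    rewrite exprn_ile1//; have [->|p0] := eqVneq p 0; first by rewrite normr0.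
    by rewrite -(@ler_pM2l _ `|p|) ?normr_gt0// mulr1 -expr2.
  pose C := \sum_(i < n) `|a i|; have C0 : 0 <= C by apply: sumr_ge0.
  apply/ler_addgt0Pr => eps eps0.
  have del0 : 0 < eps / (C + 1) by rewrite divr_gt0// ltr_wpDl.
  have [m _ hm] := find 0%N n _ del0.
  have : `|ip (f m) p| <= `|p|.
    by apply: le_trans (ip_cauchy _ _) _; rewrite ler_piMl.
  have : `| `|p| ^+ 2 - ip (f m) p| <= eps.
    rewrite norm_expansion// /p ip_sumr -sumrB.
    apply: le_trans (ler_norm_sum _ _ _) _.
    apply: (@le_trans _ _ (C * (eps / (C + 1)))); last first.
      by rewrite mulrCA ger_pMr// ler_pdivrMr ?mul1r ?lerDl// ltr_wpDl.
    rewrite /C mulr_suml; apply: ler_sum => i _.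
    rewrite ipZr expr2 -mulrBr normrM ler_wpM2l// distrC.
    apply: le_trans (hm i (ltn_ord i)); rewrite -(ip_nz (f m)) /a -mulrBr normrM.
    by case: (nz i); rewrite ?normr1 ?mul1r// normr0 mul0r.
  by rewrite !ler_norml => /andP[_ h1] /andP[_ h2]; lra.
have az k : ~~ nz k -> a k = 0 by move=> /negbTE nk; rewrite /a nk mul0r.
have [x [xa _ x1]] := riesz_fischer az a1.
exists x.
  by rewrite -ler_sqr ?nnegrE// expr1n.
move=> N K eps eps0; have [n Nn hn] := find N K eps eps0; exists n => // k kK.
rewrite ipBl xa -(ip_nz (f n)) /a -mulrBr normrM; apply: le_trans (hn k kK).
by case: (nz k); rewrite ?normr1 ?mul1r// normr0 mul0r.
Qed.

(** As no subsequence is extracted, one index [n] has to meet all requirements at once; this adds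
    smallness against one given vector [y] to smallness of the first coordinates. *)
Lemma weak_cluster_ip (f : nat -> H) (g : H) : (forall n, `|f n| <= 1) -> `|g| <= 1 ->
  (forall N K eps, 0 < eps ->
    exists2 n, (N <= n)%N & forall k, (k < K)%N -> `|ip (f n - g) (e k)| <= eps) ->
  forall N K eps y, 0 < eps -> exists n, [/\ (N <= n)%N,
    forall k, (k < K)%N -> `|ip (f n - g) (e k)| <= eps & `|ip (f n - g) y| <= eps].
Proof.
move=> f1 g1 cl N K eps y eps0.
have eps4 : 0 < eps / 4 by rewrite divr_gt0.
have h := @cvg_projection y; have /cvgrPdist_le /(_ _ eps4) [L _ hL] := h.
have := hL L (leqnn L); rewrite /=; set p := projection y L => yp.
pose C := \sum_(i < L) `|ip y (e i)|; have C0 : 0 <= C by apply: sumr_ge0.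
(* Half of eps goes to the tail of y, of norm at most eps / 4 against |f n - g| <= 2; the other half
   to its first L coordinates, of total size C. *)
pose del := Num.min eps (eps / 2 / (C + 1)).
have del0 : 0 < del by rewrite lt_min eps0 !divr_gt0// ltr_wpDl.
have [n Nn hn] := cl N (maxn K L) _ del0.
exists n; split => // [k kK|].
  apply: le_trans (hn k _) _; first by rewrite leq_max kK.
  by rewrite ge_min lexx.
rewrite -[y in leLHS](subrK p) ipDr; apply: le_trans (ler_normD _ _) _.
have h1 : `|ip (f n - g) (y - p)| <= 2 * (eps / 4).
  apply: le_trans (ip_cauchy _ _) _; apply: ler_pM => //.
  by apply: le_trans (ler_normB _ _) _; have := lerD (f1 n) g1; lra.
have h2 : `|ip (f n - g) p| <= C * (eps / 2 / (C + 1)).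
  rewrite /p ip_sumr; apply: le_trans (ler_norm_sum _ _ _) _.
  rewrite /C mulr_suml; apply: ler_sum => i _; rewrite ipZr normrM ler_wpM2l//.
  apply: le_trans (hn i _) _; first by rewrite leq_max ltn_ord orbT.
  by rewrite ge_min lexx orbT.
have h3 : C * (eps / 2 / (C + 1)) <= eps / 2.
  by rewrite mulrCA ger_pMr ?divr_gt0// ler_pdivrMr ?mul1r ?lerDl// ltr_wpDl.
by apply: le_trans (lerD h1 (le_trans h2 h3)) _; lra.
Qed.

Lemma closed_orthogonal (S : set H) : closed [set w | forall v, S v -> ip w v = 0].
Proof.
move=> x clx v Sv; apply/eqP; rewrite -normr_le0; apply/ler_addgt0Pr => eps eps0.
have v1 : 0 < `|v| + 1 by rewrite ltr_wpDl.
have d0 : 0 < eps / (`|v| + 1) by rewrite divr_gt0.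
have [w [wS /= xw]] := clx _ (nbhsx_ballx x _ d0).
rewrite add0r -[ip x v]subr0 -(wS v Sv) -ipBl; apply: le_trans (ip_cauchy _ _) _.
apply: (@le_trans _ _ (eps / (`|v| + 1) * (`|v| + 1))); last by rewrite divfK// gt_eqF.
apply: ler_pM => //; last by rewrite lerDl.
by rewrite -ball_normE in xw; exact: ltW.
Qed.

Lemma subspace_orthogonal (S : set H) : subspace [set w | forall v, S v -> ip w v = 0].
Proof.
split => [v _|x y hx hy v Sv|c x hx v Sv]; first exact: ip0l.
- by rewrite ipDl hx// hy// addr0.
- by rewrite ipZl hx// mulr0.
Qed.

Lemma bessel_family m (v : nat -> H) (b : nat -> bool) (x : H) :
  (forall i j, (i < m)%N -> (j < m)%N -> ip (v i) (v j) = ((i == j) && b i)%:R) ->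
  \sum_(i < m) ip x (v i) ^+ 2 <= `|x| ^+ 2.
Proof.
move=> vb; pose p := \sum_(i < m) ip x (v i) *: v i.
have v0 i : (i < m)%N -> ip x (v i) * (b i)%:R = ip x (v i).
  move=> im; case: (boolP (b i)) => [_|nb]; first by rewrite mulr1.
  by rewrite [v i]ip_eq0 ?ip0r ?mul0r// vb// (negbTE nb) andbF.
have xp : ip x p = \sum_(i < m) ip x (v i) ^+ 2.
  by rewrite ip_sumr; apply: eq_bigr => i _; rewrite ipZr expr2.
have pp : ip p p = \sum_(i < m) ip x (v i) ^+ 2.
  rewrite {2}/p ip_sumr; apply: eq_bigr => i _; rewrite ipZr ip_suml (bigD1 i)//= big1 => [|j ji].
    by rewrite addr0 ipZl vb// eqxx/= v0// expr2.
  by rewrite ipZl vb// val_eqE (negbTE ji) mulr0.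
have := sqr_ge0 `|x - p|; rewrite -(ip_norm (x - p)) ipBl !ipBr (ipC p x) pp xp ip_norm; lra.
Qed.

Definition orthonormal_family m (v : nat -> H) :=
  forall i j, (i < m)%N -> (j < m)%N -> ip (v i) (v j) = (i == j)%:R.

(** A longest orthonormal family in V spans it: a non-zero residual of some x could be normalised
    and appended. *)
Lemma orthonormal_basis (V : set H) N : subspace V ->
  (forall m v, orthonormal_family m v -> (forall i, (i < m)%N -> V (v i)) -> (m <= N)%N) ->
  exists m v, [/\ orthonormal_family m v, forall i, (i < m)%N -> V (v i) &
    forall x, V x -> x = \sum_(i < m) ip x (v i) *: v i].
Proof.
move=> sV VN; pose P m := `[< exists v, orthonormal_family m v /\ forall i, (i < m)%N -> V (v i) >].
have P0 : exists m, P m by exists 0%N; apply/asboolP; exists (fun=> 0).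
have PN m : P m -> (m <= N)%N by move=> /asboolP[v [h1 h2]]; exact: VN h1 h2.
case: (ex_maxnP P0 PN) => m /asboolP[v [ov Vv]] mmax; exists m, v; split => // x Vx.
apply/eqP; rewrite -subr_eq0; apply/negPn/negP => y0.
set y := x - _ in y0; have ny : `|y| != 0 by rewrite normr_eq0.
have Vy : V y.
  have [_ _ VZ] := sV; apply: subspaceB => //.
  rewrite (eq_bigr (fun i : 'I_m => ip x (v i) *: (if (i < m)%N then v i else 0))) => [|i _].
    by apply: (subspace_sum _ sV) => i; rewrite ltn_ord; apply: VZ; exact: Vv.
  by rewrite ltn_ord.
have yv i : (i < m)%N -> ip y (v i) = 0.
  move=> im; rewrite ipBl ip_suml (bigD1 (Ordinal im))//= big1 => [|j ji].
    by rewrite addr0 ipZl ov// eqxx mulr1 subrr.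
  by rewrite ipZl ov// (_ : (_ == _) = false) ?mulr0//; apply/negbTE; rewrite -val_eqE in ji.
pose z := `|y|^-1 *: y; pose w i := if (i < m)%N then v i else z.
have := mmax m.+1; rewrite ltnn => /implyP; rewrite implybF => /negP; apply.
apply/asboolP; exists w; split => [i j|i]; rewrite /w.
  rewrite !ltnS => im jm; have [im'|mi] := ltnP i m; have [jm'|mj] := ltnP j m.
  - exact: ov.
  - by rewrite ipC ipZl yv// mulr0 (ltn_eqF (leq_trans im' mj)).
  - by rewrite ipZl yv// mulr0 gtn_eqF// (leq_trans jm' mi).
  - have -> : i = m by apply/eqP; rewrite eqn_leq im mi.
    have -> : j = m by apply/eqP; rewrite eqn_leq jm mj.
    by rewrite eqxx ip_unit.
by move=> _; case: ltnP => [/Vv//|_]; have [_ _] := sV; apply.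
Qed.

(** The hypotheses say that w n is the projection of e n onto the orthogonal complement of S.
    Orthogonality of z to these countably many vectors already gives orthogonality to the whole
    complement, hence z in K; countability is what almost sure statements on z require. *)
Lemma orthogonal_all (S K : set H) (w : nat -> H) (z : H) : closed K -> subspace K -> S `<=` K ->
  (forall n v, S v -> ip (w n) v = 0) ->
  (forall n y, (forall v, S v -> ip y v = 0) -> ip (e n - w n) y = 0) ->
  (forall n, ip (w n) z = 0) -> K z.
Proof.
move=> clK sK SK wW ew wz; pose W := [set w | forall v, S v -> ip w v = 0].
have zW y : W y -> ip z y = 0.
  have [p Wp hp] := orthogonal_projection z (@closed_orthogonal S) (@subspace_orthogonal S).
  suff p0 : p = 0 by move=> Wy; have := hp y Wy; rewrite p0 subr0.
  (* <p, e n> = <p, w n> = <z, w n> = 0, because e n - w n is orthogonal to p and z - p is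
     orthogonal to w n. *)
  apply: e_total => n; rewrite ipC -[e n](subrK (w n)) ipDl (ew n p Wp) add0r.
  by rewrite -[p](subKr z) ipBr wz ipC hp ?subr0//; exact: wW.
have [k Kk hk] := orthogonal_projection z clK sK.
suff r0 : z - k = 0 by move/eqP: r0; rewrite subr_eq0 => /eqP ->.
have Wr : W (z - k) by move=> v Sv; apply: hk; exact: SK.
by apply: ip_eq0; rewrite ipBr (hk k Kk) subr0 ipC zW.
Qed.

(** * Spectral theorem for positive bilinear forms of trace class *)

Section form.
Variables (B : H -> H -> R) (M : R).
Hypotheses (BC : forall x y, B x y = B y x)
  (BDl : forall x y z, B (x + y) z = B x z + B y z)
  (BZl : forall c x y, B (c *: x) y = c * B x y)
  (B_ge0 : forall x, 0 <= B x x)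
  (B_trace : forall m (v : nat -> H) (b : nat -> bool),
    (forall i j, (i < m)%N -> (j < m)%N -> ip (v i) (v j) = ((i == j) && b i)%:R) ->
    \sum_(i < m) B (v i) (v i) <= M)
  (B_total : \sum_(i < n) B (e i) (e i) @[n --> \oo] --> M).

Lemma formDr x y z : B x (y + z) = B x y + B x z.
Proof. by rewrite BC BDl !(BC x). Qed.

Lemma formZr c x y : B x (c *: y) = c * B x y.
Proof. by rewrite BC BZl BC. Qed.

Lemma form_sqrD x y : B (x + y) (x + y) = B x x + 2 * B x y + B y y.
Proof. by rewrite !(BDl, formDr) (BC y x); ring. Qed.

Lemma formBl x y z : B (x - y) z = B x z - B y z.
Proof. by rewrite BDl -scaleN1r BZl mulN1r. Qed.

Lemma form0 x : B x 0 = 0.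
Proof. by rewrite -(scale0r x) formZr mul0r. Qed.

Lemma form_sumr (I : Type) (s : seq I) (F : I -> H) y :
  B y (\sum_(i <- s) F i) = \sum_(i <- s) B y (F i).
Proof.
elim: s => [|i s IH]; first by rewrite !big_nil form0.
by rewrite !big_cons formDr IH.
Qed.

Lemma form_cauchy x y : B x y ^+ 2 <= B x x * B y y.
Proof.
have h t : 0 <= B x x + 2 * t * B x y + t ^+ 2 * B y y.
  by have := B_ge0 (x + t *: y); rewrite !(BDl, formDr, BZl, formZr) (BC y x); lra.
have [y0|y0] := eqVneq (B y y) 0.
  suff -> : B x y = 0 by rewrite expr0n/= y0 mulr0.
  apply/eqP/negPn/negP => xy0.
  have := h (- (B x x + 1) / (2 * B x y)); rewrite y0 mulr0 addr0.
  by rewrite [2 * _]mulrC -mulrA divfK ?mulf_neq0//; lra.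
have yy : 0 < B y y by rewrite lt_def y0 B_ge0.
have := h (- B x y / B y y).
set a := B x x; set b := B x y; set c := B y y in yy *.
have -> : a + 2 * (- b / c) * b + (- b / c) ^+ 2 * c = (a * c - b ^+ 2) / c.
  by field; rewrite gt_eqF.
by rewrite pmulr_lge0 ?invr_gt0// subr_ge0.
Qed.

Lemma form_bound_ge0 : 0 <= M.
Proof. by have := @B_trace 0 (fun=> 0) xpredT; rewrite big_ord0; apply. Qed.

Lemma form_le x : B x x <= M * `|x| ^+ 2.
Proof.
have [->|x0] := eqVneq x 0; first by rewrite form0 normr0 expr0n/= mulr0.
have nx : 0 < `|x| by rewrite normr_gt0.
have := @B_trace 1 (fun=> `|x|^-1 *: x) xpredT; rewrite big_ord1 BZl formZr.
rewrite -ler_pdivrMr ?exprn_gt0// mulrA -expr2 exprVn mulrC; apply.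
by move=> [|//] [|//] _ _; rewrite ip_unit.
Qed.

Lemma form_le_norm x y : B x y ^+ 2 <= B x x * M * `|y| ^+ 2.
Proof. by apply: le_trans (form_cauchy x y) _; rewrite -mulrA ler_wpM2l// form_le. Qed.

Lemma cvg_form (s : nat -> H) (l x : H) : s n @[n --> \oo] --> l ->
  B x (s n) @[n --> \oo] --> B x l.
Proof.
move=> sl; apply/cvgrPdist_le => eps eps0.
have C0 : 0 < B x x * M + 1 by rewrite ltr_wpDl// mulr_ge0// form_bound_ge0.
have d0 : 0 < Num.sqrt (eps ^+ 2 / (B x x * M + 1)) by rewrite sqrtr_gt0 divr_gt0// exprn_gt0.
have /cvgrPdist_le /(_ _ d0) := sl; apply: filterS => n hn.
rewrite -ler_sqr ?nnegrE ?(ltW eps0)// -normrX ger0_norm ?sqr_ge0//.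
have -> : B x l - B x (s n) = B x (l - s n) by rewrite !(BC x) formBl.
apply: le_trans (form_le_norm _ _) _.
have : `|l - s n| ^+ 2 <= eps ^+ 2 / (B x x * M + 1).
  rewrite -(@sqr_sqrtr _ (_ / _)) ?divr_ge0 ?sqr_ge0 ?(ltW C0)//.
  by rewrite lerXn2r ?nnegrE ?normr_ge0 ?sqrtr_ge0.
rewrite ler_pdivlMr// => h; apply: le_trans _ h; rewrite mulrC ler_wpM2l ?sqr_ge0// lerDl//.
Qed.

(** The coefficients B x (e k) are square summable: the partial expansion p satisfies B x p = |p|^2,
    while Cauchy-Schwarz bounds B x p by a multiple of |p|. The vector c plays the role of the
    operator of B applied to x. *)
Lemma form_riesz x : exists c, forall y, ip c y = B x y.
Proof.
have a0 k : ~~ nz k -> B x (e k) = 0 by move=> /nz_zero ->; rewrite form0.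
have aM n : \sum_(i < n) B x (e i) ^+ 2 <= B x x * M.
  rewrite -(@norm_expansion (fun k => B x (e k)))//; set p := expansion _ n.
  have Bp : B x p = `|p| ^+ 2.
    by rewrite norm_expansion// form_sumr; apply: eq_bigr => i _; rewrite formZr expr2.
  have := form_le_norm x p; rewrite Bp; have [->|p0] := eqVneq p 0.
    by rewrite normr0 expr0n/= mulr_ge0// form_bound_ge0.
  by rewrite expr2 ler_pM2r// exprn_gt0// normr_gt0.
have [c [ce _ _]] := riesz_fischer a0 aM; exists c => y.
have h := @cvg_projection y.
have h1 := @cvg_ip _ _ c h; have h2 := @cvg_form _ _ x h.
have E : (fun n => B x (projection y n)) = (fun n => ip (projection y n) c).
  apply/funext => n; rewrite form_sumr ip_suml; apply: eq_bigr => i _.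
  by rewrite formZr ipZl (ipC _ c) ce.
rewrite E in h2; rewrite ipC; exact: cvg_unique h1 h2.
Qed.

(** Adjoin the normalised x to the first K basis vectors: the trace bound leaves for it only the
    part of M that those K vectors miss, which is small by [B_total]. This uniform smallness on
    tails is the compactness of B. *)
Lemma form_tail eps : 0 < eps -> exists K, forall x,
  (forall k, (k < K)%N -> ip x (e k) = 0) -> B x x <= eps * `|x| ^+ 2.
Proof.
move=> eps0; have /cvgrPdist_le /(_ _ eps0) [K _ /(_ K (leqnn K)) /= hK] := B_total.
exists K => x xK; have [->|x0] := eqVneq x 0; first by rewrite form0 normr0 expr0n/= mulr0.
have nx : `|x| != 0 by rewrite normr_eq0.
pose v i := if (i < K)%N then e i else `|x|^-1 *: x.
pose b i := if (i < K)%N then nz i else true.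
have vb i j : (i < K.+1)%N -> (j < K.+1)%N -> ip (v i) (v j) = ((i == j) && b i)%:R.
  rewrite !ltnS /v /b => iK jK; have [iK'|Ki] := ltnP i K; have [jK'|Kj] := ltnP j K.
  - by rewrite e_orth; case: eqP => [->|].
  - by rewrite ipC ipZl xK// mulr0 (ltn_eqF (leq_trans iK' Kj)).
  - by rewrite ipZl xK// mulr0 gtn_eqF// (leq_trans jK' Ki).
  - have -> : i = K by apply/eqP; rewrite eqn_leq iK Ki.
    have -> : j = K by apply/eqP; rewrite eqn_leq jK Kj.
    by rewrite eqxx ip_unit.
have := B_trace vb; rewrite big_ord_recr/= [in B (v K) _]/v [in B _ (v K)]/v ltnn BZl formZr.
have -> : \sum_(i < K) B (v i) (v i) = \sum_(i < K) B (e i) (e i).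
  by apply: eq_bigr => i _; rewrite /v ltn_ord.
have -> : `|x|^-1 * (`|x|^-1 * B x x) = B x x / `|x| ^+ 2.
  by rewrite expr2 invfM mulrA mulrC.
rewrite -ler_pdivrMr ?exprn_gt0 ?normr_gt0//.
by have := ler_norm (M - \sum_(i < K) B (e i) (e i)); lra.
Qed.

Definition eigenspace (lambda : R) : set H :=
  [set v | forall y, B v y = lambda * ip v y].

Lemma subspace_eigenspace lambda : subspace (eigenspace lambda).
Proof.
split => [y|x y hx hy z|c x hx z]; first by rewrite BC form0 ip0l mulr0.
- by rewrite BDl ipDl hx hy mulrDr.
- by rewrite BZl ipZl hx mulrCA.
Qed.

(** An orthonormal family of m eigenvectors has trace m lambda, so m <= M / lambda. *)
Lemma eigenspace_basis lambda : 0 < lambda ->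
  exists m v, [/\ orthonormal_family m v, forall i, (i < m)%N -> eigenspace lambda (v i) &
    forall x, eigenspace lambda x -> x = \sum_(i < m) ip x (v i) *: v i].
Proof.
move=> l0; apply: (@orthonormal_basis _ (Num.truncn (M / lambda))); first exact: subspace_eigenspace.
move=> m v ov Vv; rewrite truncn_ge_nat ?divr_ge0 ?form_bound_ge0 ?(ltW l0)// ler_pdivlMr//.
rewrite -[X in X%:R]card_ord mulr_natl -sumr_const.
have /= hB := @B_trace m v xpredT.
apply: (le_trans _ (hB _)) => [|i j im jm]; last by rewrite ov// andbT.
by apply: ler_sum => i _; rewrite Vv// ov// eqxx mulr1.
Qed.

Definition eigenvectors : set H := [set v | exists2 lambda, 0 < lambda & eigenspace lambda v].

(** Let W be the orthogonal complement of the eigenvectors. If B were not zero on it, its supremum m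
    over the unit ball of W would be positive and, by compactness, attained at some g in W. The
    first variation makes g an eigenvector for m, hence orthogonal to itself, against B g g >= m >
    0. *)
Theorem form_spectral w : (forall v, eigenvectors v -> ip w v = 0) -> B w w = 0.
Proof.
pose W := [set w | forall v, eigenvectors v -> ip w v = 0].
have sW : subspace W := @subspace_orthogonal eigenvectors; have [W0 WD WZ] := sW.
move=> Ww; apply/eqP/negPn/negP => Bw0.
have Bw : 0 < B w w by rewrite lt_def Bw0 B_ge0.
have w0 : w != 0 by apply: contraNneq Bw0 => ->; rewrite form0.
pose D := [set B f f | f in [set f | W f /\ `|f| <= 1]].
have D1 : has_sup D.
  split; first by exists (B 0 0), 0 => //; rewrite /= normr0.
  exists M => _ [f [_ f1] <-]; apply: le_trans (form_le f) _.
  by rewrite ler_piMr ?form_bound_ge0// exprn_ile1.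
pose m := sup D.
have mle f : W f -> B f f <= m * `|f| ^+ 2.
  move=> Wf; have [->|f0] := eqVneq f 0; first by rewrite form0 normr0 expr0n/= mulr0.
  have nf : `|f| != 0 by rewrite normr_eq0.
  rewrite -ler_pdivrMr ?exprn_gt0 ?normr_gt0//; apply: ub_le_sup; first exact: D1.2.
  exists (`|f|^-1 *: f); last by rewrite BZl formZr expr2 invfM mulrA mulrC.
  by split; [exact: WZ|rewrite normrZ normfV normr_id mulVf].
have m0 : 0 < m.
  by have := mle w Ww; rewrite -ler_pdivrMr ?exprn_gt0 ?normr_gt0//; apply: lt_le_trans;
    rewrite divr_gt0// exprn_gt0// normr_gt0.
have /choice[f hf] : forall n : nat, exists f, [/\ W f, `|f| <= 1 & m - n.+1%:R^-1 < B f f].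
  move=> n; have n0 : 0 < n.+1%:R^-1 :> R by rewrite invr_gt0.
  by have [_ [f [Wf f1] <-] h] := sup_adherent n0 D1; exists f.
have f1 n : `|f n| <= 1 by have [] := hf n.
have [g g1 gcl] := weak_cluster f1.
have cl := weak_cluster_ip f1 g1 gcl.
have Wg : W g.
  move=> v Ev; apply/eqP; rewrite -normr_le0; apply/ler_addgt0Pr => eps eps0.
  have [n [_ _]] := cl 0%N 0%N eps v eps0.
  by rewrite ipBl; have [/(_ v Ev) -> _ _] := hf n; rewrite sub0r normrN add0r.
have [c cg] := form_riesz g.
(* f n - g is split into its first K coordinates p, small by weak convergence, and a tail q, on
   which [form_tail] makes B small. *)
have mg : m <= B g g.
  apply/ler_addgt0Pr => eps eps0.
  have eps32 : 0 < eps / 32 by rewrite divr_gt0.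
  have [K hK] := form_tail eps32.
  have MK : 0 < M * K%:R + 1 by rewrite ltr_wpDl// mulr_ge0// form_bound_ge0.
  (* Budget: B p p and B q q cost eps / 8 each, B g h and B p q twice eps / 8 each, and 1 / (n + 1)
     costs eps / 4. The eps / 32 above becomes eps / 8 through |q| <= 2. *)
  pose del := Num.min 1 (Num.min (eps / 8) (eps / 8 / (M * K%:R + 1))).
  have del0 : 0 < del by rewrite !lt_min ltr01 !divr_gt0.
  pose N := (Num.truncn (4 / eps)).+1.
  have [n [Nn hn hc]] := cl N K del c del0.
  have [_ _ fm] := hf n.
  have nN : n.+1%:R^-1 <= eps / 4.
    rewrite -[leRHS]invrK lef_pV2 ?posrE ?invr_gt0 ?divr_gt0// invf_div.
    apply: ltW; apply: lt_le_trans (truncnS_gt _) _; rewrite ler_nat (leq_trans Nn)//.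
  set h := f n - g in hn hc.
  have h2 : `|h| <= 2 by apply: le_trans (ler_normB _ _) _; have := f1 n; lra.
  have Bgh : `|B g h| <= eps / 8.
    by rewrite -cg ipC; apply: le_trans hc _; rewrite !ge_min lexx !orbT.
  pose p := projection h K; pose q := h - p.
  have Bq : B q q <= eps / 32 * 4.
    apply: le_trans (hK q _) _ => [k kK|]; first exact: projection_orth.
    rewrite ler_wpM2l ?(ltW eps32)//.
    rewrite (_ : 4 = 2 ^+ 2); last by rewrite expr2 -natrM.
    by rewrite lerXn2r// ?nnegrE//; apply: le_trans (norm_projection_sub h K) h2.
  have Bp : B p p <= eps / 8.
    apply: le_trans (form_le p) _; rewrite norm_projection.
    apply: (@le_trans _ _ (M * (K%:R * del))).
      rewrite ler_wpM2l ?form_bound_ge0// -[X in X%:R]card_ord mulr_natl -sumr_const.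
      apply: ler_sum => k _; rewrite -(ger0_norm (sqr_ge0 (ip h _))) normrX.
      have d1 : del <= 1 by rewrite ge_min lexx.
      apply: le_trans (_ : del ^+ 2 <= _); first by rewrite lerXn2r ?nnegrE ?(ltW del0)// hn.
      by rewrite expr2 ler_piMr// ltW.
    rewrite mulrA; apply: (@le_trans _ _ (M * K%:R * (eps / 8 / (M * K%:R + 1)))).
      by rewrite ler_wpM2l ?mulr_ge0 ?form_bound_ge0// !ge_min lexx !orbT.
    by rewrite mulrCA ger_pMr ?divr_gt0// ler_pdivrMr// mul1r lerDl.
  have Bpq : B p q ^+ 2 <= (eps / 8) ^+ 2.
    apply: le_trans (form_cauchy _ _) _; rewrite expr2; apply: ler_pM => //.
    by apply: le_trans Bq _; lra.
  have Bpq' : `|B p q| <= eps / 8.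
    by rewrite -ler_sqr ?nnegrE ?divr_ge0 ?(ltW eps0)// -normrX ger0_norm ?sqr_ge0.
  have fE : f n = g + (p + q) by rewrite /q (addrC p) subrK addrC subrK.
  have hE : h = p + q by rewrite /q (addrC p) subrK.
  have : B (f n) (f n) = B g g + 2 * B g h + (B p p + 2 * B p q + B q q).
    by rewrite fE form_sqrD (form_sqrD p q) -hE.
  move: Bgh Bpq'; rewrite !ler_norml => /andP[_ ?] /andP[_ ?].
  by move: nN fm; set r := n.+1%:R^-1; move=> *; lra.
have Bgm y : W y -> m * ip g y - B g y = 0.
  move=> Wy; apply: (@quadratic_ge0_lin _ _ (m * ip y y - B y y)) => [|t].
    by rewrite ip_norm subr_ge0; exact: mle.
  have := mle (g + t *: y) (WD _ _ Wg (WZ t _ Wy)).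
  rewrite -ip_norm !(BDl, formDr, BZl, formZr, ipDl, ipDr, ipZl, ipZr) (ipC y g) (BC y g).
  have : m * ip g g <= B g g.
    apply: le_trans mg; rewrite ip_norm ler_piMr ?(ltW m0)// exprn_ile1//.
  by move=> *; lra.
have Wc : W c.
  move=> v [l l0 Ev]; rewrite cg BC Ev ipC Wg ?mulr0//; by exists l.
have Eg : eigenspace m g.
  (* Testing on W suffices: g and the Riesz vector c of B g both lie in W, so neither sees the
     component of y orthogonal to W. *)
  move=> y; have [p Wp hq] := orthogonal_projection y (@closed_orthogonal eigenvectors) sW.
  rewrite -(subrK p y) formDr ipDr (ipC g (y - p)) hq// add0r -cg (ipC c (y - p)) hq// add0r.
  by apply/eqP; rewrite eq_sym -subr_eq0; apply/eqP; exact: Bgm.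
have gg : ip g g = 0 by apply: Wg; exists m.
by move: mg; rewrite Eg gg mulr0 leNgt m0.
Qed.

End form.

End inner_product.

(** * The Hilbert space of square-integrable functions *)

Section Rfatou.
Context (dT : measure_display) (T : measurableType dT) (R : realType).
Variable m : {measure set T -> \bar R}.

Lemma Rfatou (f_ : nat -> T -> R) (f : T -> R) (c : R) :
  (forall n, m.-integrable setT (EFin \o f_ n)) -> (forall n x, 0 <= f_ n x) ->
  (forall x, f_ n x @[n --> \oo] --> f x) -> (forall n, \int[m]_x f_ n x <= c) ->
  m.-integrable setT (EFin \o f) /\ \int[m]_x f x <= c.
Proof.
move=> intf f0 cf fc.
have mf n := Rintegrable_measurable (intf n).
have mlim : measurable_fun setT f by apply: measurable_fun_cvg => // x _; exact: cf.
have f_ge0 x : 0 <= f x by apply: (cvgr_to_ge (cf x)); exact: nearW.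
have F : (\int[m]_x (f x)%:E <= c%:E)%E.
  have h : (\int[m]_x limn_einf (fun n => (f_ n x)%:E) <=
      limn_einf (fun n => \int[m]_x (f_ n x)%:E))%E.
    apply: fatou => // [n|n x _]; last by rewrite lee_fin.
    by apply/measurable_EFinP; exact: mf.
  apply: le_trans (_ : _ <= \int[m]_x limn_einf (fun n => (f_ n x)%:E))%E _.
    rewrite le_eqVlt; apply/orP; left; apply/eqP; apply: eq_integral => x _.
    have cx : (f_ n x)%:E @[n --> \oo] --> (f x)%:E by apply: cvg_EFin; [exact: nearW|exact: cf].
    by rewrite is_cvg_limn_einfE ?(cvg_lim _ cx)//; apply/cvg_ex; eexists; exact: cx.
  apply: (le_trans h).
  rewrite limn_einf_lim; apply: lime_le; first exact: is_cvg_einfs.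
  apply: nearW => n; apply: le_trans (_ : \int[m]_x (f_ n x)%:E <= _)%E.
    by apply: ereal_inf_lbound; exists n => /=.
  by rewrite -(fineK (integrable_fin_num measurableT (intf n))) lee_fin; exact: fc.
have intf' : m.-integrable setT (EFin \o f).
  apply/integrableP; split; first exact/measurable_EFinP.
  under eq_integral do rewrite /= ger0_norm//.
  exact: le_lt_trans F (ltry _).
split => //; rewrite -lee_fin /Rintegral fineK//; exact: integrable_fin_num.
Qed.

End Rfatou.

Section L2_inner.
Variables (R : realType) (d : nat).
Notation mu := (torus R d).
Notation T := 'rV[R]_d.
Implicit Types f g : L2 R d.

Lemma Lnorm2E (h : T -> R) : mu.-integrable setT (EFin \o (fun x => h x ^+ 2)) ->
  ('N[mu]_2%:E[EFin \o h] = (Num.sqrt (\int[mu]_x h x ^+ 2))%:E)%E.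
Proof.
move=> ih; rewrite unlock /Lnorm.
have E x : (`|(EFin \o h) x| `^ 2 = (h x ^+ 2)%:E)%E.
  by rewrite [LHS](poweR_EFin `|h x| 2) powR_mulrn// real_normK ?num_real.
under eq_integral do rewrite E.
rewrite -[X in (X `^ _)%E]fineK; last by apply: (integrable_fin_num measurableT ih).
by rewrite poweR_EFin powR12_sqrt// fine_ge0// integral_ge0// => x _; rewrite lee_fin sqr_ge0.
Qed.

Lemma is_L2_sqr (h : T -> R) : measurable_fun setT h ->
  mu.-integrable setT (EFin \o (fun x => h x ^+ 2)) -> \int[mu]_x h x = 0 -> is_L2 h.
Proof.
move=> mh ih h0; split => //; rewrite inE; apply/andP; split; rewrite inE//=.
by rewrite /finite_norm Lnorm2E// ltry.
Qed.

Definition ip f g := \int[mu]_x (f x * g x).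

Lemma L2_integrable f : mu.-integrable setT (EFin \o f).
Proof. exact: is_L2_integrable (L2_is_L2 f). Qed.

Lemma L2_integrableM f g : mu.-integrable setT (EFin \o (fun x => f x * g x)).
Proof.
by apply/Lfun1_integrable; exact: Lfun2_mul_Lfun1 (L2_is_L2 f).1 (L2_is_L2 g).1.
Qed.

Lemma L2_norm_sqr f : `|f| ^+ 2 = \int[mu]_x f x ^+ 2.
Proof.
have h := Lfun2_integrable_sqr (L2_is_L2 f).1.
have := L2_normE f; rewrite Lnorm2E// => -[E].
rewrite [`|f|]E sqr_sqrtr//.
by apply: Rintegral_ge0 => x _; exact: sqr_ge0.
Qed.

Lemma ip_normE f : ip f f = `|f| ^+ 2.
Proof. by rewrite L2_norm_sqr; under [RHS]eq_Rintegral do rewrite expr2. Qed.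

Lemma ip_sym f g : ip f g = ip g f.
Proof. by under [LHS]eq_Rintegral do rewrite mulrC. Qed.

Lemma measurable_L2M f (h : T -> R) : measurable_fun setT h ->
  measurable_fun setT (fun x => f x * h x).
Proof. by move=> mh; apply: measurable_funM => //; exact: L2_measurable. Qed.

Lemma ipDf f f' g : ip (f + f') g = ip f g + ip f' g.
Proof.
rewrite /ip -RintegralD ?L2_integrableM//; apply: Rintegral_ae_eq.
- by apply: measurable_L2M; exact: L2_measurable.
- by apply: measurable_funD; apply: measurable_L2M; exact: L2_measurable.
- by have := L2_addE f f'; apply: filterS => x /= ->; rewrite mulrDl.
Qed.

Lemma ipZf c f g : ip (c *: f) g = c * ip f g.
Proof.
rewrite /ip -RintegralZl ?L2_integrableM//; apply: Rintegral_ae_eq.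
- by apply: measurable_L2M; exact: L2_measurable.
- by apply: measurable_funM => //; apply: measurable_L2M; exact: L2_measurable.
- by have := L2_scaleE c f; apply: filterS => x /= ->; rewrite mulrA.
Qed.

Lemma L2_subE f g : {ae mu, forall x, (f - g) x = f x - g x}.
Proof.
have := L2_addE f (- g); have := L2_oppE g.
by apply: filterS2 => x h h'; rewrite [LHS]h' h.
Qed.

(** Integrates |h| <= a / 2 + h^2 / (2 a). The bound is linear in a, as Cauchy-Schwarz would give,
    so that geometric L^2 bounds yield a convergent series of L^1 norms. *)
Lemma sqr_integrable_norm (h : T -> R) (a : R) : 0 < a -> measurable_fun setT h ->
  mu.-integrable setT (EFin \o (fun x => h x ^+ 2)) -> \int[mu]_x h x ^+ 2 <= a ^+ 2 ->
  mu.-integrable setT (EFin \o h) /\ \int[mu]_x `|h x| <= a / 2 * (volume R d + 1).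
Proof.
move=> a0 mh i2 ha.
have i1 : mu.-integrable setT (EFin \o (fun=> a / 2)) by apply: (bounded_integrable `|a / 2|).
have i3 : mu.-integrable setT (EFin \o (fun x => (2 * a)^-1 * h x ^+ 2)) by exact: RintegrableZ.
have le x : `|h x| <= a / 2 + (2 * a)^-1 * h x ^+ 2.
  rewrite -subr_ge0.
  have -> : a / 2 + (2 * a)^-1 * h x ^+ 2 - `|h x| = (2 * a)^-1 * (a - `|h x|) ^+ 2.
    by rewrite -(real_normK (num_real (h x))); field; rewrite gt_eqF.
  by rewrite mulr_ge0 ?sqr_ge0// invr_ge0 mulr_ge0// ltW.
have ih : mu.-integrable setT (EFin \o h) by apply: (le_Rintegrable mh _ le); exact: RintegrableD.
split => //.
apply: (@le_trans _ _ (\int[mu]_x (a / 2 + (2 * a)^-1 * h x ^+ 2))).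
  apply: le_Rintegral => //; last by exact: RintegrableD.
  exact: integrable_norm ih.
have -> : \int[mu]_x (a / 2 + (2 * a)^-1 * h x ^+ 2) =
    (\int[mu]_x (a / 2)) + \int[mu]_x ((2 * a)^-1 * h x ^+ 2) by rewrite -RintegralD.
rewrite (Rintegral_cst_torus d (a / 2)) RintegralZl// mulrDr mulr1 lerD2l.
have -> : a / 2 = (2 * a)^-1 * a ^+ 2 by field; rewrite gt_eqF.
by rewrite ler_wpM2l ?invr_ge0 ?mulr_ge0 ?(ltW a0).
Qed.

Lemma L2_norm_ae f (h : T -> R) : {ae mu, forall x, f x = h x} -> measurable_fun setT h ->
  mu.-integrable setT (EFin \o (fun x => h x ^+ 2)) /\ \int[mu]_x h x ^+ 2 = `|f| ^+ 2.
Proof.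
move=> fh mh; have ii := Lfun2_integrable_sqr (L2_is_L2 f).1.
have mm := measurable_funX 2 mh; have mf := measurable_funX 2 (L2_measurable f).
have ae : {ae mu, forall x, f x ^+ 2 = h x ^+ 2} by apply: filterS fh => x ->.
split; last by rewrite L2_norm_sqr; apply/esym/Rintegral_ae_eq.
apply/integrableP; split; first exact/measurable_EFinP.
have /integrableP[_] := ii; congr (_ < _)%E; apply: ae_eq_integral => //.
- by apply: measurableT_comp => //; exact/measurable_EFinP.
- by apply: measurableT_comp => //; exact/measurable_EFinP.
- by apply: filterS ae => x /= -> _.
Qed.

(** Along a subsequence with steps at most 2^-k, the sum of the absolute differences is integrable,
    hence finite almost everywhere. Representatives then converge pointwise, and Fatou turns this
    into convergence in norm. *)
Theorem L2_complete (s : nat -> L2 R d) :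
  (forall e, 0 < e -> exists N, forall m n, (N <= m)%N -> (N <= n)%N -> `|s m - s n| <= e) ->
  exists l : L2 R d, s n @[n --> \oo] --> l.
Proof.
move=> cs; pose q k : R := (2^-1) ^+ k; have q0 k : 0 < q k by rewrite exprn_gt0.
have qsmall eps : 0 < eps -> exists k, q k <= eps.
  move=> eps0; have c : q k @[k --> \oo] --> (0 : R).
    by apply: cvg_expr; rewrite ger0_norm ?invr_ge0// invf_lt1// ltr1n.
  have /cvgrPdist_le /(_ eps eps0) [k _ /(_ k (leqnn k))] := c.
  by rewrite /= sub0r normrN ger0_norm ?(ltW (q0 k))//; exists k.
have /choice[N hN] := fun k => cs _ (q0 k).
(* The maximum puts n_ k beyond N j for every j <= k, so that all later terms of the subsequence
   stay within q j of the j-th. *)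
pose n_ k := \max_(j < k.+1) N j.
have Nn j k : (j <= k)%N -> (N j <= n_ k)%N.
  by rewrite -ltnS => jk; apply: (@leq_bigmax _ (fun j : 'I_k.+1 => N j) (Ordinal jk)).
pose r k : T -> R := s (n_ k).
have rd j k : (j <= k)%N -> `|s (n_ k) - s (n_ j)| <= q j.
  by move=> jk; apply: hN; exact: Nn.
pose D k x := `|r k.+1 x - r k x|.
have D0 k x : 0 <= D k x by exact: normr_ge0.
have mr k : measurable_fun setT (r k) by exact: L2_measurable.
have mD k : measurable_fun setT (D k).
  by apply: (@measurableT_comp _ _ _ _ _ _ (@Num.norm R R)) => //; exact: measurable_funB.
have ID k : (\int[mu]_x (D k x)%:E <= (q k / 2 * (volume R d + 1))%:E)%E.
  have ae : {ae mu, forall x, (s (n_ k.+1) - s (n_ k)) x = r k.+1 x - r k x} by exact: L2_subE.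
  have [i2 E2] := L2_norm_ae ae (measurable_funB (mr k.+1) (mr k)).
  have [i1 le1] := sqr_integrable_norm (q0 k) (measurable_funB (mr k.+1) (mr k)) i2
    (eq_ind_r (fun z => z <= _) (lerXn2r 2 (normr_ge0 _) (ltW (q0 k)) (rd k k.+1 (leqnSn k))) E2).
  move: le1; rewrite -lee_fin; apply: le_trans; rewrite /Rintegral fineK//.
  exact: (integrable_fin_num measurableT (integrable_norm i1)).
pose G x := (\sum_(0 <= k <oo) (D k x)%:E)%E.
have mG : measurable_fun setT G.
  apply: (@ge0_emeasurable_sum _ _ _ _ (fun k x => (D k x)%:E) xpredT) => [k x _ _|k _].
    by rewrite lee_fin D0.
  exact/measurable_EFinP.
have IG : (\int[mu]_x G x < +oo)%E.
  rewrite integral_nneseries// => [|k|k x _]; [|exact/measurable_EFinP|by rewrite lee_fin D0].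
  apply: (@le_lt_trans _ _ (volume R d + 1)%:E); last exact: ltry.
  apply: lime_le; first by apply: is_cvg_nneseries => k _ _; apply: integral_ge0 => x _; rewrite lee_fin D0.
  apply: nearW => n; apply: le_trans (_ : \sum_(0 <= k < n) (q k / 2 * (volume R d + 1))%:E <= _)%E.
    by apply: lee_sum => k _; exact: ID.
  rewrite sumEFin lee_fin -mulr_suml ler_piMl ?addr_ge0 ?ltW ?volume_gt0//.
  rewrite -mulr_suml.
  have -> : \sum_(0 <= i < n) q i = 2 * (1 - q n).
    elim: n => [|n IH]; first by rewrite big_geq// /q expr0 subrr mulr0.
    by rewrite big_nat_recr//= IH /q exprS; lra.
  by have := q0 n; lra.
pose A := [set x | (G x < +oo)%E].
have mA : measurable A.
  have -> : A = ~` (G @^-1` [set +oo%E]).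
    by apply/seteqP; split => x; rewrite /A/= ltey => /eqP.
  by apply: measurableC; rewrite -[X in measurable X]setTI; apply: mG => //; exact: emeasurable_set1.
have aeA : {ae mu, forall x, A x}.
  have iG : mu.-integrable setT G.
    have G0 x : (0 <= G x)%E by apply: nneseries_ge0 => k _ _; rewrite lee_fin D0.
    apply/integrableP; split => //; under eq_integral do rewrite (gee0_abs (G0 _)).
    exact: IG.
  by have := integrable_ae measurableT iG; apply: filterS => x /(_ I); rewrite fin_numE /A/= ltey => /andP[].
(* Cutting off to the set A of full measure changes no class and makes the limit exist at every
   point, hence measurable. *)
pose t k x := \1_A x * r k x.
have mt k : measurable_fun setT (t k) by apply: measurable_funM => //; exact: measurable_indic.
have ct x : cvgn (fun k => t k x).
  rewrite /t indicE; case: (boolP (x \in A)) => [|_]; last first.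
    by under eq_fun do rewrite mul0r; exact: is_cvg_cst.
  rewrite inE => Ax; under eq_fun do rewrite mul1r.
  have cD : cvgn (series (fun k => D k x)).
    apply: nnseries_is_cvg => [k|]; first exact: normr_ge0.
    exact: Ax.
  have cT : cvgn (series (telescope (fun k => r k x))) by exact: normed_cvg.
  have -> : (fun k => r k x) = (fun k => r 0%N x + series (telescope (fun k => r k x)) k).
    by apply/funext => k; rewrite -eq_sum_telescope.
  by apply: is_cvgD => //; exact: is_cvg_cst.
pose l (x : T) : R := limn ((fun k => t k x) : nat -> R).
have cl x : t k x @[k --> \oo] --> l x by exact: ct.
have ml : measurable_fun setT l by apply: (measurable_fun_cvg mt) => x _; exact: cl.
have tr k : {ae mu, forall x, t k x = s (n_ k) x}.
  by apply: filterS aeA => x Ax; rewrite /t indicE mem_set// mul1r.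
(* Fatou in j for t (j + k), with k fixed. *)
have key k : mu.-integrable setT (EFin \o (fun x => (l x - t k x) ^+ 2)) /\
    \int[mu]_x (l x - t k x) ^+ 2 <= q k ^+ 2.
  have sq j : mu.-integrable setT (EFin \o (fun x => (t (j + k)%N x - t k x) ^+ 2)) /\
      \int[mu]_x (t (j + k)%N x - t k x) ^+ 2 = `|s (n_ (j + k)%N) - s (n_ k)| ^+ 2.
    apply: L2_norm_ae; last exact: measurable_funB.
    have := L2_subE (s (n_ (j + k)%N)) (s (n_ k)).
    by apply: filterS3 (tr (j + k)%N) (tr k) => x -> -> ->.
  apply: (@Rfatou _ _ _ mu (fun j x => (t (j + k)%N x - t k x) ^+ 2)).
  - by move=> j; have [] := sq j.
  - by move=> j x; exact: sqr_ge0.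
  - move=> x; apply: cvgM; (apply: cvgB; last exact: cvg_cst).
      by have := cl x; rewrite -(cvg_shiftn k).
    by have := cl x; rewrite -(cvg_shiftn k).
  - move=> j; have [_ ->] := sq j; rewrite lerXn2r ?nnegrE ?(ltW (q0 k))//.
    by apply: rd; rewrite leq_addl.
have ilt k : mu.-integrable setT (EFin \o (fun x => l x - t k x)) /\
    \int[mu]_x `|l x - t k x| <= q k / 2 * (volume R d + 1).
  by have [i1 i2] := key k; apply: sqr_integrable_norm => //; exact: measurable_funB.
have it k : mu.-integrable setT (EFin \o t k) /\ \int[mu]_x t k x = 0.
  have ii := L2_integrable (s (n_ k)); split; last first.
    rewrite -(L2_mean0 (s (n_ k))); apply: Rintegral_ae_eq => //; exact: L2_measurable.
  apply: (@le_Rintegrable _ _ _ _ _ (fun x => `|r k x|)) => //; first exact: integrable_norm.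
  by move=> x; rewrite /t indicE normrM; case: (x \in A); rewrite ?normr1 ?mul1r// normr0 mul0r.
have il : mu.-integrable setT (EFin \o l).
  by have := RintegrableD (ilt 0%N).1 (it 0%N).1; congr (_.-integrable _ (EFin \o _));
    apply/funext => x; rewrite subrK.
have l0 : \int[mu]_x l x = 0.
  apply/eqP; rewrite -normr_le0; apply/ler_addgt0Pr => eps eps0; rewrite add0r.
  have vol1 : 0 < volume R d + 1 by rewrite ltr_wpDl// ltW// volume_gt0.
  have [k hk] : exists k, q k / 2 * (volume R d + 1) <= eps.
    have [|k hk] := qsmall (eps / (volume R d + 1)); first by rewrite divr_gt0.
    exists k; rewrite -ler_pdivlMr//; apply: le_trans hk.
    by have := q0 k; lra.
  apply: le_trans hk; have [i1 h1] := ilt k; have [i2 h2] := it k.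
  rewrite -[X in `|X|]subr0 -h2 -RintegralB//.
  by apply: le_trans h1; apply: le_normr_Rintegral.
have il2 : mu.-integrable setT (EFin \o (fun x => l x ^+ 2)).
  have [i1 _] := key 0%N; have [|i2 _] := @L2_norm_ae (s (n_ 0%N)) (t 0%N) _ (mt 0%N).
    by apply: filterS (tr 0%N) => x ->.
  have := RintegrableD (RintegrableZ 2 i1) (RintegrableZ 2 i2).
  move=> ii; apply: (@le_Rintegrable _ _ _ mu (fun x => l x ^+ 2) _ _ ii); first exact: measurable_funX.
  move=> x; rewrite ger0_norm ?sqr_ge0//.
  have := sqr_ge0 (l x - t 0%N x - t 0%N x); lra.
have Ll := is_L2_sqr ml il2 l0; pose f : L2 R d := L2_of l.
have fs k : `|f - s (n_ k)| <= q k.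
  rewrite -ler_sqr ?nnegrE ?(ltW (q0 k))//; have [_ h] := key k; apply: le_trans h.
  have [||_ <-//] := @L2_norm_ae (f - s (n_ k)) (fun x => l x - t k x).
    have := L2_subE f (s (n_ k)); have := L2_ofE Ll.
    by apply: filterS3 (tr k) => x -> -> ->.
  exact: measurable_funB.
exists f; apply/cvgrPdist_le => eps eps0.
have [|k qk] := qsmall (eps / 2); first by rewrite divr_gt0.
exists (N k) => // n /= Nkn; rewrite -[f - _](subrKA (s (n_ k))).
apply: le_trans (ler_normD _ _) _; have := fs k.
by have := hN k (n_ k) n (Nn k k (leqnn k)) Nkn; lra.
Qed.

Lemma L2_ae_eq0 f : (forall A, measurable A -> \int[mu]_x (f x * \1_A x) = 0) -> f = 0.
Proof.
move=> f0; apply: L2_ae_inj.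
have : ae_eq mu setT (EFin \o f) (cst 0%E).
  apply: integral_ae_eq => //; first exact: L2_integrable.
  move=> E _ mE; rewrite integral0 integral_mkcond.
  have ii : mu.-integrable setT (EFin \o (fun x => f x * \1_E x)).
    apply: (@RintegrableM_bounded _ _ _ _ _ _ 1); first exact: L2_integrable.
      exact: measurable_indic.
    by move=> x; rewrite indicE; case: (x \in E); rewrite ?normr1 ?normr0.
  transitivity (\int[mu]_x (f x * \1_E x))%:E; last by rewrite f0.
  rewrite /Rintegral fineK; last exact: (integrable_fin_num measurableT ii).
  by apply: eq_integral => x _; rewrite patchE indicE; case: ifP; rewrite /= ?mulr1 ?mulr0.
by apply: filterS2 (L2_zeroE R d) => x x0 /(_ I) [] ->.
Qed.

(** As f is integrable, vanishing of the pairing with f passes to bounded limits by dominated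
    convergence, so [trig_monotone_class] reaches all indicators. *)
Lemma L2_trig_eq0 f : (forall h, trigpoly h -> \int[mu]_x (f x * h x) = 0) -> f = 0.
Proof.
move=> fh; apply: L2_ae_eq0 => A mA.
have mf : measurable_fun setT f by exact: L2_measurable.
pose P (h : T -> R) := mu.-integrable setT (EFin \o (fun x => f x * h x)) /\ \int[mu]_x (f x * h x) = 0.
suff : P \1_A by case.
apply: (trig_monotone_class (P := P)) => //.
- move=> h th; split; last exact: fh.
  have [M hM] := trigpoly_bounded th.
  by apply: (@RintegrableM_bounded _ _ _ _ _ _ M) => //; [exact: L2_integrable|exact: measurable_trigpoly].
- move=> g h [ig g0] [ih h0].
  have E : (fun x => f x * (g x - h x)) = (fun x => f x * g x - f x * h x).
    by apply/funext => x; rewrite mulrBr.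
  by rewrite /P E; split; [exact: RintegrableB|rewrite RintegralB// g0 h0 subr0].
move=> f_ g M Pf mf_ mg fM cfg.
have [|||||i1 c1] := @Rintegral_dominated _ _ _ mu (fun n x => f x * f_ n x) (fun x => f x * g x) (fun x => `|f x| * M).
- by move=> n; exact: measurable_funM.
- exact: measurable_funM.
- by apply: filterS (cell_ae R d) => x cx; apply: cvgM; [exact: cvg_cst|exact: cfg].
- have := RintegrableZ M (integrable_norm (L2_integrable f)).
  by congr (_.-integrable _ _); apply/funext => x /=; rewrite mulrC.
- by apply: aeW => x n; rewrite normrM ler_wpM2l.
split => //; have c2 : \int[mu]_x (f x * f_ n x) @[n --> \oo] --> (0 : R).
  by apply: cvg_near_cst; apply: nearW => n; have [] := Pf n.
exact: cvg_unique c1 c2.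
Qed.

End L2_inner.

(** * The real Fourier basis *)

Section fourier_basis.
Variables (R : realType) (d : nat).
Notation mu := (torus R d).
Notation T := 'rV[R]_d.
Implicit Types (k l : 'rV[int]_d) (f : L2 R d).

(* One of k and - k for each k != 0. *)
Definition positive k := (pickle k < pickle (- k))%N.

Lemma positive0 : ~~ positive 0.
Proof. by rewrite /positive oppr0 ltnn. Qed.

Lemma positiveN k : k != 0 -> ~~ positive k -> positive (- k).
Proof.
rewrite /positive opprK -leqNgt leq_eqVlt => k0 /orP[/eqP h|//].
have : k = - k by apply: (pcan_inj (@pickleK _)).
move=> kk; case/negP: k0; apply/eqP/rowP => j; rewrite mxE.
have := congr1 (fun m : 'rV_d => m 0 j) kk; rewrite !mxE => /eqP.
by rewrite -addr_eq0 -mulr2n mulrn_eq0 => /eqP.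
Qed.

Lemma positiveD k l : positive k -> positive l -> k + l != 0.
Proof.
move=> pk pl; apply/negP; rewrite addr_eq0 => /eqP kl; move: pk pl.
by rewrite kl /positive opprK => h1 h2; have := ltn_trans h1 h2; rewrite ltnn.
Qed.

(** [true] selects the sine, as cos (theta - pi / 2) = sin theta; cosines and sines thus share one
    formula. *)
Definition phase (b : bool) : R := if b then pi / 2 else 0.

Definition wave (p : 'rV[int]_d * bool) (x : T) : R := cos (dotZ p.1 x - phase p.2).

Lemma trigpoly_wave p : trigpoly (wave p).
Proof. exact: trigpoly_cos. Qed.

Lemma trigpoly_is_L2 (h : T -> R) : trigpoly h -> \int[mu]_x h x = 0 -> is_L2 h.
Proof.
move=> th h0; apply: is_L2_sqr => //; first exact: measurable_trigpoly.
by apply: trigpoly_integrable; exact: trigpolyX.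
Qed.

Lemma wave_is_L2 p : p.1 != 0 -> is_L2 (wave p).
Proof. by move=> p0; apply: trigpoly_is_L2; [exact: trigpoly_wave|exact: Rintegral_cos]. Qed.

(* The codes of the pairs (k, b) with k positive leave gaps, where the basis
   below is 0; [indexed_nz] marks the other indices. *)
Definition indexed n : option ('rV[int]_d * bool) :=
  if @unpickle ('rV[int]_d * bool)%type n is Some p then
    if (positive p.1) && (pickle p == n) then Some p else None
  else None.

(** The square of a wave has mean 1/2, whence the normalising factor. *)
Definition basis n : L2 R d :=
  if indexed n is Some p then Num.sqrt (2 / volume R d) *: L2_of (wave p) else 0.

Definition indexed_nz n : bool := indexed n.

Lemma indexedP n p : indexed n = Some p -> positive p.1 /\ pickle p = n.
Proof.
rewrite /indexed; case: unpickle => // q; case: ifP => // /andP[qp /eqP qn] [<-].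
by [].
Qed.

Lemma indexed_pickle p : positive p.1 -> indexed (pickle p) = Some p.
Proof. by move=> pp; rewrite /indexed pickleK pp eqxx. Qed.

Lemma positive_neq0 k : positive k -> k != 0.
Proof. by apply: contraTneq => ->; exact: positive0. Qed.

Lemma ip_wave f p : p.1 != 0 -> ip f (L2_of (wave p)) = \int[mu]_x (f x * wave p x).
Proof.
move=> p0; apply: Rintegral_ae_eq.
- by apply: measurable_L2M; exact: L2_measurable.
- by apply: measurable_L2M; apply: measurable_trigpoly; exact: trigpoly_wave.
- by have := L2_ofE (wave_is_L2 p0); apply: filterS => x ->.
Qed.

Lemma Rintegral_wave2 p q : positive p.1 -> positive q.1 ->
  \int[mu]_x (wave p x * wave q x) = (p == q)%:R * (volume R d / 2).
Proof.
move=> pp pq.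
have E : (fun x => wave p x * wave q x) =
    (fun x => 2^-1 * cos (dotZ (p.1 - q.1) x + (phase q.2 - phase p.2)) +
              2^-1 * cos (dotZ (p.1 + q.1) x + (- phase p.2 - phase q.2))).
  apply/funext => x; rewrite /wave dotZDl dotZNl dotZDl.
  have -> : dotZ p.1 x - dotZ q.1 x + (phase q.2 - phase p.2) =
     (dotZ p.1 x - phase p.2) - (dotZ q.1 x - phase q.2) by ring.
  have -> : dotZ p.1 x + dotZ q.1 x + (- phase p.2 - phase q.2) =
     (dotZ p.1 x - phase p.2) + (dotZ q.1 x - phase q.2) by ring.
  by move: (_ - _) (_ - _) => a b; rewrite cosB cosD; lra.
have it k a : mu.-integrable setT (EFin \o (fun x => 2^-1 * cos (dotZ k x + a))).
  by apply: trigpoly_integrable; apply: trigpolyZ; exact: trigpoly_cos.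
have it' k a : mu.-integrable setT (EFin \o (fun x => cos (dotZ k x + a))).
  by apply: trigpoly_integrable; exact: trigpoly_cos.
rewrite E RintegralD// !RintegralZl// (Rintegral_cos _ (positiveD pp pq)) mulr0 addr0.
have [pq1|pq1] := eqVneq p.1 q.1; last first.
  rewrite Rintegral_cos ?subr_eq0// mulr0.
  by have /negbTE -> : p != q; [apply: contraNneq pq1 => ->|rewrite mul0r].
rewrite pq1 subrr; under eq_Rintegral do rewrite dotZ0 add0r.
rewrite (Rintegral_cst_torus d).
case: p q pp pq pq1 E => [k b] [l c] /= _ _ <- _; rewrite xpair_eqE eqxx/=.
by case: b; case: c; rewrite /phase /= ?subrr ?sub0r ?subr0 ?cosN ?cos0 ?cos_pihalf; lra.
Qed.

Lemma basis_orth m n : ip (basis m) (basis n) = ((m == n) && indexed_nz n)%:R.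
Proof.
rewrite /basis /indexed_nz; case Em : (indexed m) => [p|]; last first.
  rewrite (ip0l (ip := @ip R d) (@ipZf R d)); case: eqP => [<-|//]; by rewrite Em.
case En : (indexed n) => [q|]; last first.
  by rewrite andbF ip_sym (ip0l (ip := @ip R d) (@ipZf R d)).
have [pp pm] := indexedP Em; have [pq qn] := indexedP En.
rewrite ipZf ip_sym ipZf ip_wave ?positive_neq0//.
have -> : \int[mu]_x (L2_of (wave q) x * wave p x) = \int[mu]_x (wave q x * wave p x).
  apply: Rintegral_ae_eq.
  - by apply: measurable_L2M; apply: measurable_trigpoly; exact: trigpoly_wave.
  - by apply: measurable_trigpoly; apply: trigpolyM; exact: trigpoly_wave.
  - by have := L2_ofE (wave_is_L2 (positive_neq0 pq)); apply: filterS => x ->.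
rewrite Rintegral_wave2// andbT mulrA -expr2 sqr_sqrtr; last first.
  by rewrite divr_ge0// ltW// volume_gt0.
have -> : (q == p) = (m == n).
  by rewrite -pm -qn; apply/eqP/eqP => [->//|/(pcan_inj (@pickleK _))->].
by field; rewrite gt_eqF ?volume_gt0.
Qed.

(** The basis has only positive frequencies and two phases. Other phases follow from the addition
    formula, opposite frequencies from parity, and the frequency 0 from the mean-zero condition. *)
Lemma basis_total f : (forall n, ip f (basis n) = 0) -> f = 0.
Proof.
move=> fe; have fw p : positive p.1 -> \int[mu]_x (f x * wave p x) = 0.
  move=> pp; have := fe (pickle p); rewrite /basis indexed_pickle// ip_sym ipZf ip_sym.
  rewrite ip_wave ?positive_neq0// => /eqP; rewrite mulf_eq0 gt_eqF/= => [/eqP//|].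
  by rewrite sqrtr_gt0 divr_gt0// volume_gt0.
have intf (h : T -> R) : trigpoly h -> mu.-integrable setT (EFin \o (fun x => f x * h x)).
  move=> th; have [M hM] := trigpoly_bounded th.
  by apply: (@RintegrableM_bounded _ _ _ _ _ _ M) => //; [exact: L2_integrable|exact: measurable_trigpoly].
have fc k a : positive k -> \int[mu]_x (f x * cos (dotZ k x + a)) = 0.
  move=> pk; have E : (fun x => f x * cos (dotZ k x + a)) =
      (fun x => cos a * (f x * wave (k, false) x) - sin a * (f x * wave (k, true) x)).
    apply/funext => x; rewrite /wave /phase/= subr0 cosBpihalf cosD; ring.
  have i1 : mu.-integrable setT (EFin \o (fun x => cos a * (f x * wave (k, false) x))).
    by apply: RintegrableZ; apply: intf; exact: trigpoly_wave.
  have i2 : mu.-integrable setT (EFin \o (fun x => sin a * (f x * wave (k, true) x))).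
    by apply: RintegrableZ; apply: intf; exact: trigpoly_wave.
  rewrite E RintegralB// !RintegralZl ?fw ?mulr0 ?subr0//; apply: intf; exact: trigpoly_wave.
apply: L2_trig_eq0 => h th; elim: th => {h}[k a|g h tg IHg th IHh|c h th IHh].
- have [->|k0] := eqVneq k 0.
    under eq_Rintegral do rewrite dotZ0 add0r mulrC.
    by rewrite RintegralZl ?L2_mean0 ?mulr0//; exact: L2_integrable.
  case: (boolP (positive k)) => [|/(positiveN k0) pk]; first exact: fc.
  have := fc _ (- a) pk; under eq_Rintegral do rewrite dotZNl -opprD cosN.
  by [].
- under eq_Rintegral do rewrite mulrDr.
  by rewrite RintegralD ?IHg ?IHh ?addr0//; exact: intf.
- under eq_Rintegral do rewrite mulrCA.
  by rewrite RintegralZl ?IHh ?mulr0//; exact: intf.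
Qed.

End fourier_basis.

(** * Sobolev functions and the operator u . grad *)

Section C1_functions.
Variables (R : realType) (d : nat).
Notation T := 'rV[R]_d.
Notation mu := (torus R d).
Implicit Types (psi : T -> R) (x y : T).

Lemma is_derive_line psi (x v : T) (t : R) : derivable psi (x + t *: v) v ->
  is_derive t 1 (fun s : R => psi (x + s *: v)) ('D_v psi (x + t *: v)).
Proof.
move=> dpsi.
have E : (fun h : R => h^-1 *: (((fun s : R => psi (x + s *: v)) \o shift t) (h *: (1 : R^o)) - psi (x + t *: v))) =
    (fun h : R => h^-1 *: ((psi \o shift (x + t *: v)) (h *: v) - psi (x + t *: v))).
  apply/funext => h /=; congr (_ *: (psi _ - _)).
  by rewrite [h *: 1]mulr1 scalerDl addrCA addrA addrAC addrC.
split; first by rewrite /derivable E.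
by rewrite /derive E.
Qed.

Lemma continuous_periodic_bounded psi : periodic2pi psi -> continuous psi ->
  exists2 M, 0 <= M & forall x, `|psi x| <= M.
Proof.
move=> pp cp.
have cK : compact [set x : T | forall j, `[0, pi *+ 2]%classic (x ord0 j)].
  by apply: (@rV_compact _ _ (fun=> `[0, pi *+ 2]%classic)) => j; exact: segment_compact.
have := continuous_compact (continuous_subspaceT cp) cK.
move=> /compact_bounded[N [_ N1]].
exists (`|N| + 1) => [|x]; first by rewrite addr_ge0.
rewrite -(periodic_torus_repr x pp); apply: (N1 (`|N| + 1)).
  by rewrite (le_lt_trans (ler_norm _))// ltrDl.
exists (torus_repr x) => // j /=; rewrite in_itv/=.
by have /andP[-> /ltW ->] := cell_torus_repr x j.
Qed.

Lemma pderiv_periodic psi j : periodic2pi psi -> periodic2pi (pderiv j psi).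
Proof.
move=> pp x i; set y := x + _; rewrite /pderiv /derive.
suff -> : (fun h : R => h^-1 *: ((psi \o shift y) (h *: delta_mx 0 j) - psi y)) =
    (fun h : R => h^-1 *: ((psi \o shift x) (h *: delta_mx 0 j) - psi x)) by [].
by apply/funext => h; rewrite /= /y addrA !pp.
Qed.

Lemma C1_pderiv_bounded psi : C1_periodic psi ->
  exists2 M, 0 <= M & forall j x, `|pderiv j psi x| <= M.
Proof.
move=> [pp dp].
have /choice[M hM] : forall j, exists M, 0 <= M /\ forall x, `|pderiv j psi x| <= M.
  move=> j; have [|M M0 hM] := continuous_periodic_bounded _ (dp j).2; last by exists M.
  exact: pderiv_periodic.
exists (\sum_j M j) => [|j x]; first by apply: sumr_ge0 => j _; have [] := hM j.
apply: le_trans ((hM j).2 x) _; rewrite (bigD1 j)//= lerDl sumr_ge0// => i _.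
by have [] := hM i.
Qed.

Lemma C1_line psi M j x (h : R) : C1_periodic psi -> (forall x, `|pderiv j psi x| <= M) ->
  `|psi (x + h *: delta_mx 0 j) - psi x| <= M * `|h|.
Proof.
move=> [_ dp] pM.
have := @mean_value_bound R (fun s => psi (x + s *: delta_mx 0 j))
  (fun s => pderiv j psi (x + s *: delta_mx 0 j)) 0 h M.
rewrite add0r scale0r addr0; apply => [t|t _]; last exact: pM.
by apply: is_derive_line; exact: (dp j).1.
Qed.

(** The path from y to x changes one coordinate at a time, as [C1_periodic] provides only partial
    derivatives. *)
Lemma C1_lipschitz psi : C1_periodic psi ->
  exists2 L, 0 <= L & forall x y, `|psi x - psi y| <= L * `|x - y|.
Proof.
move=> Cp; have [M M0 pM] := C1_pderiv_bounded Cp.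
exists (d%:R * M) => [|x y]; first by rewrite mulr_ge0.
have h (s : seq 'I_d) : `|psi (y + \sum_(j <- s) (x - y) 0 j *: delta_mx 0 j) - psi y| <=
    (size s)%:R * M * `|x - y|.
  elim: s => [|j s IH]; first by rewrite big_nil addr0 subrr normr0 !mul0r.
  rewrite big_cons addrCA addrC /= -natr1 mulrDl mul1r mulrDl.
  set z := y + _ in IH *; rewrite -[_ - psi y](subrKA (psi z)) [leRHS]addrC.
  apply: le_trans (ler_normD _ _) _; apply: lerD => //.
  apply: le_trans (C1_line z _ Cp (pM j)) _; rewrite ler_wpM2l//.
  exact: entry_le_norm.
have := h (index_enum 'I_d); rewrite /index_enum -enumT size_enum_ord enumT.
have -> : \sum_(j <- index_enum 'I_d) (x - y) 0 j *: delta_mx 0 j = x - y.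
  by rewrite -row_sum_delta.
by rewrite subrKC.
Qed.

Lemma C1_bounded psi : C1_periodic psi -> exists2 M, 0 <= M & forall x, `|psi x| <= M.
Proof.
move=> Cp; have [L L0 pL] := C1_lipschitz Cp.
by apply: lipschitz_periodic_bounded pL; case: Cp.
Qed.

Lemma C1_measurable psi : C1_periodic psi -> measurable_fun setT psi.
Proof. by move=> /C1_lipschitz[L _]; exact: lipschitz_measurable. Qed.

Lemma C1_pderiv_measurable psi j : C1_periodic psi -> measurable_fun setT (pderiv j psi).
Proof. by move=> [_ dp]; apply: continuous_measurable_rV; exact: (dp j).2. Qed.

Lemma C1_integrable psi : C1_periodic psi -> mu.-integrable setT (EFin \o psi).
Proof.
move=> Cp; have [M _ pM] := C1_bounded Cp.
by apply: (bounded_integrable M) => //; exact: C1_measurable.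
Qed.

Lemma pderivM psi psi' j x : C1_periodic psi -> C1_periodic psi' ->
  pderiv j (psi \* psi') x = psi x * pderiv j psi' x + psi' x * pderiv j psi x.
Proof. by move=> [_ dp] [_ dp']; apply: deriveM; [exact: (dp j).1|exact: (dp' j).1]. Qed.

Lemma C1_continuous psi : C1_periodic psi -> continuous psi.
Proof. by move=> /C1_lipschitz[L _]; exact: lipschitz_continuous_rV. Qed.

Lemma C1_periodicM psi psi' : C1_periodic psi -> C1_periodic psi' -> C1_periodic (psi \* psi').
Proof.
move=> Cp Cp'; have [pp dp] := Cp; have [pp' dp'] := Cp'; split.
  by move=> x j /=; rewrite pp pp'.
move=> j; split; first by move=> x; apply: derivableM; [exact: (dp j).1|exact: (dp' j).1].
have -> : pderiv j (psi \* psi') = (fun x => psi x * pderiv j psi' x + psi' x * pderiv j psi x).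
  by apply/funext => x; exact: pderivM.
have cM (f g : T -> R) : continuous f -> continuous g -> continuous (fun x => f x * g x).
  by move=> cf cg x; apply: (@cvgM R T (nbhs x)); [exact: cf|exact: cg].
have c1 := cM _ _ (C1_continuous Cp) (dp' j).2.
have c2 := cM _ _ (C1_continuous Cp') (dp j).2.
by move=> x; apply: (@cvgD R R T (nbhs x)); [exact: c1|exact: c2].
Qed.

(** Difference quotients integrate to 0 by translation invariance and are bounded by the sup of the
    derivative; dominated convergence passes to the limit. *)
Lemma Rintegral_pderiv psi j : C1_periodic psi -> \int[mu]_x pderiv j psi x = 0.
Proof.
move=> Cp; have [M M0 pM] := C1_pderiv_bounded Cp; have [pp dp] := Cp.
pose h n : R := n.+1%:R^-1; have h0 n : h n != 0 by rewrite invr_eq0 pnatr_eq0.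
have mp := C1_measurable Cp.
pose v : T := delta_mx 0 j.
pose q n x := (h n)^-1 * (psi (x + h n *: v) - psi x).
have mt n : measurable_fun setT (fun x => psi (x + h n *: v)).
  have [L L0 pL] := C1_lipschitz Cp; apply: (@lipschitz_measurable _ _ _ L) => x y.
  by apply: le_trans (pL _ _) _; rewrite opprD addrACA subrr addr0.
have mq n : measurable_fun setT (q n).
  by apply: measurable_funM => //; exact: measurable_funB.
have cq x : q n x @[n --> \oo] --> pderiv j psi x.
  have := (dp j).1 x; rewrite /derivable => cx.
  have := (cvgr_dnbhsP (fun h : R => h^-1 *: ((psi \o shift x) (h *: v) - psi x)) 0 (pderiv j psi x)).1 cx h.
  have -> : (fun n => (h n)^-1 *: ((psi \o shift x) (h n *: v) - psi x)) = q ^~ x.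
    by apply/funext => n; rewrite /q /= [h n *: v + x]addrC.
  by apply; split => //; exact: cvg_harmonic.
have qM n x : `|q n x| <= M.
  rewrite /q normrM normfV ler_pdivrMl ?normr_gt0// mulrC; exact: C1_line.
have [||||_ c1] := @Rintegral_dominated _ _ _ mu q (pderiv j psi) (fun=> M) mq.
- exact: C1_pderiv_measurable.
- exact: aeW.
- by apply: (bounded_integrable `|M|).
- by apply: aeW => x n; exact: qM.
have c2 : \int[mu]_x q n x @[n --> \oo] --> (0 : R).
  apply: cvg_near_cst; apply: nearW => n.
  have ip := C1_integrable Cp.
  have [B _ pB] := C1_bounded Cp.
  have it : mu.-integrable setT (EFin \o (fun x => psi (x + h n *: v))).
    by apply: (bounded_integrable B).
  have ib : mu.-integrable setT (EFin \o (fun x => psi (x + h n *: v) - psi x)).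
    exact: RintegrableB.
  by rewrite RintegralZl// RintegralB// Rintegral_translate// subrr mulr0.
exact: cvg_unique c1 c2.
Qed.

End C1_functions.

(** * Square-integrable functions and removal of their mean *)

Section mean_zero_part.
Variables (R : realType) (d : nat).
Notation T := 'rV[R]_d.
Notation mu := (torus R d).
Implicit Types (f g : L2 R d) (h : T -> R).

Definition sqr_integrable h :=
  measurable_fun setT h /\ mu.-integrable setT (EFin \o (fun x => h x ^+ 2)).

Lemma sqr_integrable_L2 f : sqr_integrable f.
Proof.
by split; [exact: L2_measurable|exact: Lfun2_integrable_sqr (L2_is_L2 f).1].
Qed.

Lemma bounded_sqr_integrable h (M : R) : measurable_fun setT h ->
  (forall x, `|h x| <= M) -> sqr_integrable h.
Proof.
move=> mh hM; split => //; apply: (bounded_integrable (M ^+ 2)); first exact: measurable_funX.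
move=> x; rewrite normrX lerXn2r// nnegrE//; exact: le_trans (normr_ge0 _) (hM x).
Qed.

Lemma sqr_integrableM h f (M : R) : measurable_fun setT h -> (forall x, `|h x| <= M) ->
  sqr_integrable (fun x => h x * f x).
Proof.
move=> mh hM; have [mf i2] := sqr_integrable_L2 f.
have mhf : measurable_fun setT (fun x => h x * f x) by exact: measurable_funM.
split => //; have ii := RintegrableZ (M ^+ 2) i2.
apply: (@le_Rintegrable _ _ _ mu _ _ _ ii); first exact: measurable_funX.
move=> x; rewrite ger0_norm ?sqr_ge0// exprMn ler_wpM2r ?sqr_ge0//.
rewrite -(ger0_norm (sqr_ge0 (h x))) normrX lerXn2r// nnegrE//.
exact: le_trans (normr_ge0 _) (hM x).
Qed.

Lemma sqr_integrable_integrable h : sqr_integrable h -> mu.-integrable setT (EFin \o h).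
Proof.
move=> [mh i2]; have i1 : mu.-integrable setT (EFin \o (fun=> 1)) by apply: (bounded_integrable 1) => // x; rewrite normr1.
apply: (@le_Rintegrable _ _ _ mu _ _ mh (RintegrableD i1 i2)) => x.
rewrite -(real_normK (num_real (h x))); have := sqr_ge0 (`|h x| - 1); have := normr_ge0 (h x); nra.
Qed.

Lemma sqr_integrable_mul h h' : sqr_integrable h -> sqr_integrable h' ->
  mu.-integrable setT (EFin \o (fun x => h x * h' x)).
Proof.
move=> [mh i2] [mh' i2'].
apply: (@le_Rintegrable _ _ _ mu _ _ (measurable_funM mh mh') (RintegrableD i2 i2')) => x.
rewrite normrM -(real_normK (num_real (h x))) -(real_normK (num_real (h' x))).
have := sqr_ge0 (`|h x| - `|h' x|); have := normr_ge0 (h x); have := normr_ge0 (h' x); nra.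
Qed.

Lemma sqr_integrableB_cst h c : sqr_integrable h -> sqr_integrable (fun x => h x - c).
Proof.
move=> sh; have [mh i2] := sh; split; first exact: measurable_funB.
have i1 := sqr_integrable_integrable sh.
have ic : mu.-integrable setT (EFin \o (fun=> c ^+ 2)) by apply: (bounded_integrable `|c ^+ 2|).
have := RintegrableD (RintegrableB i2 (RintegrableZ (2 * c) i1)) ic.
by congr (_.-integrable _ (EFin \o _)); apply/funext => x; ring.
Qed.

Lemma sqr_integrable_sum (I : Type) (s : seq I) (F : I -> T -> R) :
  (forall i, sqr_integrable (F i)) -> sqr_integrable (fun x => \sum_(i <- s) F i x).
Proof.
move=> sF; elim: s => [|i s IH].
  have -> : (fun x => \sum_(i <- [::]) F i x) = cst 0 by apply/funext => x; rewrite big_nil.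
  by apply: (@bounded_sqr_integrable _ 0) => // x; rewrite normr0.
have -> : (fun x => \sum_(i <- i :: s) F i x) = (fun x => F i x + \sum_(i <- s) F i x).
  by apply/funext => x; rewrite big_cons.
have [m1 i1] := sF i; have [m2 i2] := IH; split; first exact: measurable_funD.
apply: (@le_Rintegrable _ _ _ mu _ _ _ (RintegrableD (RintegrableZ 2 i1) (RintegrableZ 2 i2))).
  by apply: measurable_funX; exact: measurable_funD.
move=> x; rewrite ger0_norm ?sqr_ge0//; have := sqr_ge0 (F i x - \sum_(i <- s) F i x); lra.
Qed.

(** Products such as u_j f leave the space of mean-zero functions; this is the orthogonal projection
    back to it. Pairings with elements of [L2] do not notice it, which is [ip_mean0]. *)
Definition mean0 h : L2 R d := L2_of (fun x => h x - (\int[mu]_x h x) / volume R d).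

Lemma mean0E h : sqr_integrable h ->
  {ae mu, forall x, mean0 h x = h x - (\int[mu]_x h x) / volume R d}.
Proof.
move=> sh; apply: L2_ofE.
have [mh i2] := sqr_integrableB_cst ((\int[mu]_x h x) / volume R d) sh.
apply: is_L2_sqr => //; rewrite RintegralB//; last first.
- by apply: (bounded_integrable `|(\int[mu]_x h x) / volume R d|).
- exact: sqr_integrable_integrable.
by rewrite (Rintegral_cst_torus d) divfK ?subrr// gt_eqF// volume_gt0.
Qed.

Lemma ip_mean0 f h : sqr_integrable h -> ip f (mean0 h) = \int[mu]_x (f x * h x).
Proof.
move=> sh; set c := (\int[mu]_x h x) / volume R d.
have mf := L2_measurable f; have [mh _] := sh.
have i1 := sqr_integrable_mul (sqr_integrable_L2 f) sh.
have i2 := RintegrableZ c (L2_integrable f).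
transitivity (\int[mu]_x (f x * h x - c * f x)).
  apply: Rintegral_ae_eq.
  - by apply: measurable_funM => //; exact: L2_measurable.
  - by apply: measurable_funB; exact: measurable_funM.
  - by apply: filterS (mean0E sh) => x ->; rewrite mulrBr [c * _]mulrC.
rewrite RintegralB// RintegralZl ?L2_mean0 ?mulr0 ?subr0//; exact: L2_integrable.
Qed.

End mean_zero_part.

(** * Gradients as Fourier series *)

Section gradient.
Variables (R : realType) (d : nat).
Notation T := 'rV[R]_d.
Notation mu := (torus R d).
Implicit Types (f g h : L2 R d) (k : 'rV[int]_d).
Notation e := (@basis R d).

Lemma pderiv_wave (p : 'rV[int]_d * bool) j (x : T) : pderiv j (wave p) x =
  (if p.2 then 1 else -1) * (p.1 0 j)%:~R * wave (p.1, ~~ p.2) x.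
Proof.
case: p => k b; set ph := phase R b.
have D : is_derive x (delta_mx 0 j) (wave (k, b)) (- (k 0 j)%:~R * sin (dotZ k x - ph)).
  apply: (@is_derive_taylor _ _ _ _ _ _ ((k 0 j)%:~R ^+ 2)) => s.
  rewrite /wave dotZDr dotZZr dotZ_delta_mx /= -/ph real_normK ?num_real//.
  have -> : dotZ k x + s * (k 0 j)%:~R - ph = dotZ k x - ph + s * (k 0 j)%:~R by ring.
  have := cos_taylor1 (dotZ k x - ph) (s * (k 0 j)%:~R); rewrite exprMn [s ^+ 2 * _]mulrC.
  by congr (`|_| <= _); ring.
rewrite /pderiv (@derive_val _ _ _ _ _ _ _ D) /wave /ph {ph D}; case: b => /=; rewrite /phase.
  by rewrite sinBpihalf subr0; ring.
by rewrite subr0 cosBpihalf; ring.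
Qed.

(** A smooth representative of the class [basis n], needed for derivatives and for composition with
    the flow. *)
Definition basisf n (x : T) : R :=
  if indexed d n is Some p then Num.sqrt (2 / volume R d) * wave p x else 0.

(** Exchanges cosine and sine of the same frequency, as differentiation does. *)
Definition flip n := if indexed d n is Some p then pickle (p.1, ~~ p.2) else n.

Definition dcoef (j : 'I_d) n : R :=
  if indexed d n is Some p then (if p.2 then 1 else -1) * (p.1 0 j)%:~R else 0.

Definition weight n : R := if indexed d n is Some p then normZ R p.1 else 0.

Lemma trigpoly_basisf n : trigpoly (basisf n).
Proof.
rewrite /basisf; case: indexed => [p|]; last exact: trigpoly_cst.
by apply: trigpolyZ; exact: trigpoly_wave.
Qed.

Lemma basisfE n : {ae mu, forall x, e n x = basisf n x}.
Proof.
rewrite /basis /basisf; case En : (indexed d n) => [p|]; last exact: L2_zeroE.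
have [pp _] := indexedP En; have := L2_ofE (@wave_is_L2 R d p (positive_neq0 pp)).
have := L2_scaleE (Num.sqrt (2 / volume R d)) (L2_of (wave p)).
by apply: filterS2 => x -> ->.
Qed.

Lemma pderiv_basisf j n (x : T) : pderiv j (basisf n) x = dcoef j n * basisf (flip n) x.
Proof.
rewrite /dcoef /flip /basisf; case En : (indexed d n) => [p|]; last first.
  by rewrite mul0r /pderiv derive_cst.
have [pp _] := indexedP En; rewrite indexed_pickle//.
have [dw _] := trigpoly_gradient (@trigpoly_wave R d p).
have := @deriveZ _ _ _ (wave p) (Num.sqrt (2 / volume R d)) x (delta_mx 0 j) (dw j x).
rewrite /pderiv => h; apply: etrans h _; rewrite -/(pderiv j _ _) pderiv_wave /GRing.scale/=.
by rewrite mulrCA.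
Qed.

Lemma dcoef_le j n : `|dcoef j n| <= weight n.
Proof.
rewrite /dcoef /weight; case: indexed => [p|]; last by rewrite normr0.
have -> : `|(if p.2 then 1 else -1) * (p.1 0 j)%:~R| = `|(p.1 0 j)%:~R| :> R.
  by case: p.2; rewrite ?mul1r// mulN1r normrN.
rewrite -(@ler_sqr R) ?nnegrE ?sqrtr_ge0// sqr_sqrtr; last by apply: sumr_ge0 => i _; exact: sqr_ge0.
rewrite real_normK ?num_real// (bigD1 j)//= lerDl sumr_ge0// => i _; exact: sqr_ge0.
Qed.

(** The flipped basis has the same orthogonality relations and the same gaps, so Riesz-Fischer sums
    the series differentiated term by term. *)
Lemma flip_orth m n : ip (e (flip m)) (e (flip n)) = ((m == n) && indexed_nz d n)%:R.
Proof.
rewrite basis_orth /indexed_nz /flip.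
case Em : (indexed d m) => [p|]; case En : (indexed d n) => [q|]; rewrite /= ?Em ?En ?andbF//.
- have [pp pm] := indexedP Em; have [pq qn] := indexedP En.
  rewrite indexed_pickle// !andbT -pm -qn; congr (nat_of_bool _)%:R.
  apply/eqP/eqP => [/(pcan_inj (@pickleK _)) [h1 h2]|/(pcan_inj (@pickleK _)) ->//].
  congr pickle; case: p q h1 h2 {Em En pp pm pq qn} => [a b] [a' b'] /= -> /negb_inj -> //.
- have [pq qn] := indexedP En; rewrite indexed_pickle// andbT.
  case: eqP => [mE|_]; last by case: eqP => // mn; move: Em; rewrite mn En.
  by move: Em; rewrite mE indexed_pickle.
Qed.

Definition gradient_sum j (a : nat -> R) n : L2 R d :=
  expansion (e \o flip) (fun i => dcoef j i * a i) n.

(** Square summability of the coefficients of (- Delta)^(1/2) f, equivalent to [H1] by [H1P]. *)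
Definition sobolev f := exists M, forall n, \sum_(i < n) (weight i * ip f (e i)) ^+ 2 <= M.

Definition gradient f (G : 'I_d -> L2 R d) :=
  forall j, gradient_sum j (fun i => ip f (e i)) n @[n --> \oo] --> G j.

Lemma sobolev_gradient f : sobolev f -> exists G, gradient f G.
Proof.
move=> [M fM]; suff /choice[G hG] : forall j, exists g : L2 R d,
  gradient_sum j (fun i => ip f (e i)) n @[n --> \oo] --> g by exists G.
move=> j; pose a i := dcoef j i * ip f (e i).
have a0 i : ~~ indexed_nz d i -> a i = 0.
  by rewrite /indexed_nz /a /dcoef; case: indexed => // _; rewrite mul0r.
have aM n : \sum_(i < n) a i ^+ 2 <= M.
  apply: le_trans (fM n); apply: ler_sum => i _; rewrite !exprMn ler_wpM2r ?sqr_ge0//.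
  rewrite -(real_normK (num_real (dcoef j i))) lerXn2r// ?nnegrE//; last exact: dcoef_le.
  exact: le_trans (normr_ge0 _) (dcoef_le j i).
have [g [_ cg _]] := @riesz_fischer R (L2 R d) (@ip R d) (@ip_sym R d) (@ipDf R d) (@ipZf R d)
  (@ip_normE R d) (@L2_complete R d) (e \o flip) (indexed_nz d) flip_orth a M a0 aM.
by exists g.
Qed.

Lemma ip_gradient f G j y : gradient f G ->
  \sum_(i < n) ip f (e i) * (dcoef j i * ip (e (flip i)) y) @[n --> \oo] --> ip (G j) y.
Proof.
move=> /(_ j) cG.
have := @cvg_ip R (L2 R d) (@ip R d) (@ip_sym R d) (@ipDf R d) (@ipZf R d) (@ip_normE R d) _ _ y cG.
apply: cvg_trans; apply: near_eq_cvg; apply: nearW => n.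
rewrite (@ip_suml R (L2 R d) (@ip R d) (@ipDf R d) (@ipZf R d)); apply: eq_bigr => i _.
by rewrite ipZf mulrCA mulrA.
Qed.

Lemma ip_basis_sqr n (h : T -> R) : sqr_integrable h -> ip (e n) (mean0 h) = \int[mu]_x (basisf n x * h x).
Proof.
move=> sh; have [mh _] := sh; rewrite ip_mean0//; apply: Rintegral_ae_eq.
- by apply: measurable_funM => //; exact: L2_measurable.
- by apply: measurable_funM => //; apply: measurable_trigpoly; exact: trigpoly_basisf.
- by apply: filterS (basisfE n) => x ->.
Qed.

Lemma C1_sqr_integrable psi : C1_periodic psi -> @sqr_integrable R d psi.
Proof.
by move=> Cp; have [M _ pM] := C1_bounded Cp; exact: bounded_sqr_integrable (C1_measurable Cp) pM.
Qed.

Lemma C1_pderiv_sqr_integrable psi j : C1_periodic psi -> @sqr_integrable R d (pderiv j psi).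
Proof.
move=> Cp; have [M _ pM] := C1_pderiv_bounded Cp.
by apply: bounded_sqr_integrable (pM j); exact: C1_pderiv_measurable.
Qed.

Lemma ip_parseval f y : \sum_(i < n) ip f (e i) * ip y (e i) @[n --> \oo] --> ip f y.
Proof.
exact: (@parseval R (L2 R d) (@ip R d) (@ip_sym R d) (@ipDf R d) (@ipZf R d)
  (@ip_normE R d) (@L2_complete R d) e (indexed_nz d) (@basis_orth R d) (@basis_total R d)).
Qed.

(** Both sides of the weak identity are limits of series in the coefficients of f, which agree term
    by term: the derivative of [basisf i] times [psi] has integral 0. *)
Lemma gradient_is_partial f G j : gradient f G -> is_partial j f (G j).
Proof.
move=> fG psi Cp; have sp := C1_sqr_integrable Cp; have sd := C1_pderiv_sqr_integrable j Cp.
rewrite -!ip_mean0//.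
have c1 := @ip_parseval f (mean0 (pderiv j psi)).
have c2 := cvgN (@ip_gradient f G j (mean0 psi) fG).
suff E : (fun n => \sum_(i < n) ip f (e i) * ip (mean0 (pderiv j psi)) (e i)) =
    (fun n => - \sum_(i < n) ip f (e i) * (dcoef j i * ip (e (flip i)) (mean0 psi))).
  by rewrite E in c1; exact: cvg_unique c1 (c2 _).
apply/funext => n; rewrite -sumrN; apply: eq_bigr => i _; rewrite -mulrN; congr (_ * _).
rewrite ip_sym !ip_basis_sqr//.
have Cb := trigpoly_C1 (trigpoly_basisf i).
have := Rintegral_pderiv j (C1_periodicM Cb Cp).
have E : pderiv j (basisf i \* psi) =
    (fun x => basisf i x * pderiv j psi x + dcoef j i * (basisf (flip i) x * psi x)).
  by apply/funext => x; rewrite pderivM// pderiv_basisf; ring.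
have i1 := sqr_integrable_mul (C1_sqr_integrable Cb) sd.
have i2 := sqr_integrable_mul (C1_sqr_integrable (trigpoly_C1 (trigpoly_basisf (flip i)))) sp.
rewrite E RintegralD//; last exact: RintegrableZ.
by rewrite RintegralZl// => /eqP; rewrite addr_eq0 => /eqP.
Qed.

End gradient.

(** * Fourier characterisation of H^1 *)

Section sobolev_space.
Variables (R : realType) (d : nat).
Notation T := 'rV[R]_d.
Notation mu := (torus R d).
Implicit Types (f g h : L2 R d) (k : 'rV[int]_d).
Notation e := (@basis R d).

Lemma ip_basisE f n : ip f (e n) = if indexed d n is Some p then
  Num.sqrt (2 / volume R d) * \int[mu]_x (f x * wave p x) else 0.
Proof.
rewrite /basis; case En : (indexed d n) => [p|]; last first.
  by rewrite ip_sym (ip0l (ip := @ip R d) (@ipZf R d)).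
by rewrite ip_sym ipZf ip_sym ip_wave ?positive_neq0//; have [] := indexedP En.
Qed.

Lemma fourier_ip f g (c : R) p : positive p.1 ->
  (ip g (e (pickle p)) = c * ip f (e (pickle p))) <->
  (\int[mu]_x (g x * wave p x) = c * \int[mu]_x (f x * wave p x)).
Proof.
move=> pp; rewrite !ip_basisE indexed_pickle// mulrCA.
have s0 : Num.sqrt (2 / volume R d) != 0.
  by rewrite gt_eqF// sqrtr_gt0 divr_gt0// volume_gt0.
by split=> [/(mulfI s0)//|->].
Qed.

Lemma normZN k : normZ R (- k) = normZ R k.
Proof.
by congr Num.sqrt; apply: eq_bigr => j _; rewrite mxE mulrNz sqrrN.
Qed.

(** Real and imaginary parts of a Fourier coefficient are the pairings with the cosine and the sine.
    The basis knows one of k and - k; the other follows by parity, and the frequency 0 is trivial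
    for mean-zero functions. *)
Lemma sqrt_laplacianP f g : is_sqrt_laplacian f g <->
  forall n, ip g (e n) = weight R d n * ip f (e n).
Proof.
have vol0 : (pi *+ 2) ^+ d != 0 :> R.
  by rewrite expf_neq0// mulrn_eq0/= gt_eqF// pi_gt0.
have waveE (F : L2 R d) k : \int[mu]_x (F x * wave (k, false) x) = \int[mu]_x (F x * cos (dotZ k x)) /\
    \int[mu]_x (F x * wave (k, true) x) = \int[mu]_x (F x * sin (dotZ k x)).
  split; apply: eq_Rintegral => x _; rewrite /wave /phase/=; first by rewrite subr0.
  by rewrite cosBpihalf.
split=> [fg n|fg k].
  case En : (indexed d n) => [p|]; last by rewrite !ip_basisE En mulr0.
  have [pp <-] := indexedP En; rewrite /weight indexed_pickle//; apply/(fourier_ip _ _ _ pp).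
  have [] := fg p.1; rewrite /fourier/= !mul0r subr0 addr0.
  rewrite !mulrA => /(mulIf (invr_neq0 vol0)) h1.
  rewrite mulrN !mulNr => /oppr_inj/(mulIf (invr_neq0 vol0)) h2.
  case: p pp En h1 h2 => l [] pp En /= h1 h2; have [f1 f2] := waveE f l; have [g1 g2] := waveE g l.
    by rewrite f2 g2.
  by rewrite f1 g1.
have key l : positive l -> \int[mu]_x (g x * cos (dotZ l x)) = normZ R l * \int[mu]_x (f x * cos (dotZ l x)) /\
    \int[mu]_x (g x * sin (dotZ l x)) = normZ R l * \int[mu]_x (f x * sin (dotZ l x)).
  move=> pl; have [<- <-] := waveE f l; have [<- <-] := waveE g l.
  have h b := (fourier_ip f g (normZ R l) (p := (l, b)) pl).1.
  by split; apply: h; rewrite fg /weight indexed_pickle.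
have {}key : \int[mu]_x (g x * cos (dotZ k x)) = normZ R k * \int[mu]_x (f x * cos (dotZ k x)) /\
    \int[mu]_x (g x * sin (dotZ k x)) = normZ R k * \int[mu]_x (f x * sin (dotZ k x)).
  have [->|k0] := eqVneq k 0.
    have E (F : L2 R d) : \int[mu]_x (F x * cos (dotZ 0 x)) = 0 /\ \int[mu]_x (F x * sin (dotZ 0 x)) = 0.
      split; first by under eq_Rintegral do rewrite dotZ0 cos0 mulr1; exact: L2_mean0.
      by under eq_Rintegral do rewrite dotZ0 sin0 mulr0; rewrite (Rintegral_cst_torus d) mul0r.
    by have [-> ->] := E f; have [-> ->] := E g; rewrite mulr0.
  case: (boolP (positive k)) => [|/(positiveN k0) pk]; first exact: key.
  have [h1 h2] := key _ pk; rewrite normZN in h1 h2; split.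
    by move: h1; under eq_Rintegral do rewrite dotZNl cosN; under [in RHS]eq_Rintegral do rewrite dotZNl cosN.
  have E (F : L2 R d) : \int[mu]_x (F x * sin (dotZ (- k) x)) = - \int[mu]_x (F x * sin (dotZ k x)).
    under eq_Rintegral do rewrite dotZNl sinN mulrN -mulN1r.
    rewrite RintegralZl ?mulN1r//.
    apply: (@RintegrableM_bounded _ _ _ _ _ _ 1); first exact: L2_integrable.
      apply: (@measurableT_comp _ _ _ _ _ _ (@sin R)); last exact: measurable_dotZ.
      by apply: continuous_measurable_fun; exact: continuous_sin.
    by move=> x; rewrite ler_norml sin_geN1 sin_le1.
  by move: h2; rewrite !E mulrN => /oppr_inj.
have [h1 h2] := key; rewrite /fourier h1 h2; congr Complex => /=.
  by rewrite mul0r subr0 mulrA.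
by rewrite mul0r addr0 !mulNr mulrN mulrA.
Qed.

Lemma H1P f : @H1 R d f <-> sobolev f.
Proof.
have h := @basis_orth R d.
split=> [[g /sqrt_laplacianP fg]|[M fM]].
  exists (`|g| ^+ 2) => n.
  have := @bessel R (L2 R d) (@ip R d) (@ip_sym R d) (@ipDf R d) (@ipZf R d) (@ip_normE R d) e
    (indexed_nz d) h g n.
  by apply: le_trans; apply: ler_sum => i _; rewrite fg.
have a0 i : ~~ indexed_nz d i -> weight R d i * ip f (e i) = 0.
  by rewrite /indexed_nz /weight; case: indexed => // _; rewrite mul0r.
have [g [ge _ _]] := @riesz_fischer R (L2 R d) (@ip R d) (@ip_sym R d) (@ipDf R d) (@ipZf R d)
  (@ip_normE R d) (@L2_complete R d) e (indexed_nz d) h _ M a0 fM.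
by exists g; apply/sqrt_laplacianP.
Qed.

End sobolev_space.

(** * The antisymmetric operator u . grad *)

Section advection.
Variables (R : realType) (d : nat).
Notation T := 'rV[R]_d.
Notation mu := (torus R d).
Implicit Types (f g h : L2 R d).
Notation e := (@basis R d).
Variable u : T -> T.
Hypotheses (u_periodic : periodic2pi u) (u_lipschitz : lipschitz u)
  (u_divergence_free : divergence_free u).

Lemma field_sqr_integrableM j f : sqr_integrable (fun x => u x 0 j * f x).
Proof.
have [U U0 uU] := field_bounded u_periodic u_lipschitz.
apply: (@sqr_integrableM _ _ _ _ U); first exact: measurable_field u_lipschitz j.
by move=> x; apply: le_trans (entry_le_norm _ j) (uU x).
Qed.

Definition advection_basisf n (x : T) := \sum_j u x 0 j * pderiv j (basisf n) x.

Lemma advection_sqr_integrable n : sqr_integrable (advection_basisf n).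
Proof.
have [U U0 uU] := field_bounded u_periodic u_lipschitz.
apply: sqr_integrable_sum => j.
have Cb := trigpoly_C1 (@trigpoly_basisf R d n).
have [M M0 pM] := C1_pderiv_bounded Cb.
apply: (@bounded_sqr_integrable _ _ _ (U * M)) => [|x].
  by apply: measurable_funM; [exact: measurable_field u_lipschitz j|exact: C1_pderiv_measurable].
by rewrite normrM; apply: ler_pM => //; exact: le_trans (entry_le_norm _ j) (uU x).
Qed.

Definition advection_basis n : L2 R d := mean0 (advection_basisf n).

Lemma ip_advection_basis n y :
  ip (advection_basis n) y = \sum_j dcoef R j n * ip (e (flip d n)) (mean0 (fun x => u x 0 j * y x)).
Proof.
rewrite ip_sym ip_mean0; last exact: advection_sqr_integrable.
have sb i := C1_sqr_integrable (trigpoly_C1 (@trigpoly_basisf R d i)).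
have E : (fun x => y x * advection_basisf n x) =
    (fun x => \sum_j dcoef R j n * (basisf (flip d n) x * (u x 0 j * y x))).
  apply/funext => x; rewrite mulr_sumr; apply: eq_bigr => j _; rewrite pderiv_basisf; ring.
have ii j : mu.-integrable setT (EFin \o (fun x => basisf (flip d n) x * (u x 0 j * y x))).
  by apply: sqr_integrable_mul; [exact: sb|exact: field_sqr_integrableM].
rewrite E Rintegral_sum => [|j]; last exact: RintegrableZ.
apply: eq_bigr => j _; rewrite RintegralZl// ip_basis_sqr//; exact: field_sqr_integrableM.
Qed.

(** The divergence condition tested on the product of the two basis functions, expanded by the
    Leibniz rule. *)
Lemma advection_basis_antisym m n : ip (advection_basis m) (e n) = - ip (e m) (advection_basis n).
Proof.
have sb i := C1_sqr_integrable (trigpoly_C1 (@trigpoly_basisf R d i)).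
have Cm := trigpoly_C1 (@trigpoly_basisf R d m); have Cn := trigpoly_C1 (@trigpoly_basisf R d n).
rewrite ip_sym !ip_basis_sqr; try exact: advection_sqr_integrable.
have := u_divergence_free (C1_periodicM Cm Cn).
have -> : (fun x => \sum_j u x 0 j * pderiv j (basisf m \* basisf n) x) =
  (fun x => basisf n x * advection_basisf m x + basisf m x * advection_basisf n x).
  apply/funext => x; rewrite !mulr_sumr -big_split/=; apply: eq_bigr => j _.
  by rewrite pderivM//; ring.
rewrite RintegralD//; last 2 first.
- by apply: sqr_integrable_mul; [exact: sb|exact: advection_sqr_integrable].
- by apply: sqr_integrable_mul; [exact: sb|exact: advection_sqr_integrable].
by move=> /eqP; rewrite addr_eq0 => /eqP.
Qed.

(* [h] is the weak value of u . grad [f]; [h] is unique by totality. *)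
Definition weak_advection f h := forall n, ip h (e n) = - ip f (advection_basis n).

(** For the gradient of a function the mean removed here is 0, as shown in
    [weak_advection_is_advection]. *)
Definition advect (G : 'I_d -> L2 R d) : L2 R d := mean0 (fun x => \sum_j u x 0 j * G j x).

Lemma advect_sqr_integrable (G : 'I_d -> L2 R d) : sqr_integrable (fun x => \sum_j u x 0 j * G j x).
Proof. by apply: sqr_integrable_sum => j; exact: field_sqr_integrableM. Qed.

Lemma cvg_sum_ord m (s : 'I_m -> nat -> R) (l : 'I_m -> R) :
  (forall j, s j n @[n --> \oo] --> l j) -> \sum_j s j n @[n --> \oo] --> \sum_j l j.
Proof.
move=> sl; elim: (index_enum _) => [|j r IH].
  under eq_fun do rewrite big_nil; rewrite big_nil; exact: cvg_cst.
under eq_fun do rewrite big_cons; rewrite big_cons; exact: cvgD.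
Qed.

Lemma cvg_advect f G y : gradient f G ->
  \sum_(i < n) ip f (e i) * ip (advection_basis i) y @[n --> \oo] --> ip (advect G) y.
Proof.
move=> fG.
have -> : ip (advect G) y = \sum_j ip (G j) (mean0 (fun x => u x 0 j * y x)).
  rewrite ip_sym ip_mean0; last exact: advect_sqr_integrable.
  under eq_Rintegral do rewrite mulr_sumr.
  have ii j : mu.-integrable setT (EFin \o (fun x => y x * (u x 0 j * G j x))).
    by apply: sqr_integrable_mul; [exact: sqr_integrable_L2|exact: field_sqr_integrableM].
  rewrite Rintegral_sum//; apply: eq_bigr => j _; rewrite ip_mean0; last exact: field_sqr_integrableM.
  by apply: eq_Rintegral => x _; ring.
have := cvg_sum_ord (fun j => @ip_gradient R d f G j (mean0 (fun x => u x 0 j * y x)) fG).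
apply: cvg_trans; apply: near_eq_cvg; apply: nearW => n.
rewrite exchange_big; apply: eq_bigr => i _; rewrite ip_advection_basis mulr_sumr.
by apply: eq_bigr => j _.
Qed.

Lemma weak_advection_unique f h h' : weak_advection f h -> weak_advection f h' -> h = h'.
Proof.
move=> fh fh'; apply/eqP; rewrite -subr_eq0; apply/eqP; apply: basis_total => n.
by rewrite (ipBl (ip := @ip R d) (@ipDf R d) (@ipZf R d)) fh fh' subrr.
Qed.

Lemma gradient_weak_advection f G : gradient f G -> weak_advection f (advect G).
Proof.
move=> fG n; have c1 := @cvg_advect f G (e n) fG.
have c2 := @ip_parseval R d f (advection_basis n).
have c3 := cvgN c2.
suff E : (fun m => \sum_(i < m) ip f (e i) * ip (advection_basis i) (e n)) =
   - (fun m => \sum_(i < m) ip f (e i) * ip (advection_basis n) (e i)).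
  by rewrite E in c1; exact: cvg_unique c1 (c3 _).
apply/funext => m; rewrite [RHS](_ : _ = - \sum_(i < m) ip f (e i) * ip (advection_basis n) (e i))//.
rewrite -sumrN; apply: eq_bigr => i _.
rewrite -mulrN; congr (_ * _).
exact: etrans (advection_basis_antisym i n) (congr1 -%R (ip_sym _ _)).
Qed.

Lemma sobolev_weak_advection f : sobolev f -> exists h, weak_advection f h.
Proof. by move=> /sobolev_gradient[G fG]; exists (advect G); exact: gradient_weak_advection. Qed.

Lemma weak_advectionP f h y : sobolev f -> weak_advection f h ->
  \sum_(i < n) ip f (e i) * ip (advection_basis i) y @[n --> \oo] --> ip h y.
Proof.
move=> /sobolev_gradient[G fG] fh.
by rewrite (weak_advection_unique fh (gradient_weak_advection fG)); exact: cvg_advect.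
Qed.

(** Expand f in the basis: the series for <h, g> has terms <f, e i> <A e i, g>, and the definition
    of k turns <A e i, g> into - <k, e i>. *)
Lemma weak_advection_antisym f g h k : sobolev f -> weak_advection f h -> weak_advection g k ->
  ip h g = - ip f k.
Proof.
move=> sf fh gk; have c1 := @weak_advectionP f h g sf fh.
have c3 := cvgN (@ip_parseval R d f k).
suff E : (fun m => \sum_(i < m) ip f (e i) * ip (advection_basis i) g) =
   - (fun m => \sum_(i < m) ip f (e i) * ip k (e i)).
  by rewrite E in c1; exact: cvg_unique c1 (c3 _).
apply/funext => m; rewrite [RHS](_ : _ = - \sum_(i < m) ip f (e i) * ip k (e i))//.
by rewrite -sumrN; apply: eq_bigr => i _; rewrite gk mulrN opprK (ip_sym g).
Qed.

(** [h] is [advect G], so it remains to see that u . G itself has mean zero. Its mean is the limit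
    of combinations of the integrals of u . grad (basisf i), which vanish by the divergence
    condition. *)
Lemma weak_advection_is_advection f h : sobolev f -> weak_advection f h -> is_advection u f h.
Proof.
move=> /sobolev_gradient[G fG] fh; exists G => [j|]; first exact: gradient_is_partial.
rewrite (weak_advection_unique fh (gradient_weak_advection fG)).
suff E : \int[mu]_x (\sum_j u x 0 j * G j x) = 0.
  by have := mean0E (advect_sqr_integrable G); apply: filterS => x ->; rewrite E mul0r subr0.
have [U U0 uU] := field_bounded u_periodic u_lipschitz.
have su j : sqr_integrable (fun x => u x 0 j).
  apply: (@bounded_sqr_integrable _ _ _ U); first exact: measurable_field u_lipschitz j.
  by move=> x; apply: le_trans (entry_le_norm _ j) (uU x).
have -> : \int[mu]_x (\sum_j u x 0 j * G j x) = \sum_j ip (G j) (mean0 (fun x => u x 0 j)).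
  rewrite Rintegral_sum => [|j]; last exact: sqr_integrable_integrable (field_sqr_integrableM _ _).
  apply: eq_bigr => j _; rewrite ip_mean0//; by under eq_Rintegral do rewrite mulrC.
have := cvg_sum_ord (fun j => @ip_gradient R d f G j (mean0 (fun x => u x 0 j)) fG).
suff -> : (fun n => \sum_j \sum_(i < n) ip f (e i) *
    (dcoef R j i * ip (e (flip d i)) (mean0 (fun x => u x 0 j)))) = (fun=> 0).
  by move=> c; exact: cvg_unique c (cvg_cst _).
apply/funext => n; rewrite exchange_big big1// => i _; rewrite -mulr_sumr.
suff -> : \sum_j dcoef R j i * ip (e (flip d i)) (mean0 (fun x => u x 0 j)) = 0 by rewrite mulr0.
have Cb := trigpoly_C1 (@trigpoly_basisf R d i).
rewrite -[RHS](u_divergence_free Cb).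
have sb l := C1_sqr_integrable (trigpoly_C1 (@trigpoly_basisf R d l)).
have ii j : mu.-integrable setT (EFin \o (fun x => basisf (flip d i) x * u x 0 j)).
  by apply: sqr_integrable_mul.
have -> : (fun x => \sum_j u x 0 j * pderiv j (basisf i) x) =
    (fun x => \sum_j dcoef R j i * (basisf (flip d i) x * u x 0 j)).
  by apply/funext => x; apply: eq_bigr => j _; rewrite pderiv_basisf; ring.
rewrite Rintegral_sum => [|j]; last exact: RintegrableZ.
by apply: eq_bigr => j _; rewrite RintegralZl// ip_basis_sqr.
Qed.

End advection.

(** * The transport group *)

Section mean0_linear.
Variables (R : realType) (d : nat).
Notation T := 'rV[R]_d.
Notation mu := (torus R d).
Implicit Types (f g : L2 R d) (h : T -> R).

Lemma L2_ip_eq f g : (forall y, ip y f = ip y g) -> f = g.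
Proof.
move=> fg; apply/eqP; rewrite -subr_eq0; apply/eqP.
apply: (ip_eq0 (ip := @ip R d) (@ip_normE R d)).
by rewrite (ipBr (@ip_sym R d) (@ipDf R d) (@ipZf R d)) fg subrr.
Qed.

Lemma sqr_integrableZ c h : sqr_integrable h -> sqr_integrable (fun x => c * h x).
Proof.
move=> [mh ih]; split; first exact: measurable_funM.
have := RintegrableZ (c ^+ 2) ih; congr (_.-integrable _ (EFin \o _)).
by apply/funext => x; rewrite exprMn.
Qed.

Lemma sqr_integrableB h h' : sqr_integrable h -> sqr_integrable h' ->
  sqr_integrable (fun x => h x - h' x).
Proof.
move=> [m1 i1] [m2 i2]; split; first exact: measurable_funB.
apply: (@le_Rintegrable _ _ _ mu _ _ _ (RintegrableD (RintegrableZ 2 i1) (RintegrableZ 2 i2))).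
  by apply: measurable_funX; exact: measurable_funB.
move=> x; rewrite ger0_norm ?sqr_ge0//; have := sqr_ge0 (h x + h' x); lra.
Qed.

Lemma mean0Z c h : sqr_integrable h -> mean0 (fun x => c * h x) = c *: mean0 h.
Proof.
move=> sh; apply: L2_ip_eq => y; rewrite ip_mean0; last exact: sqr_integrableZ.
rewrite ip_sym ipZf ip_sym ip_mean0//.
rewrite -RintegralZl//; last by apply: sqr_integrable_mul => //; exact: sqr_integrable_L2.
by apply: eq_Rintegral => x _; rewrite mulrCA.
Qed.

Lemma mean0B h h' : sqr_integrable h -> sqr_integrable h' ->
  mean0 (fun x => h x - h' x) = mean0 h - mean0 h'.
Proof.
move=> sh sh'; apply: L2_ip_eq => y; rewrite ip_mean0; last exact: sqr_integrableB.
rewrite (ipBr (@ip_sym R d) (@ipDf R d) (@ipZf R d)) !ip_mean0//.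
rewrite -RintegralB//; try by apply: sqr_integrable_mul => //; exact: sqr_integrable_L2.
by apply: eq_Rintegral => x _; rewrite mulrBr.
Qed.

Lemma basis_mean0 n : basis R d n = mean0 (basisf n).
Proof.
have sb := C1_sqr_integrable (trigpoly_C1 (@trigpoly_basisf R d n)).
apply: L2_ip_eq => y; rewrite ip_mean0//; have [mb _] := sb; apply: Rintegral_ae_eq.
- by apply: measurable_funM; exact: L2_measurable.
- by apply: measurable_funM => //; exact: L2_measurable.
- by apply: filterS (basisfE R d n) => x ->.
Qed.

(** With m the class of h, |m|^2 is the integral of m h, at most c times the L^1 norm of m, which
    [sqr_integrable_norm] bounds linearly in |m|. *)
Lemma norm_mean0_le h (c : R) : measurable_fun setT h -> (forall x, `|h x| <= c) ->
  `|mean0 h| <= c * (volume R d + 1).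
Proof.
move=> mh hc; have c0 : 0 <= c := le_trans (normr_ge0 _) (hc 0).
have sh := bounded_sqr_integrable mh hc; set m := mean0 h.
have vol0 := volume_gt0 R d.
have [->|m0] := eqVneq m 0; first by rewrite normr0 mulr_ge0// addr_ge0// ltW.
have nm : 0 < `|m| by rewrite normr_gt0.
have [mm im] := sqr_integrable_L2 m.
have [i1 h1] := sqr_integrable_norm nm mm im (eq_ind_r (fun z => z <= _) (lexx _) (esym (L2_norm_sqr m))).
have in1 := integrable_norm i1.
have : `|m| ^+ 2 <= c * \int[mu]_x `|m x|.
  rewrite -ip_normE {2}/m ip_mean0// -RintegralZl//.
  apply: le_Rintegral => //.
  - by apply: sqr_integrable_mul => //; exact: sqr_integrable_L2.
  - exact: (RintegrableZ c in1).
  move=> x _; apply: le_trans (ler_norm _) _; rewrite normrM mulrC ler_wpM2r//.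
move=> h2; have := le_trans h2 (ler_wpM2l c0 h1).
have -> : c * (`|m| / 2 * (volume R d + 1)) = `|m| * (c * (volume R d + 1) / 2) by ring.
rewrite expr2 ler_pM2l// => h3; apply: le_trans h3 _.
by rewrite ler_pdivrMr// ler_peMr ?ler1n// mulr_ge0// addr_ge0// ltW.
Qed.

End mean0_linear.

Section transport_group.
Variables (R : realType) (d : nat).
Notation T := 'rV[R]_d.
Notation mu := (torus R d).
Implicit Types (f g h : L2 R d).
Notation e := (@basis R d).
Variable u : T -> T.
Hypotheses (u_periodic : periodic2pi u) (u_lipschitz : lipschitz u)
  (u_divergence_free : divergence_free u).
Variable Phi : R -> T -> T.
Hypothesis Phi_flow : is_flow u Phi.

Let F t x := torus_repr (Phi t x).

Let mpF t : measure_preserving (F t).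
Proof. exact: (measure_preserving_flow u_periodic u_lipschitz u_divergence_free Phi_flow t). Qed.

Lemma torus_repr_periodic : periodic2pi (@torus_repr R d).
Proof.
move=> x i; apply/rowP => j; rewrite !mxE eqxx/=.
have p0 : pi *+ 2 != 0 :> R by rewrite mulrn_eq0/= gt_eqF// pi_gt0.
case: eqP => [->|_]; last by rewrite mulr0 addr0.
rewrite mulr1 mulrDl divff// floorDrz ?rpred1// floor1 intrD mulrDl mul1r.
by rewrite opprD addrACA subrr addr0.
Qed.

Lemma flow_repr_add s t x : F s (F t x) = F (s + t) x.
Proof.
rewrite /F -(flow_add u_lipschitz Phi_flow) (periodic_torus_repr (f := fun y => torus_repr (Phi s y)))//.
move=> y j; rewrite (flow_periodic u_periodic u_lipschitz Phi_flow); exact: torus_repr_periodic.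
Qed.

Lemma flow_repr0 : {ae mu, forall x, F 0 x = x}.
Proof. by apply: filterS (cell_ae R d) => x cx; rewrite /F (flow0 Phi_flow) torus_repr_id. Qed.

Lemma sqr_integrable_flow t h : sqr_integrable (fun x => h (F t x)).
Proof.
have [mh ih] := sqr_integrable_L2 h; split.
  by apply: measurableT_comp => //; exact: (mpF t).1.
exact: (measure_preserving_integrable (mpF t) ih).
Qed.

Lemma transportE t f : {ae mu, forall x, transport Phi t f x = f (F (- t) x)}.
Proof.
apply: L2_ofE; have [m i] := sqr_integrable_flow (- t) f; apply: is_L2_sqr => //.
by rewrite (measure_preserving_Rintegral (mpF (- t)) (L2_integrable f)) L2_mean0.
Qed.

Lemma transport_norm t f : `|transport Phi t f| = `|f|.
Proof.
apply/eqP; rewrite -(@eqrXn2 _ 2)//; apply/eqP.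
have [m i] := sqr_integrable_flow (- t) f.
have [_ <-] := L2_norm_ae (transportE t f) m.
by rewrite L2_norm_sqr (measure_preserving_Rintegral (mpF (- t)) (sqr_integrable_L2 f).2).
Qed.

Lemma transportB t f g : transport Phi t (f - g) = transport Phi t f - transport Phi t g.
Proof.
apply: L2_ae_inj.
have h1 := measure_preserving_ae (mpF (- t)) (L2_subE f g).
have h2 : {ae mu, forall x, transport Phi t (f - g) x = f (F (- t) x) - g (F (- t) x)}.
  by apply: filterS2 (transportE t (f - g)) h1 => x -> ->.
have h3 : {ae mu, forall x, (transport Phi t f - transport Phi t g) x = f (F (- t) x) - g (F (- t) x)}.
  by apply: filterS3 (L2_subE (transport Phi t f) (transport Phi t g)) (transportE t f) (transportE t g) => x -> -> ->.
by apply: filterS2 h2 h3 => x -> ->.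
Qed.

Lemma transport_continuous t : continuous (transport Phi t).
Proof.
move=> f A /nbhs_ballP[eps /= eps0 epsA]; apply/nbhs_ballP; exists eps => //= g.
rewrite -ball_normE /= => fg; apply: epsA.
by rewrite -ball_normE /= -transportB transport_norm.
Qed.

Lemma transportK t f : transport Phi t (transport Phi (- t) f) = f.
Proof.
apply: L2_ae_inj.
have h1 := measure_preserving_ae (mpF (- t)) (transportE (- t) f).
apply: filterS3 (transportE t (transport Phi (- t) f)) h1 flow_repr0 => x -> -> x0.
by rewrite flow_repr_add addNr x0.
Qed.

Definition flowed_basisf n t (x : T) : R := basisf n (Phi t x).

Lemma flowed_basisf_bounded n : exists2 M, 0 <= M & forall t x, `|flowed_basisf n t x| <= M.
Proof.
have [M M0 hM] := C1_bounded (trigpoly_C1 (@trigpoly_basisf R d n)).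
by exists M => // t x; exact: hM.
Qed.

Lemma measurable_flowed_basisf n t : measurable_fun setT (flowed_basisf n t).
Proof.
apply: (@measurableT_comp _ _ _ _ _ _ (@basisf R d n) _ (Phi t)).
  by apply: measurable_trigpoly; exact: trigpoly_basisf.
exact: (measurable_flow u_lipschitz Phi_flow t).
Qed.

Lemma flowed_sqr_integrable n t : sqr_integrable (flowed_basisf n t).
Proof.
have [M M0 hM] := flowed_basisf_bounded n.
exact: bounded_sqr_integrable (measurable_flowed_basisf n t) (hM t).
Qed.

Definition flowed_basis n t : L2 R d := mean0 (flowed_basisf n t).

(** Measure preservation moves the flow from the class f, which need not be smooth, onto an explicit
    function that can be differentiated in time. *)
Lemma ip_transport_basis t f n : ip (transport Phi t f) (e n) = ip f (flowed_basis n t).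
Proof.
have sb := C1_sqr_integrable (trigpoly_C1 (@trigpoly_basisf R d n)).
have sf := sqr_integrable_flow (- t) f.
rewrite basis_mean0 !ip_mean0//; last exact: flowed_sqr_integrable.
have [mb _] := sb; have [mf _] := sf.
transitivity (\int[mu]_x (f (F (- t) x) * basisf n x)).
  apply: Rintegral_ae_eq.
  - by apply: measurable_funM => //; exact: L2_measurable.
  - exact: measurable_funM.
  - by apply: filterS (transportE t f) => x ->.
rewrite -(measure_preserving_Rintegral (mpF t) (sqr_integrable_mul sf sb)).
apply: Rintegral_ae_eq.
- apply: (@measurableT_comp _ _ _ _ _ _ (fun x => f (F (- t) x) * basisf n x)); last exact: (mpF t).1.
  exact: measurable_funM.
- by apply: measurable_funM; [exact: L2_measurable|exact: measurable_flowed_basisf].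
- apply: filterS flow_repr0 => x x0; rewrite flow_repr_add addNr x0 /F periodic_torus_repr//.
  by apply: periodic_trigpoly; exact: trigpoly_basisf.
Qed.

Lemma flowed_basisf_taylor n : exists2 C, 0 <= C & forall (h : R) x,
  `|flowed_basisf n h x - basisf n x - h * advection_basisf u n x| <= C * `|h| ^+ 2.
Proof.
have tb := @trigpoly_basisf R d n.
have [_ [_ [C C0 fC]]] := trigpoly_gradient tb.
have [M M0 pM] := C1_pderiv_bounded (trigpoly_C1 tb).
have [K K0 uK] := field_lipschitz u_lipschitz.
have [U U0 uU] := field_bounded u_periodic u_lipschitz.
exists (C * U ^+ 2 + d%:R * (K * U * M)) => [|h x].
  by rewrite addr_ge0 ?mulr_ge0 ?sqr_ge0.
have near := flow_near Phi_flow h x U0 uU.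
have eul := flow_euler Phi_flow h x K0 U0 uK uU.
set v := Phi h x - x.
have vE : Phi h x = x + v by rewrite addrC subrK.
have h1 : `|basisf n (x + v) - basisf n x - \sum_j v 0 j * pderiv j (basisf n) x| <= C * U ^+ 2 * `|h| ^+ 2.
  apply: le_trans (fC x v) _; rewrite -mulrA ler_wpM2l// -exprMn lerXn2r ?nnegrE ?mulr_ge0//.
have h2 : `|\sum_j v 0 j * pderiv j (basisf n) x - h * advection_basisf u n x| <= d%:R * (K * U * M) * `|h| ^+ 2.
  rewrite mulr_sumr -sumrB; apply: le_trans (ler_norm_sum _ _ _) _.
  rewrite -[X in X%:R]card_ord -mulrA mulr_natl -sumr_const; apply: ler_sum => j _.
  rewrite mulrA -mulrBl normrM [K * U * M * _]mulrAC; apply: ler_pM => //.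
  apply: le_trans eul; apply: le_trans (entry_le_norm _ j); rewrite /v !mxE.
  by rewrite opprD addrA.
rewrite /flowed_basisf vE mulrDl; apply: le_trans (lerD h1 h2).
by apply: le_trans (ler_normD _ _); rewrite subrKA.
Qed.

(** The Taylor error along the flow is uniform in x, so the difference quotients at times 1 / (k +
    1) converge in norm. This allows both arguments of the covariance to vary at once in
    [cov_advection]. *)
Lemma cvg_flowed_basis n :
  k.+1%:R *: (flowed_basis n k.+1%:R^-1 - e n) @[k --> \oo] --> advection_basis u n.
Proof.
have [C C0 hC] := flowed_basisf_taylor n.
have sb := C1_sqr_integrable (trigpoly_C1 (@trigpoly_basisf R d n)).
have sa := advection_sqr_integrable u_periodic u_lipschitz n.
have key k : `|k.+1%:R *: (flowed_basis n k.+1%:R^-1 - e n) - advection_basis u n| <=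
    C * (volume R d + 1) * k.+1%:R^-1.
  set h : R := k.+1%:R^-1; have h0 : h != 0 by rewrite invr_eq0 pnatr_eq0.
  have kE : k.+1%:R = h^-1 :> R by rewrite invrK.
  have sf := flowed_sqr_integrable n h.
  have E : k.+1%:R *: (flowed_basis n h - e n) - advection_basis u n =
      mean0 (fun x => h^-1 * (flowed_basisf n h x - basisf n x) - advection_basisf u n x).
    rewrite mean0B//; last by apply: sqr_integrableZ; exact: sqr_integrableB.
    by rewrite mean0Z ?mean0B// -?basis_mean0 ?kE//; exact: sqr_integrableB.
  rewrite E mulrAC; apply: norm_mean0_le.
    have [ma _] := sa; have [mb _] := sb; have [mf _] := sf.
    apply: measurable_funB => //; apply: measurable_funM => //; exact: measurable_funB.
  move=> x; have := hC h x.
  have -> : flowed_basisf n h x - basisf n x - h * advection_basisf u n x =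
    h * (h^-1 * (flowed_basisf n h x - basisf n x) - advection_basisf u n x).
    by rewrite mulrBr mulVKf.
  rewrite normrM mulrC -ler_pdivlMr ?normr_gt0// => hh; apply: le_trans hh _.
  by rewrite expr2 mulrA mulfK ?normr_eq0// ger0_norm// invr_ge0.
apply/cvgrPdist_le => eps eps0.
have c : C * (volume R d + 1) * k.+1%:R^-1 @[k --> \oo] --> (C * (volume R d + 1) * 0 : R).
  by apply: cvgM; [exact: cvg_cst|exact: cvg_harmonic].
rewrite mulr0 in c; move/cvgrPdist_le : c => /(_ eps eps0); apply: filterS => k /=.
rewrite sub0r normrN distrC => h; apply: le_trans (key k) (le_trans (ler_norm _) h).
Qed.

End transport_group.

(** * The covariance form *)

Section ge0_integral_monotone.
Context (dT : measure_display) (T : measurableType dT) (R : realType).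
Variable m : {measure set T -> \bar R}.

(** Compares the suprema over simple functions, which asks for no measurability; it is applied with
    the square of [H1norm] as upper bound, where none has been established. *)
Lemma ge0_le_integralT (f g : T -> \bar R) : (forall x, 0 <= f x)%E ->
  (forall x, f x <= g x)%E -> (\int[m]_x f x <= \int[m]_x g x)%E.
Proof.
move=> f0 fg; have g0 x : (0 <= g x)%E := le_trans (f0 x) (fg x).
rewrite !ge0_integralTE//; apply: ub_ereal_sup => _ [h hf <-].
by apply: ereal_sup_ubound; exists h => // x; exact: le_trans (hf x) (fg x).
Qed.

End ge0_integral_monotone.

Section covariance.
Variables (R : realType) (d : nat).
Notation H := (L2 R d).
Implicit Types (f g v y z : H).
Notation e := (@basis R d).
Let ipC := @ip_sym R d.
Let ipD := @ipDf R d.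
Let ipZ := @ipZf R d.
Let ipN := @ip_normE R d.
Let eO := @basis_orth R d.
Let eT := @basis_total R d.
Let cpl := @L2_complete R d.

Lemma ip_continuous y : continuous (fun z => ip z y).
Proof.
move=> z A /nbhs_ballP[eps /= eps0 epsA].
have y1 : 0 < `|y| + 1 by rewrite ltr_wpDl.
apply/nbhs_ballP; exists (eps / (`|y| + 1)) => /=; first by rewrite divr_gt0.
move=> z'; rewrite -ball_normE /= ltr_pdivlMr// => zz'; apply: epsA.
rewrite -ball_normE /= -(ipBl ipD ipZ); apply: le_lt_trans zz'.
by apply: le_trans (ip_cauchy ipC ipD ipZ ipN _ _) _; rewrite ler_wpM2l// lerDl.
Qed.

Lemma borel_continuous (F : H -> R) : continuous F -> measurable_fun [set: borelL2 R d] F.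
Proof.
move=> cF; apply: (measurability (@RGenOpens.G R)) => //.
  exact: RGenOpens.measurableE.
move=> _ [_ [a [b ->] <-]]; rewrite setTI; apply: sub_sigma_algebra => /=.
by apply: open_comp => [x _|]; [exact: cF|exact: interval_open].
Qed.

Lemma measurable_ip y : measurable_fun [set: borelL2 R d] (fun z => ip z y).
Proof. by apply: borel_continuous; exact: ip_continuous. Qed.

(** The squared H^1 norm on the Fourier side: measurable as a series of continuous functions, and
    finite exactly on [H1]. *)
Definition energy z : \bar R := (\sum_(0 <= n <oo) ((weight R d n * ip z (e n)) ^+ 2)%:E)%E.

Lemma energy_term_ge0 z n : (0 <= ((weight R d n * ip z (e n)) ^+ 2)%:E)%E.
Proof. by rewrite lee_fin sqr_ge0. Qed.

Lemma energy_ge_sum z n :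
  ((\sum_(i < n) (weight R d i * ip z (e i)) ^+ 2)%:E <= energy z)%E.
Proof.
rewrite -sumEFin -(big_mkord xpredT (fun i => ((weight R d i * ip z (e i)) ^+ 2)%:E)).
by apply: nneseries_lim_ge => k *; exact: energy_term_ge0.
Qed.

Lemma energy_le z (M : R) : (forall n, \sum_(i < n) (weight R d i * ip z (e i)) ^+ 2 <= M) ->
  (energy z <= M%:E)%E.
Proof.
move=> zM; apply: lime_le; first by apply: is_cvg_nneseries => n _ _; exact: energy_term_ge0.
by apply: nearW => n; rewrite big_mkord sumEFin lee_fin.
Qed.

Lemma energy_le_H1norm z : (energy z <= H1norm z ^+ 2)%E.
Proof.
have [[g zg]|nz] := pselect (exists g, is_sqrt_laplacian z g); last first.
  (* The infimum defining [H1norm] is here over the empty set. *)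
  suff -> : H1norm z = +oo%E by rewrite expe2 mulyy leey.
  by apply: (ereal_inf_pinfty _).2 => y [g zg _]; case: nz; exists g.
have gn : (`|g|%:E <= H1norm z)%E.
  apply/ereal_infP => _ [g' zg' <-]; suff -> : g = g' by [].
  apply: L2_ip_eq => y; apply/eqP; rewrite -subr_eq0 -(ipBr ipC ipD ipZ).
  suff -> : g - g' = 0 by rewrite (ip0r ipC ipZ).
  apply: eT => n; rewrite (ipBl ipD ipZ).
  by rewrite ((sqrt_laplacianP z g).1 zg) ((sqrt_laplacianP z g').1 zg') subrr.
apply: le_trans (_ : (`|g| ^+ 2)%:E <= _)%E.
  apply: energy_le => n; apply: le_trans (bessel ipC ipD ipZ ipN eO g n).
  by apply: ler_sum => i _; rewrite ((sqrt_laplacianP z g).1 zg).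
by rewrite expe2 expr2 EFinM; apply: lee_pmul; rewrite ?lee_fin.
Qed.

Lemma measurable_energy : measurable_fun [set: borelL2 R d] energy.
Proof.
apply: (@ge0_emeasurable_sum _ _ _ _ (fun n (z : borelL2 R d) => ((weight R d n * ip (z : H) (e n)) ^+ 2)%:E) xpredT).
  by move=> n z _ _; exact: energy_term_ge0.
move=> n _; apply/measurable_EFinP; apply: measurable_funX.
by apply: measurable_funM => //; exact: measurable_ip.
Qed.

Lemma sobolev_energy z : (energy z < +oo)%E -> sobolev z.
Proof.
move=> zoo; exists (fine (energy z)) => n; rewrite -lee_fin fineK; first exact: energy_ge_sum.
rewrite ge0_fin_numE//; apply: nneseries_ge0 => k _ _; exact: energy_term_ge0.
Qed.

(** A non-zero integer vector has length at least 1. This is the Poincare inequality behind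
    [norm_le_energy], which gives mu0 a second moment in L^2. *)
Lemma weight_ge1 n : indexed_nz d n -> 1 <= weight R d n.
Proof.
rewrite /indexed_nz /weight; case En : (indexed d n) => [p|//] _.
have [/positive_neq0 p0 _] := indexedP En.
have [j pj] : exists j, p.1 0 j != 0.
  apply/existsP; rewrite -negb_forall; apply: contraNN p0 => /forallP h.
  by apply/eqP/rowP => j; rewrite mxE; apply/eqP; exact: h.
rewrite -(@ler_sqr R) ?nnegrE ?sqrtr_ge0// expr1n sqr_sqrtr; last first.
  by apply: sumr_ge0 => i _; exact: sqr_ge0.
rewrite (bigD1 j)//=; apply: (@le_trans _ _ ((p.1 0 j)%:~R ^+ 2)); last first.
  by rewrite lerDl sumr_ge0// => i _; exact: sqr_ge0.
rewrite -(@real_normK R) ?num_real// exprn_ege1// -intr_norm ler1z.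
by rewrite -gtz0_ge1 normr_gt0.
Qed.

Lemma norm_le_energy z : ((`|z| ^+ 2)%:E <= energy z)%E.
Proof.
have [zoo|] := boolP (energy z < +oo)%E; last by rewrite -leNgt leye_eq => /eqP ->; rewrite leey.
have zf : (energy z)%E \is a fin_num.
  by rewrite ge0_fin_numE//; apply: nneseries_ge0 => k _ _; exact: energy_term_ge0.
rewrite -(fineK zf) lee_fin -ipN.
apply: (cvgr_to_le (@ip_parseval R d z z)); apply: nearW => n.
rewrite -lee_fin fineK//; apply: le_trans (energy_ge_sum z n); rewrite lee_fin.
apply: ler_sum => i _; rewrite -expr2 exprMn.
case: (boolP (indexed_nz d i)) => [/weight_ge1 w1|/(nz_zero ipN eO) ->].
  by rewrite ler_peMl ?sqr_ge0// exprn_ege1.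
by rewrite (ip0r ipC ipZ) expr0n/= mulr0.
Qed.

Variable mu0 : probability (borelL2 R d) R.
Hypothesis mu0_H1 : (\int[mu0]_z (H1norm z ^+ 2) < +oo)%E.

Lemma integral_energy : (\int[mu0]_z energy z < +oo)%E.
Proof.
apply: le_lt_trans mu0_H1; apply: ge0_le_integralT => z; last exact: energy_le_H1norm.
by apply: nneseries_ge0 => k _ _; exact: energy_term_ge0.
Qed.

Lemma ae_sobolev : {ae mu0, forall z, (energy z < +oo)%E}.
Proof.
have ie : mu0.-integrable setT energy.
  apply/integrableP; split; first exact: measurable_energy.
  under eq_integral => z _.
    rewrite gee0_abs; last by apply: nneseries_ge0 => k _ _; exact: energy_term_ge0.
    over.
  exact: integral_energy.
have := integrable_ae measurableT ie; apply: filterS => z /(_ I).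
by rewrite fin_numE ltey => /andP[].
Qed.

Lemma measurable_norm_sqr : measurable_fun [set: borelL2 R d] (fun z : H => `|z| ^+ 2).
Proof. by apply: measurable_funX; apply: borel_continuous; exact: norm_continuous. Qed.

Lemma integrable_norm_sqr : mu0.-integrable setT (EFin \o (fun z : H => `|z| ^+ 2)).
Proof.
apply/integrableP; split; first by apply/measurable_EFinP; exact: measurable_norm_sqr.
apply: le_lt_trans integral_energy; apply: ge0_le_integralT => z; first exact: abse_ge0.
by rewrite /= ger0_norm ?sqr_ge0//; exact: norm_le_energy.
Qed.

Lemma integrable_ipM f g : mu0.-integrable setT (EFin \o (fun z => ip z f * ip z g)).
Proof.
apply: (@le_Rintegrable _ _ _ mu0 _ _ _ (RintegrableZ (`|f| * `|g|) integrable_norm_sqr)).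
  by apply: measurable_funM; exact: measurable_ip.
move=> z; rewrite normrM.
have -> : `|f| * `|g| * `|z| ^+ 2 = (`|z| * `|f|) * (`|z| * `|g|) by ring.
by apply: ler_pM => //; exact: (ip_cauchy ipC ipD ipZ ipN).
Qed.

Definition cov f g : R := \int[mu0]_z (ip z f * ip z g).

Lemma covC f g : cov f g = cov g f.
Proof. by apply: eq_Rintegral => z _; rewrite mulrC. Qed.

Lemma covDl f f' g : cov (f + f') g = cov f g + cov f' g.
Proof.
rewrite /cov -RintegralD ?integrable_ipM//; apply: eq_Rintegral => z _.
by rewrite (ipDr ipC ipD) mulrDl.
Qed.

Lemma covZl c f g : cov (c *: f) g = c * cov f g.
Proof.
rewrite /cov -RintegralZl ?integrable_ipM//; apply: eq_Rintegral => z _.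
by rewrite (ipZr ipC ipZ) mulrA.
Qed.

Lemma cov_ge0 f : 0 <= cov f f.
Proof. by apply: Rintegral_ge0 => z _; rewrite -expr2 sqr_ge0. Qed.

Definition cov_total_mass : R := \int[mu0]_z (`|z| ^+ 2).

Lemma cov_sum m (v : nat -> H) :
  \sum_(i < m) cov (v i) (v i) = \int[mu0]_z (\sum_(i < m) ip z (v i) ^+ 2).
Proof.
rewrite Rintegral_sum => [|i]; first by apply: eq_bigr => i _; apply: eq_Rintegral => z _; rewrite expr2.
by have := integrable_ipM (v i) (v i); congr (_.-integrable _ _); apply/funext => z; rewrite /= expr2.
Qed.

Lemma integrable_ip_sqr v : mu0.-integrable setT (EFin \o (fun z => ip z v ^+ 2)).
Proof.
by have := integrable_ipM v v; congr (_.-integrable _ _); apply/funext => z; rewrite /= expr2.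
Qed.

Lemma cov_trace m (v : nat -> H) (b : nat -> bool) :
  (forall i j, (i < m)%N -> (j < m)%N -> ip (v i) (v j) = ((i == j) && b i)%:R) ->
  \sum_(i < m) cov (v i) (v i) <= cov_total_mass.
Proof.
move=> vb; rewrite cov_sum; apply: le_Rintegral => //.
- by apply: Rintegrable_sum => i; exact: integrable_ip_sqr.
- exact: integrable_norm_sqr.
- by move=> z _; exact: (bessel_family ipC ipD ipZ ipN z vb).
Qed.

Lemma cov_total : \sum_(i < n) cov (e i) (e i) @[n --> \oo] --> cov_total_mass.
Proof.
have [|||||_ c] := @Rintegral_dominated _ _ _ mu0 (fun n z => \sum_(i < n) ip z (e i) ^+ 2)
  (fun z : H => `|z| ^+ 2) (fun z : H => `|z| ^+ 2).
- by move=> n; apply: measurable_sum => i; apply: measurable_funX; exact: measurable_ip.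
- exact: measurable_norm_sqr.
- apply: aeW => z; rewrite -ipN; have := @ip_parseval R d z z.
  by under eq_fun do under eq_bigr do rewrite -expr2.
- exact: integrable_norm_sqr.
- apply: aeW => z n; rewrite ger0_norm; last by apply: sumr_ge0 => i _; exact: sqr_ge0.
  exact: (bessel ipC ipD ipZ ipN eO).
by under eq_fun do rewrite cov_sum.
Qed.

Notation eigenspace := (eigenspace (@ip R d) cov).

Lemma cov_riesz y : exists c, forall x, ip c x = cov y x.
Proof. exact: (form_riesz ipC ipD ipZ ipN cpl eO eT covC covDl covZl cov_ge0 cov_trace y).
Qed.

(** Since lambda <v, e i> = cov v (e i), Cauchy-Schwarz gives lambda^2 <v, e i>^2 <= cov v v * cov
    (e i) (e i). Summed with squared weights, the last factors become the mu0-integral of a partial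
    sum of [energy], bounded uniformly in n. *)
Lemma eigenspace_sobolev (lambda : R) v : 0 < lambda -> eigenspace lambda v -> sobolev v.
Proof.
move=> l0 Ev; have ef := integral_energy.
exists (cov v v * fine (\int[mu0]_z energy z) / lambda ^+ 2) => n.
rewrite ler_pdivlMr ?exprn_gt0// mulr_suml.
apply: (@le_trans _ _ (cov v v * \sum_(i < n) (weight R d i) ^+ 2 * cov (e i) (e i))).
  rewrite mulr_sumr; apply: ler_sum => i _.
  have -> : (weight R d i * ip v (e i)) ^+ 2 * lambda ^+ 2 =
    weight R d i ^+ 2 * (lambda * ip v (e i)) ^+ 2 by ring.
  rewrite -Ev [leRHS]mulrCA ler_wpM2l ?sqr_ge0//.
  exact: (form_cauchy covC covDl covZl cov_ge0).
rewrite ler_wpM2l ?cov_ge0//.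
have -> : \sum_(i < n) weight R d i ^+ 2 * cov (e i) (e i) =
    \int[mu0]_z (\sum_(i < n) (weight R d i * ip z (e i)) ^+ 2).
  under [in RHS]eq_Rintegral do under eq_bigr do rewrite exprMn.
  rewrite Rintegral_sum => [|i]; last by apply: RintegrableZ; exact: integrable_ip_sqr.
  apply: eq_bigr => i _; rewrite (RintegralZl _ measurableT (integrable_ip_sqr (e i))).
  by congr (_ * _); apply: eq_Rintegral => z _; rewrite expr2.
have is_ : mu0.-integrable setT (EFin \o (fun z => \sum_(i < n) (weight R d i * ip z (e i)) ^+ 2)).
  apply: Rintegrable_sum => i; have := RintegrableZ (weight R d i ^+ 2) (integrable_ip_sqr (e i)).
  by congr (_.-integrable _ _); apply/funext => z; rewrite /= exprMn.
have e0 z : (0 <= energy z)%E by apply: nneseries_ge0 => k _ _; exact: energy_term_ge0.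
rewrite /Rintegral fine_le//.
- exact: (integrable_fin_num measurableT is_).
- by rewrite ge0_fin_numE ?integral_ge0.
- apply: ge0_le_integralT => z; last exact: energy_ge_sum.
  by rewrite lee_fin; apply: sumr_ge0 => i _; exact: sqr_ge0.
Qed.

(** Let w n be the projection of e n onto the complement of the eigenvectors. By [form_spectral] the
    mu0-integral of <z, w n>^2 is 0, so almost every z is orthogonal to w n. The countably many
    exceptional sets are united, and [orthogonal_all] concludes. *)
Lemma ae_of_eigenvectors (K : set H) : closed K -> subspace K ->
  (forall lambda v, 0 < lambda -> eigenspace lambda v -> K v) -> {ae mu0, forall z, K z}.
Proof.
move=> clK sK EK; pose S := eigenvectors (@ip R d) cov.
have /choice[w hw] : forall n, exists w, (forall v, S v -> ip w v = 0) /\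
    forall y, (forall v, S v -> ip y v = 0) -> ip (e n - w) y = 0.
  move=> n; have [w Ww hw] := orthogonal_projection ipC ipD ipZ ipN cpl (e n)
    (closed_orthogonal ipC ipD ipZ ipN (S := S)) (subspace_orthogonal ipD ipZ S).
  by exists w.
have w0 n : {ae mu0, forall z, ip (w n) z = 0}.
  have cw : cov (w n) (w n) = 0.
    apply: (form_spectral ipC ipD ipZ ipN cpl eO eT covC covDl covZl cov_ge0 cov_trace cov_total).
    exact: (hw n).1.
  have iw := integrable_ip_sqr (w n); have mw := Rintegrable_measurable iw.
  have : ae_eq mu0 setT (EFin \o (fun z => ip z (w n) ^+ 2)) (cst 0%E).
    apply/ae_eq_integral_abs => //; first exact/measurable_EFinP.
    under eq_integral do rewrite /= ger0_norm ?sqr_ge0//.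
    have I0 : \int[mu0]_z (ip z (w n) ^+ 2) = 0.
      by rewrite -cw; apply: eq_Rintegral => z _; rewrite expr2.
    by rewrite -(fineK (integrable_fin_num measurableT iw)) [fine _]I0.
  apply: filterS => z /(_ I) [] /eqP; rewrite sqrf_eq0 => /eqP; rewrite ipC; exact.
have := ae_foralln w0; apply: filterS => z wz.
apply: (orthogonal_all ipC ipD ipZ ipN cpl eT clK sK (S := S) (w := w)) => //.
- by move=> v [lambda l0 Ev]; exact: EK Ev.
- by move=> n; exact: (hw n).1.
- by move=> n; exact: (hw n).2.
Qed.

End covariance.

(** * Commutation of the covariance with u . grad *)

Section invariance.
Variables (R : realType) (d : nat).
Notation T := 'rV[R]_d.
Notation H := (L2 R d).
Implicit Types (f g v y z : H).
Notation e := (@basis R d).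
Let ipC := @ip_sym R d.
Let ipD := @ipDf R d.
Let ipZ := @ipZf R d.
Let ipN := @ip_normE R d.
Let eO := @basis_orth R d.
Let eT := @basis_total R d.
Let cpl := @L2_complete R d.
Variable u : T -> T.
Hypotheses (u_periodic : periodic2pi u) (u_lipschitz : lipschitz u)
  (u_divergence_free : divergence_free u).
Variable Phi : R -> T -> T.
Hypothesis Phi_flow : is_flow u Phi.
Variable mu0 : probability (borelL2 R d) R.
Hypotheses (mu0_invariant : invariant_measure mu0 (transport Phi))
  (mu0_H1 : (\int[mu0]_z (H1norm z ^+ 2) < +oo)%E).

Let trK := transportK u_periodic u_lipschitz u_divergence_free Phi_flow.
Let covD := covDl mu0_H1.
Let covZ := covZl mu0_H1.
Let covT := cov_trace mu0_H1.

Lemma measurable_transport t : measurable_fun [set: borelL2 R d]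
  (transport Phi t : borelL2 R d -> borelL2 R d).
Proof.
apply: (measurability (@open (L2 R d) : set (set (borelL2 R d)))) => //.
move=> _ [A oA <-]; rewrite setTI; apply: sub_sigma_algebra.
apply: open_comp => // x _.
exact: (transport_continuous u_periodic u_lipschitz u_divergence_free Phi_flow).
Qed.

(** Invariance is stated for images; a preimage under S(t) is an image under S(- t). *)
Lemma transport_preimage t (A : set (borelL2 R d)) : measurable A ->
  mu0 ((transport Phi t : borelL2 R d -> borelL2 R d) @^-1` A) = mu0 A.
Proof.
move=> mA; rewrite [RHS](mu0_invariant (- t) mA); congr (mu0 _).
apply/seteqP; split => [z Az|_ [z Az <-]] /=; last by rewrite trK.
by exists (transport Phi t z) => //; have := trK (- t) z; rewrite opprK.
Qed.

Lemma transport_Rintegral t (G : borelL2 R d -> R) : mu0.-integrable setT (EFin \o G) ->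
  mu0.-integrable setT (EFin \o (fun z => G (transport Phi t z))) ->
  \int[mu0]_z G (transport Phi t z) = \int[mu0]_z G z.
Proof.
move=> iG iGt; have /integrableP[mG _] := iG; rewrite /Rintegral; congr fine.
have mt := measurable_transport t.
have := @integral_pushforward _ _ _ _ _ _ mt mu0 setT (EFin \o G) mG.
rewrite preimage_setT => /(_ iGt measurableT) h; rewrite -[LHS]h.
by apply: eq_measure_integral => A mA _; exact: transport_preimage.
Qed.

Lemma cov_flowed m n t : cov mu0 (flowed_basis Phi m t) (flowed_basis Phi n t) = cov mu0 (e m) (e n).
Proof.
have ipt := ip_transport_basis u_periodic u_lipschitz u_divergence_free Phi_flow.
have E : (fun z => ip (transport Phi t z) (e m) * ip (transport Phi t z) (e n)) =
    (fun z => ip z (flowed_basis Phi m t) * ip z (flowed_basis Phi n t)).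
  by apply/funext => z; rewrite !ipt.
have := @transport_Rintegral t (fun z => ip (z : H) (e m) * ip (z : H) (e n)) (integrable_ipM mu0_H1 _ _).
by rewrite E => /(_ (integrable_ipM mu0_H1 _ _)).
Qed.

Lemma cov_le_norm f g : `|cov mu0 f g| <= cov_total_mass mu0 * (`|f| * `|g|).
Proof.
have M0 : 0 <= cov_total_mass mu0 by apply: Rintegral_ge0 => z _; exact: sqr_ge0.
rewrite -ler_sqr ?nnegrE ?mulr_ge0// -normrX ger0_norm ?sqr_ge0//.
apply: le_trans (form_cauchy (@covC R d mu0) covD covZ (@cov_ge0 R d mu0) f g) _.
have h x := form_le ipC ipZ ipN (@covC R d mu0) covZ covT x.
apply: le_trans (ler_pM _ _ (h f) (h g)) _; rewrite ?cov_ge0//.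
by rewrite le_eqVlt; apply/orP; left; apply/eqP; ring.
Qed.

(* Differentiating the invariance of cov under the flow at t = 0. *)
Lemma cov_advection m n :
  cov mu0 (advection_basis u m) (e n) + cov mu0 (e m) (advection_basis u n) = 0.
Proof.
pose D p k := k.+1%:R *: (flowed_basis Phi p k.+1%:R^-1 - e p).
have cD p : D p k @[k --> \oo] --> advection_basis u p.
  exact: (cvg_flowed_basis u_periodic u_lipschitz Phi_flow).
have fE p k : flowed_basis Phi p k.+1%:R^-1 = e p + k.+1%:R^-1 *: D p k.
  by rewrite /D scalerA mulVf ?pnatr_eq0// scale1r addrC subrK.
have covDr x y z := formDr (@covC R d mu0) covD x y z.
have covZr c x y := formZr (@covC R d mu0) covZ c x y.
(* Bilinear expansion of the invariance at time 1 / (k + 1), divided by this time; the right side is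
   the second-order term, which tends to 0. *)
have key k : cov mu0 (D m k) (e n) + cov mu0 (e m) (D n k) =
    - (k.+1%:R^-1 * cov mu0 (D m k) (D n k)).
  have := cov_flowed m n k.+1%:R^-1; rewrite !fE covD !covDr !covZ !covZr.
  set r : R := k.+1%:R^-1; have r0 : r != 0 by rewrite invr_eq0 pnatr_eq0.
  set a := cov _ (e m) (e n); set b := cov _ (e m) _; set c := cov _ _ (e n); set p := cov _ _ _.
  move=> h; apply: (mulfI r0); lra.
have cc := cvg_form (M := cov_total_mass mu0) ipC ipZ ipN (@covC R d mu0) covD covZ (@cov_ge0 R d mu0) covT.
have c1 : cov mu0 (D m k) (e n) + cov mu0 (e m) (D n k) @[k --> \oo] -->
    cov mu0 (advection_basis u m) (e n) + cov mu0 (e m) (advection_basis u n).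
  apply: cvgD; last exact: cc.
  by under eq_fun do rewrite covC; rewrite covC; exact: cc.
have c2 : - (k.+1%:R^-1 * cov mu0 (D m k) (D n k)) @[k --> \oo] --> (0 : R).
  rewrite -oppr0; apply: cvgN; apply/norm_cvg0P.
  have cb : k.+1%:R^-1 * (cov_total_mass mu0 * (`|D m k| * `|D n k|)) @[k --> \oo] -->
      (0 * (cov_total_mass mu0 * (`|advection_basis u m| * `|advection_basis u n|)) : R).
    apply: cvgM; first exact: cvg_harmonic.
    by apply: cvgM; [exact: cvg_cst|apply: cvgM; apply: cvg_norm; exact: cD].
  rewrite mul0r in cb; apply: (squeeze_cvgr _ (cvg_cst 0) cb); apply: nearW => k.
  by rewrite normr_ge0/= normrM ger0_norm ?invr_ge0// ler_wpM2l ?invr_ge0// cov_le_norm.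
have E := funext key.
by rewrite E in c1; exact: cvg_unique c1 c2.
Qed.

Notation eigenspace := (eigenspace (@ip R d) (cov mu0)).

(** [cov_advection] holds on basis vectors only, so v is expanded: cov (A v) (e n) = - cov v (A e n)
    = - lambda <v, A e n> = lambda <A v, e n>. The Riesz vectors c and c' turn the covariances into
    inner products, in which the series can be summed. *)
Lemma eigenspace_advection (lambda : R) v h : 0 < lambda -> eigenspace lambda v ->
  weak_advection u v h -> eigenspace lambda h.
Proof.
move=> l0 Ev vh; have sv := eigenspace_sobolev mu0_H1 l0 Ev.
have key n : cov mu0 h (e n) = lambda * ip h (e n).
  have [c cE] := cov_riesz mu0_H1 (e n); have [c' cE'] := cov_riesz mu0_H1 (advection_basis u n).
  have c1 := weak_advectionP u_periodic u_lipschitz u_divergence_free (y := c) sv vh.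
  have c2 := cvgN (@ip_parseval R d v c').
  have E : (fun k => \sum_(i < k) ip v (e i) * ip (advection_basis u i) c) =
      - (fun k => \sum_(i < k) ip v (e i) * ip c' (e i)).
    apply/funext => k; rewrite [RHS](_ : _ = - \sum_(i < k) ip v (e i) * ip c' (e i))//.
    rewrite -sumrN; apply: eq_bigr => i _; rewrite -mulrN; congr (_ * _).
    have a1 : ip (advection_basis u i) c = cov mu0 (e n) (advection_basis u i) := etrans (ipC _ _) (cE _).
    have a2 : cov mu0 (advection_basis u i) (e n) = - cov mu0 (e i) (advection_basis u n).
      by apply/eqP; rewrite -addr_eq0; apply/eqP; exact: cov_advection.
    have a3 : cov mu0 (e i) (advection_basis u n) = ip c' (e i) := etrans (covC _ _ _) (esym (cE' _)).
    exact: etrans (etrans a1 (covC _ _ _)) (etrans a2 (congr1 -%R a3)).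
  rewrite E in c1; have hc : ip h c = - ip v c' by exact: cvg_unique c1 (c2 _).
  have b1 : cov mu0 h (e n) = ip h c := etrans (covC _ _ _) (esym (etrans (ipC _ _) (cE _))).
  have b2 : ip v c' = cov mu0 v (advection_basis u n) := etrans (ipC _ _) (etrans (cE' _) (covC _ _ _)).
  by rewrite b1 hc b2 Ev vh mulrN.
(* From the basis to every y: the Riesz vector of cov h has the same coefficients as lambda h. *)
have [c cE] := cov_riesz mu0_H1 h.
have c0 : c - lambda *: h = 0 by apply: eT => n; rewrite (ipBl ipD ipZ) ipZ cE key subrr.
by move=> y; rewrite -cE -(subrK (lambda *: h) c) c0 add0r ipZ.
Qed.

End invariance.

(** * Eigenfunctions *)

Section antisymmetric_matrix.
Local Open Scope sesquilinear_scope.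

(* i M is Hermitian, hence unitarily diagonalisable with real eigenvalues. *)
Lemma antisymmetric_diagonalizable (R : realType) n (M : 'M[R]_n) :
  (forall i j, M i j = - M j i) ->
  exists2 P : 'M[R[i]]_n, P \in unitmx & exists lambda : 'I_n -> R, forall r j,
    \sum_i P r i * (M i j)%:C%C = 'i%C * (lambda r)%:C%C * P r j.
Proof.
move=> Manti; pose A : 'M[R[i]]_n := \matrix_(i, j) ('i%C * (M i j)%:C%C).
have ii : 'i%C * 'i%C = -1 :> R[i] by rewrite -expr2 sqr_i.
have Aherm : A \is hermsymmx.
  apply/is_hermitianmxP; rewrite expr0 scale1r; apply/matrixP => i j; rewrite !mxE.
  rewrite rmorphM/= (Manti i j) rmorphN/= mulrN -mulNr; congr (_ * _).
    by apply/eqP; rewrite eq_complex /= oppr0 !eqxx.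
  by apply/eqP; rewrite eq_complex /= oppr0 !eqxx.
have /orthomx_spectralP AE := hermitian_normalmx Aherm.
have Dreal := hermitian_spectral_diag_real Aherm.
set P := spectralmx A in AE; have Pu : P \in unitmx := spectral_unit A.
(* M = - i A, so a real eigenvalue D of A gives the eigenvalue - i D of M; hence the sign. *)
exists P => //; exists (fun r => - complex.Re (spectral_diag A 0 r)) => r j.
have PA : P *m A = diag_mx (spectral_diag A) *m P by rewrite {1}AE -!mulmxA mulKVmx.
have /matrixP /(_ r j) := PA; rewrite mul_diag_mx !mxE => h.
have Dr : (complex.Re (spectral_diag A 0 r))%:C%C = spectral_diag A 0 r.
  by apply: RRe_real; exact: (mxOverP Dreal).
rewrite rmorphN/= Dr mulrN mulNr -mulrA -h mulr_sumr -sumrN; apply: eq_bigr => i _.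
by rewrite mxE [in RHS]mulrCA (mulrA 'i%C) ii mulN1r mulrN opprK.
Qed.

End antisymmetric_matrix.

Section complex_span.
Variables (R : realType) (d : nat).
Notation H := (L2 R d).
Implicit Types (f g : H) (phi psi : L2C R d) (A : set (L2C R d)).

Lemma cspan0 A : cspan A 0.
Proof.
by exists 0%N, (fun=> 0), (fun=> 0); split => [[]//|]; rewrite big_ord0.
Qed.

Lemma cspanD A phi psi : cspan A phi -> cspan A psi -> cspan A (phi + psi).
Proof.
move=> [m [a [p [Ap ->]]]] [n [b [q [Aq ->]]]].
exists (m + n)%N, (fun i => match fintype.split i with inl j => a j | inr k => b k end),
  (fun i => match fintype.split i with inl j => p j | inr k => q k end); split.
  by move=> i; case: (fintype.split i).
rewrite big_split_ord/=; congr (_ + _); apply: eq_bigr => i _.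
  by rewrite (unsplitK (inl i)).
by rewrite (unsplitK (inr i)).
Qed.

Lemma cspanZ A (c : R) phi : cspan A phi -> cspan A (c *: phi).
Proof.
move=> [m [a [p [Ap ->]]]]; exists m, (fun i => c%:C%C * a i), p; split => //.
rewrite scaler_sumr; apply: eq_bigr => i _; case: (a i) => x y.
rewrite /cscale /=; congr pair => /=.
  by rewrite !mul0r subr0 addr0 scalerBr !scalerA.
by rewrite !mul0r subr0 addr0 scalerDr !scalerA.
Qed.

Lemma closureD A phi psi : (forall p q, A p -> A q -> A (p + q)) ->
  closure A phi -> closure A psi -> closure A (phi + psi).
Proof.
move=> AD cp cq B /nbhs_ballP[eps /= eps0 epsB].
have e2 : 0 < eps / 2 by rewrite divr_gt0.
have [p [Ap bp]] := cp _ (nbhsx_ballx phi _ e2).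
have [q [Aq bq]] := cq _ (nbhsx_ballx psi _ e2).
exists (p + q); split; first exact: AD.
apply: epsB; move: bp bq; rewrite -!ball_normE /= => bp bq.
rewrite opprD addrACA (le_lt_trans (ler_normD _ _))// [ltRHS](splitr eps); exact: ltrD.
Qed.

Lemma closureZ A (c : R) phi : (forall p, A p -> A (c *: p)) ->
  closure A phi -> closure A (c *: phi).
Proof.
move=> AZ cp B /nbhs_ballP[eps /= eps0 epsB].
have c1 : 0 < `|c| + 1 by rewrite ltr_wpDl.
have e2 : 0 < eps / (`|c| + 1) by rewrite divr_gt0.
have [p [Ap bp]] := cp _ (nbhsx_ballx phi _ e2).
exists (c *: p); split; first exact: AZ.
apply: epsB; move: bp; rewrite -!ball_normE /= -scalerBr normrZ ltr_pdivlMr//.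
by apply: le_lt_trans; rewrite mulrC ler_wpM2l// lerDl.
Qed.

Lemma complexify_continuous : continuous (@complexify R d).
Proof.
move=> f B /nbhs_ballP[eps /= eps0 epsB]; apply/nbhs_ballP; exists eps => //= g fg.
by apply: epsB; split => //=; exact: ballxx.
Qed.

Variable u : 'rV[R]_d -> 'rV[R]_d.

(** The real functions in E form a closed real subspace, to which the real Hilbert space argument
    applies. *)
Definition realE : set H := [set f | spaceE u (complexify f)].

Lemma closed_realE : closed realE.
Proof. by apply: (@closed_comp _ _ _ (spaceE u)) => [f _|]; [exact: complexify_continuous|exact: closed_closure]. Qed.

Lemma subspace_realE : subspace realE.
Proof.
split => [|f g Ef Eg|c f Ef].
- by apply: subset_closure; exact: cspan0.
- rewrite /realE /=; have -> : complexify (f + g) = complexify f + complexify g.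
    by rewrite /complexify; congr pair; rewrite /= addr0.
  by apply: closureD => //; exact: cspanD.
- rewrite /realE /=; have -> : complexify (c *: f) = c *: complexify f.
    by rewrite /complexify; congr pair; rewrite /= scaler0.
  by apply: closureZ => //; exact: cspanZ.
Qed.

Hypotheses (u_periodic : periodic2pi u) (u_lipschitz : lipschitz u)
  (u_divergence_free : divergence_free u).

Lemma weak_advection_sum m (c : 'I_m -> R) (v h : 'I_m -> H) :
  (forall i, weak_advection u (v i) (h i)) ->
  weak_advection u (\sum_i c i *: v i) (\sum_i c i *: h i).
Proof.
move=> vh n; rewrite !(ip_suml (@ipDf R d) (@ipZf R d)) -sumrN; apply: eq_bigr => i _.
by rewrite !ipZf vh mulrN.
Qed.

Lemma is_advection_ae f (h h' : 'rV[R]_d -> R) : {ae torus R d, forall x, h x = h' x} ->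
  is_advection u f h -> is_advection u f h'.
Proof.
by move=> hh [G Gf GE]; exists G => //; apply: filterS2 hh GE => x <-.
Qed.

(* An antisymmetric matrix of u . grad on a finite-dimensional invariant space
   is diagonalised over the complex numbers by eigenfunctions. *)
Lemma invariant_realE m (v h : 'I_m -> H) (M : 'M[R]_m) :
  (forall c : 'I_m -> R, sobolev (\sum_i c i *: v i)) ->
  (forall i, weak_advection u (v i) (h i)) -> (forall i, h i = \sum_j M i j *: v j) ->
  (forall i j, M i j = - M j i) -> forall i, realE (v i).
Proof.
move=> sv vh hM Manti i; apply: subset_closure.
have [P Pu [lambda PM]] := antisymmetric_diagonalizable Manti.
pose a r := \sum_i complex.Re (P r i) *: v i; pose b r := \sum_i complex.Im (P r i) *: v i.
have ReC (z : R[i]) (x : R) : complex.Re (z * x%:C%C) = complex.Re z * x /\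
    complex.Im (z * x%:C%C) = complex.Im z * x.
  by case: z => z1 z2 /=; rewrite mulr0 subr0 mulr0 add0r.
have Re_sum (F : 'I_m -> R[i]) : complex.Re (\sum_k F k) = \sum_k complex.Re (F k) /\
    complex.Im (\sum_k F k) = \sum_k complex.Im (F k).
  by split; rewrite raddf_sum.
have advE (c : 'I_m -> R) : weak_advection u (\sum_i c i *: v i) (\sum_j (\sum_i c i * M i j) *: v j).
  have := weak_advection_sum c vh; congr (weak_advection u _ _).
  under eq_bigr => k _ do rewrite hM scaler_sumr.
  rewrite exchange_big/=; apply: eq_bigr => j _; rewrite scaler_suml.
  by apply: eq_bigr => k _; rewrite scalerA.
have adv_a r : weak_advection u (a r) (- lambda r *: b r).
  have := advE (fun i => complex.Re (P r i)); congr (weak_advection u _ _).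
  rewrite scaler_sumr; apply: eq_bigr => j _; rewrite scalerA; congr (_ *: _).
  have := congr1 (@complex.Re R) (PM r j); rewrite (Re_sum _).1.
  under eq_bigr do rewrite (ReC _ _).1.
  by move=> ->; case: (P r j) => x y /=; ring.
have adv_b r : weak_advection u (b r) (lambda r *: a r).
  have := advE (fun i => complex.Im (P r i)); congr (weak_advection u _ _).
  rewrite scaler_sumr; apply: eq_bigr => j _; rewrite scalerA; congr (_ *: _).
  have := congr1 (@complex.Im R) (PM r j); rewrite (Re_sum _).2.
  under eq_bigr do rewrite (ReC _ _).2.
  by move=> ->; case: (P r j) => x y /=; ring.
(* a r + i b r is the eigenfunction given by row r of P. Row i of the inverse of P recombines these
   into v i, with zero imaginary part. *)
exists m, (fun r => invmx P i r), (fun r => (a r, b r)); split.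
  move=> r; split; [by apply/H1P; exact: sv|by apply/H1P; exact: sv|exists (lambda r); split].
    apply: (is_advection_ae (h := (- lambda r *: b r : H))).
      by have := L2_scaleE (- lambda r) (b r); apply: filterS => x ->; rewrite mulNr.
    exact: (weak_advection_is_advection u_periodic u_lipschitz u_divergence_free (sv _) (adv_a r)).
  apply: (is_advection_ae (h := (lambda r *: a r : H))); first exact: L2_scaleE.
  exact: (weak_advection_is_advection u_periodic u_lipschitz u_divergence_free (sv _) (adv_b r)).
have QP j : \sum_r invmx P i r * P r j = (i == j)%:R.
  by have /matrixP /(_ i j) := mulVmx Pu; rewrite !mxE.
have ReM (z w : R[i]) : complex.Re (z * w) = complex.Re z * complex.Re w - complex.Im z * complex.Im w /\
   complex.Im (z * w) = complex.Re z * complex.Im w + complex.Im z * complex.Re w.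
  by case: z => z1 z2; case: w => w1 w2.
have sum_pair (F : 'I_m -> L2C R d) : \sum_r F r = (\sum_r (F r).1, \sum_r (F r).2).
  elim: (index_enum _) => [|r s IH]; first by rewrite !big_nil.
  by rewrite !big_cons IH.
have delta (F : 'I_m -> R) : (forall j, F j = (i == j)%:R) -> \sum_j F j *: v j = v i.
  move=> FE; rewrite (bigD1 i)//= FE eqxx scale1r big1 ?addr0// => j ij.
  by rewrite FE eq_sym (negbTE ij) scale0r.
rewrite sum_pair /complexify; congr pair => /=.
  have -> : \sum_r (complex.Re (invmx P i r) *: a r - complex.Im (invmx P i r) *: b r) =
      \sum_j complex.Re (\sum_r invmx P i r * P r j) *: v j.
    under [RHS]eq_bigr do rewrite (Re_sum _).1 scaler_suml.
    rewrite [RHS]exchange_big/=; apply: eq_bigr => r _; rewrite !scaler_sumr -sumrB.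
    by apply: eq_bigr => j _; rewrite !scalerA -scalerBl (ReM _ _).1.
  by rewrite delta// => j; rewrite QP; case: (i == j).
have -> : \sum_r (complex.Re (invmx P i r) *: b r + complex.Im (invmx P i r) *: a r) =
    \sum_j complex.Im (\sum_r invmx P i r * P r j) *: v j.
  under [RHS]eq_bigr do rewrite (Re_sum _).2 scaler_suml.
  rewrite [RHS]exchange_big/=; apply: eq_bigr => r _; rewrite !scaler_sumr -big_split/=.
  by apply: eq_bigr => j _; rewrite !scalerA -scalerDl (ReM _ _).2.
by rewrite big1// => j _; rewrite QP; case: (i == j); rewrite /= scale0r.
Qed.

End complex_span.

(** * Full measure of H^1 and E *)

Lemma probability_ae (dT : measure_display) (T : measurableType dT) (R : realType)
    (P : probability T R) (A : set T) : measurable A -> {ae P, forall x, A x} -> P A = 1%E.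
Proof.
move=> mA [N [mN N0 AN]].
have C0 : P (~` A) = 0%E.
  by apply/eqP; rewrite -measure_le0 -N0; apply: le_measure; rewrite ?inE//; exact: measurableC.
rewrite -(setCK A) probability_setC; last exact: measurableC.
by rewrite C0 sube0.
Qed.

Lemma probability_aeI (dT : measure_display) (T : measurableType dT) (R : realType)
    (P : probability T R) (A B : set T) : measurable A -> measurable B ->
  {ae P, forall x, A x} -> {ae P, forall x, B x} -> P (A `&` B) = 1%E.
Proof.
move=> mA mB aA aB; apply: probability_ae; first exact: measurableI.
by apply: filterS2 aA aB => x ? ?; split.
Qed.

(* Each eigenspace of cov with positive eigenvalue is finite dimensional,
   contained in H^1 and invariant under u . grad. *)
Lemma eigenspace_realE (R : realType) (d : nat)
    (u : 'rV[R]_d -> 'rV[R]_d)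
    (u_periodic : periodic2pi u) (u_lipschitz : lipschitz u)
    (u_divergence_free : divergence_free u)
    (Phi : R -> 'rV[R]_d -> 'rV[R]_d) (Phi_flow : is_flow u Phi)
    (mu0 : probability (borelL2 R d) R)
    (mu0_invariant : invariant_measure mu0 (transport Phi))
    (mu0_H1 : (\int[mu0]_zeta (H1norm zeta ^+ 2) < +oo)%E) (lambda : R) (x : L2 R d) :
  0 < lambda -> eigenspace (@ip R d) (cov mu0) lambda x -> realE u x.
Proof.
move=> l0 Ex.
have sE := subspace_eigenspace (@ipDf R d) (@ipZf R d)
  (@covC R d mu0) (covDl mu0_H1) (covZl mu0_H1) lambda.
have [m [v [ov Vv Vspan]]] := eigenspace_basis (@ip_sym R d) (@ipDf R d) (@ipZf R d) (@ip_normE R d)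
  (@covC R d mu0) (covDl mu0_H1) (covZl mu0_H1) (cov_trace mu0_H1) l0.
have [_ _ EZ] := sE.
pose V (i : 'I_m) := v i.
have VE i : eigenspace (@ip R d) (cov mu0) lambda (V i) by exact: Vv.
have sob y : eigenspace (@ip R d) (cov mu0) lambda y -> sobolev y.
  by move=> Ey; exact: (eigenspace_sobolev mu0_H1 l0 Ey).
have /choice[h hh] := fun i => sobolev_weak_advection u_periodic u_lipschitz u_divergence_free (sob _ (VE i)).
pose Mx : 'M[R]_m := \matrix_(i, j) ip (h i) (V j).
have realV i : realE u (V i).
  apply: (invariant_realE u_periodic u_lipschitz u_divergence_free (h := h) (M := Mx)) => //.
  - by move=> c; apply: sob; apply: (subspace_sum _ sE) => k; exact: EZ.
  - move=> k; rewrite [LHS]Vspan; first by apply: eq_bigr => j _; rewrite mxE.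
    exact: (eigenspace_advection u_periodic u_lipschitz u_divergence_free Phi_flow mu0_invariant mu0_H1 l0 (VE k) (hh k)).
  - move=> k j; rewrite !mxE (weak_advection_antisym u_periodic u_lipschitz u_divergence_free (sob _ (VE k)) (hh k) (hh j)).
    by rewrite ip_sym.
have [_ _ KZ] := subspace_realE u.
by rewrite (Vspan x Ex); apply: (subspace_sum _ (subspace_realE u)) => i; apply: KZ; exact: (realV i).
Qed.

Theorem corollary2p4 (R : realType) (d : nat) (d_ge2 : (2 <= d)%N)
    (u : 'rV[R]_d -> 'rV[R]_d)
    (u_periodic : periodic2pi u) (u_lipschitz : lipschitz u)
    (u_divergence_free : divergence_free u)
    (Phi : R -> 'rV[R]_d -> 'rV[R]_d) (Phi_flow : is_flow u Phi)
    (mu0 : probability (borelL2 R d) R)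
    (mu0_invariant : invariant_measure mu0 (transport Phi))
    (mu0_H1 : (\int[mu0]_zeta (H1norm zeta ^+ 2) < +oo)%E) :
  mu0 (@H1 R d `&` [set f | spaceE u (complexify f)]) = 1%E /\
  [set complexify f | f in spt mu0] `<=` spaceE u.
Proof.
have mE : measurable [set z : borelL2 R d | (energy z < +oo)%E].
  have -> : [set z : borelL2 R d | (energy z < +oo)%E] = ~` (@energy R d @^-1` [set +oo%E]).
    by apply/seteqP; split => z /=; rewrite ltey => /eqP.
  apply: measurableC; rewrite -[X in measurable X]setTI.
  by apply: measurable_energy => //; exact: emeasurable_set1.
(* This shows that [H1] is Borel, so that the almost sure statement yields the value of mu0 on
   it. *)
have HE : @H1 R d = [set z | (energy z < +oo)%E].
  apply/seteqP; split => z /=; last by move=> /sobolev_energy/H1P.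
  move=> /H1P[M hM]; exact: le_lt_trans (energy_le hM) (ltry _).
have mK : measurable (realE u : set (borelL2 R d)).
  rewrite -(setCK (realE u)); apply: measurableC; apply: sub_sigma_algebra => /=.
  by rewrite openC; exact: closed_realE.
have aeK : {ae mu0, forall z, realE u z}.
  have h := ae_of_eigenvectors mu0_H1 (@closed_realE R d u) (subspace_realE u).
  apply: h => lambda v; exact: (eigenspace_realE u_periodic u_lipschitz u_divergence_free Phi_flow mu0_invariant mu0_H1).
split.
  by rewrite HE; exact: (probability_aeI mE mK (ae_sobolev mu0_H1) aeK).
(* [realE u] is one of the closed sets of measure one whose intersection is the support. *)
move=> _ [f fspt <-]; apply: (fspt (realE u)); split; first exact: closed_realE.
exact: probability_ae.
Qed.
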